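(* Let $\mu_1,\mu_2\in\mathbb R$ and $x_1,x_2\in\mathbb Z$. (a) For $x_1,x_2<0$, $$\lim_{\epsilon\downarrow0}\epsilon^{x_1-x_2}\mathcal K^\epsilon(x_1,\mu_1,x_2,\mu_2)=-\chi_{\mu_1<\mu_2}\chi_{x_1\le x_2}(\mu_2-\mu_1)^{x_2-x_1}+\frac1{(2\pi i)^2}\oint_{\Gamma_0}\int_\Sigma\frac{e^{\mu_2z+\frac12z^2}}{e^{\mu_1w+\frac12w^2}}\,\frac{w^{x_1}}{z^{x_2+1}}\,\frac{dz\,dw}{w-z}.$$ (b) For $x_1,x_2\ge0$, $$\lim_{\epsilon\downarrow0}\epsilon^{x_2-x_1}\mathcal K^\epsilon(x_1,\mu_1,x_2,\mu_2)=-\chi_{\mu_1<\mu_2}\chi_{x_2\le x_1}(\mu_2-\mu_1)^{x_1-x_2}+\frac1{(2\pi i)^2}\oint_{\Gamma_0}\int_\Sigma\frac{e^{\mu_2z+\frac12z^2}}{e^{\mu_1w+\frac12w^2}}\,\frac{z^{x_2}}{w^{x_1+1}}\,\frac{dz\,dw}{w-z}.$$ (c) Moreover, the limit of the kernel as $\epsilon\downarrow0$ vanishes if neither of the two conditions on $x_1$ and $x_2$ (namely $x_1,x_2<0$ or $x_1,x_2\ge0$) is satisfied.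
   Context: $\chi_{A}=1$ if the condition $A$ holds and $0$ otherwise. For $\epsilon>0$, $x_1,x_2\in\mathbb Z$, $\mu_1,\mu_2\in\mathbb R$ the kernel is $$\mathcal K^{\epsilon}(x_1,\mu_1,x_2,\mu_2)=-\frac{\chi_{\mu_1<\mu_2}}{2\pi i}\oint_{\Gamma_0}e^{\epsilon(\mu_2-\mu_1)(w+1/w)}w^{x_1-x_2-1}\,dw+\frac1{(2\pi i)^2}\oint_{\Gamma_0}\int_{\Sigma\cup\Sigma^{-1}}\frac{e^{\epsilon\mu_2(z+\frac1z)+\frac{\epsilon^2}{2}(z+\frac1z)^2}\,w^{x_1}}{e^{\epsilon\mu_1(w+\frac1w)+\frac{\epsilon^2}{2}(w+\frac1w)^2}\,z^{x_2}}\,\frac{dz\,dw}{z(w-z)} .$$ $\Gamma_0$ is a contour encircling the origin with counter-clockwise orientation. $\Sigma$ is a contour connecting $-i\infty$ to $i\infty$ that does not intersect $\Gamma_0$, stays in the right half-plane and lies to the right of $\Gamma_0$ (outside it); it is traversed from $+i\infty$ to $-i\infty$. $\Sigma^{-1}$ is the image of $\Sigma$ under $z\mapsto1/z$, with the induced orientation (a counter-clockwise loop through $0$), lying inside $\Gamma_0$.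
   Formalization: In (a),(b) the power (μ2−μ1)^n, n=|x1−x2|, is divided by n!. In (c) the kernel is first multiplied by ε^{g(x1)−g(x2)}, g(x)=x for x<0, g(x)=−x−1 for x≥0, as the unscaled limit need not vanish. The ends ±i∞ of Σ mean Re z/Im z→0. *)

(* Defs.v *)
From Stdlib Require Import Reals ZArith.
From Coquelicot Require Import Coquelicot.

Open Scope R_scope.

Definition chi {A B : Prop} (d : {A} + {B}) : R := if d then 1 else 0.

Definition Cexp (z : C) : C := (RtoC (exp (Re z)) * (cos (Im z), sin (Im z)))%C.

Definition CpowZ (z : C) (n : Z) : C :=
  match n with
  | Z0 => RtoC 1
  | Zpos p => (z ^ Pos.to_nat p)%C
  | Zneg p => (/ z ^ Pos.to_nat p)%C
  end.

Definition two_pi_i : C := (RtoC (2 * PI) * Ci)%C.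

(** * Paths and contour integrals *)

(* Componentwise, because [Derive] is real-valued.  At the finitely many corners
   of a piecewise C1 path the value is irrelevant to the integrals below. *)
Definition velocity (g : R -> C) (t : R) : C :=
  (Derive (fun s => Re (g s)) t, Derive (fun s => Im (g s)) t).

Definition C1_path (h : R -> C) : Prop :=
  forall t : R,
    ex_derive (fun s => Re (h s)) t /\ ex_derive (fun s => Im (h s)) t /\
    continuous (velocity h) t.

(* C1 up to the end points of [a, b] is expressed by the existence of a C1
   extension to the whole line. *)
Inductive piecewise_C1 (g : R -> C) : R -> R -> Prop :=
  | piecewise_C1_one (a b : R) (h : R -> C) :
      a <= b -> C1_path h -> (forall t, a <= t <= b -> g t = h t) ->
      piecewise_C1 g a b
  | piecewise_C1_cat (a b c : R) :
      piecewise_C1 g a b -> piecewise_C1 g b c -> piecewise_C1 g a c.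

(* Closed contours are parametrised by [0, 1]. *)
Definition loop_int (g : R -> C) (f : C -> C) : C :=
  RInt (V := C_R_CompleteNormedModule) (fun t => (f (g t) * velocity g t)%C) 0 1.

(* Infinite contours are parametrised by the whole real line. *)
Definition line_int (g : R -> C) (f : C -> C) : C :=
  RInt_gen (V := C_R_CompleteNormedModule) (fun t => (f (g t) * velocity g t)%C)
    (Rbar_locally m_infty) (Rbar_locally p_infty).

Definition inv_path (g : R -> C) (t : R) : C := (/ g t)%C.

Definition winding (g : R -> C) (p : C) : C :=
  (loop_int g (fun w => / (w - p)) / two_pi_i)%C.

(** * Admissible contours *)

(* A closed contour going once counter-clockwise around the origin. *)
Record encircles_origin (Gamma : R -> C) : Prop := {
  loop_C1 : piecewise_C1 Gamma 0 1;
  loop_closed : Gamma 0 = Gamma 1;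
  loop_avoids_origin : forall t, 0 <= t <= 1 -> Gamma t <> RtoC 0;
  loop_winding_origin : winding Gamma (RtoC 0) = RtoC 1
}.

(* A contour in the right half-plane traversed from +i oo to -i oo.  The end
   points are understood as directions: the argument tends to +-PI/2. *)
Record from_pioo_to_mioo (Sigma : R -> C) : Prop := {
  line_C1 : forall a b, a <= b -> piecewise_C1 Sigma a b;
  line_right : forall t, 0 < Re (Sigma t);
  line_start :
    filterlim (fun t => Im (Sigma t)) (Rbar_locally m_infty) (Rbar_locally p_infty);
  line_end :
    filterlim (fun t => Im (Sigma t)) (Rbar_locally p_infty) (Rbar_locally m_infty);
  line_start_dir :
    filterlim (fun t => Re (Sigma t) / Im (Sigma t)) (Rbar_locally m_infty) (locally 0);
  line_end_dir :
    filterlim (fun t => Re (Sigma t) / Im (Sigma t)) (Rbar_locally p_infty) (locally 0)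
}.

(* "Outside" and "inside" [Gamma] mean winding number 0 and 1. *)
Record admissible (Gamma Sigma : R -> C) : Prop := {
  adm_loop : encircles_origin Gamma;
  adm_line : from_pioo_to_mioo Sigma;
  adm_disjoint : forall s t, 0 <= s <= 1 -> Gamma s <> Sigma t;
  adm_outside : forall t, winding Gamma (Sigma t) = RtoC 0;
  adm_inv_disjoint : forall s t, 0 <= s <= 1 -> Gamma s <> inv_path Sigma t;
  adm_inv_inside : forall t, winding Gamma (inv_path Sigma t) = RtoC 1
}.

(** * The kernel *)

Definition kernel_weight (eps mu : R) (z : C) : C :=
  Cexp (RtoC (eps * mu) * (z + / z) + RtoC (eps ^ 2 / 2) * (z + / z) ^ 2)%C.

Definition kernel_integrand (eps : R) (x1 : Z) (mu1 : R) (x2 : Z) (mu2 : R)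
    (w z : C) : C :=
  ((kernel_weight eps mu2 z * CpowZ w x1) / (kernel_weight eps mu1 w * CpowZ z x2)
   * / (z * (w - z)))%C.

(* The double integral is iterated with the [z]-integral inside. *)
Definition kernel (Gamma Sigma : R -> C) (eps : R) (x1 : Z) (mu1 : R) (x2 : Z)
    (mu2 : R) : C :=
  (- (RtoC (chi (Rlt_dec mu1 mu2)) / two_pi_i)
     * loop_int Gamma (fun w =>
         Cexp (RtoC (eps * (mu2 - mu1)) * (w + / w)) * CpowZ w (x1 - x2 - 1))
   + / two_pi_i ^ 2
     * loop_int Gamma (fun w =>
         line_int Sigma (kernel_integrand eps x1 mu1 x2 mu2 w)
         + line_int (inv_path Sigma) (kernel_integrand eps x1 mu1 x2 mu2 w)))%C.

(** * The limits *)

Definition gauss_weight (mu : R) (z : C) : C :=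
  Cexp (RtoC mu * z + RtoC (1 / 2) * z ^ 2)%C.

(* The factorial comes from the residue
   [w^n] exp (eps d (w + 1/w)) = (eps d)^n / n! + O(eps^(n+2)). *)
Definition divided_power (d : R) (n : Z) : R :=
  powerRZ d n / INR (fact (Z.to_nat n)).

Definition limit_neg (Gamma Sigma : R -> C) (x1 : Z) (mu1 : R) (x2 : Z) (mu2 : R) : C :=
  (- RtoC (chi (Rlt_dec mu1 mu2) * chi (Z_le_dec x1 x2)
           * divided_power (mu2 - mu1) (x2 - x1))
   + / two_pi_i ^ 2
     * loop_int Gamma (fun w => line_int Sigma (fun z =>
         gauss_weight mu2 z / gauss_weight mu1 w
         * (CpowZ w x1 / CpowZ z (x2 + 1)) * / (w - z))))%C.

Definition limit_nonneg (Gamma Sigma : R -> C) (x1 : Z) (mu1 : R) (x2 : Z) (mu2 : R) : C :=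
  (- RtoC (chi (Rlt_dec mu1 mu2) * chi (Z_le_dec x2 x1)
           * divided_power (mu2 - mu1) (x1 - x2))
   + / two_pi_i ^ 2
     * loop_int Gamma (fun w => line_int Sigma (fun z =>
         gauss_weight mu2 z / gauss_weight mu1 w
         * (CpowZ z x2 / CpowZ w (x1 + 1)) * / (w - z))))%C.

(* [eps^(gauge x1 - gauge x2)] is eps^(x1-x2) if x1, x2 < 0 and eps^(x2-x1) if
   x1, x2 >= 0; being symmetric under x |-> -1-x (that is, z |-> 1/z), it is the
   only conjugation by integer powers of eps with these restrictions for which
   the mixed entries of the kernel tend to 0.  Some factor is needed: without it
   the entry at x1 = 0, x2 = -2 tends to - mu1 exp (- mu2^2 / 2) / sqrt (2 PI). *)
Definition gauge (x : Z) : Z := (if Z_lt_dec x 0 then x else - x - 1)%Z.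

(* Main.v *)
Require Import Defs.
From Stdlib Require Import Reals ZArith Lra Lia Classical FunctionalExtensionality.
From Coquelicot Require Import Coquelicot.

(** Put e = eps^2. In the variables eps z and eps w the weight of the kernel reads
    exp (mu (z + e/z) + (z + e/z)^2 / 2): it depends continuously on e down to
    e = 0, where it is the Gaussian weight of the limit, and it decays like
    exp (- (Im z)^2 / 4) at the ends of Sigma uniformly in e in [0, 1]
    ([tail_ok_weight]). The limits are therefore values at e = 0 of continuous
    functions of e, once each term of the kernel has been written as a power of
    eps times an integral over fixed contours in the scaled variables.

    The part over Sigma^-1 is brought back to Sigma by z = 1/u. The weight is
    invariant under this substitution and the exponents become -1-x1 and -1-x2, so
    that both parts are values of a single function [circle_int] ([sigma_part],
    [inv_sigma_part]). In it the loop enters only through its Cauchy transform on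
    Sigma ([cauchy_int_loop_change]), and this transform is determined by winding
    numbers ([loop_cauchy_agree], [loop_cauchy_agree_inv]): the loop may be any
    circle that leaves Sigma outside. Dilating Sigma by 1/eps ([line_int_dilate])
    and then letting w run over a circle of radius of order 1/eps, respectively
    eps, gives two formulas for the same quantity,
    eps^(x2-x1) [outer_int] = eps^(x1+x2+2) [inner_int], where both factors are
    continuous at e = 0. The first one carries the nonzero limit; the second one
    shows that a term with nonnegative first exponent is smaller than its size
    eps^(x2-x1) suggests, because the singularity of w^x1 at 0 is created by the
    factor exp (- mu e/w) alone. The single integral has two such formulas as well
    ([single_part], [single_part_inv]), and its limit is the residue of
    w^(n-1) exp (d w). In each of the cases (a), (b), (c) one choice of formulas
    makes all the exponents of eps nonnegative.

    The contours are general piecewise C1 paths, and two devices take the place of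
    a global Cauchy theorem. For a path g, the integral of f over the dilated
    paths c + s (g - c) changes with s only by contributions of the end points
    ([dilation]). This scales Sigma, and it also replaces a piece of an end of
    Sigma, whose length need not be finite, by its chord, which yields convergence
    of the integrals over Sigma with bounds that depend only on the decay of the
    integrand ([tail_bound], [line_int_close]). Loops are compared by their
    moments: the integrals of w^n and of w^n / (w - u) are known for every integer
    n from the winding numbers, and the exponential of a Laurent polynomial is a
    uniform limit of Laurent polynomials on every compact subset of C \ {0}
    ([arc_int_agree]). *)

Local Open Scope R_scope.

(** * Complex-valued continuity *)

Lemma continuous_Re {X : UniformSpace} (f : X -> C) (x : X) :
  continuous f x -> continuous (fun y => Re (f y)) x.
Proof.
  intros H. apply (continuous_comp f fst); [exact H|].
  apply continuous_fst.
Qed.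

Lemma continuous_Im {X : UniformSpace} (f : X -> C) (x : X) :
  continuous f x -> continuous (fun y => Im (f y)) x.
Proof.
  intros H. apply (continuous_comp f snd); [exact H|].
  apply continuous_snd.
Qed.

Lemma continuous_C_pair {X : UniformSpace} (f g : X -> R) (x : X) :
  continuous f x -> continuous g x -> continuous (fun y => (f y, g y) : C) x.
Proof.
  intros Hf Hg.
  apply (continuous_comp_2 f g (fun a b => (a, b) : C)); auto.
  apply (continuous_ext (fun p => p)); [intros [a b]; reflexivity|].
  apply continuous_id.
Qed.

Lemma continuous_RtoC {X : UniformSpace} (f : X -> R) (x : X) :
  continuous f x -> continuous (fun y => RtoC (f y)) x.
Proof.
  intros H. apply continuous_C_pair; [exact H | apply continuous_const].
Qed.

Lemma continuous_Rmul {X : UniformSpace} (f g : X -> R) (x : X) :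
  continuous f x -> continuous g x -> continuous (fun y => f y * g y) x.
Proof. intros; apply (continuous_mult (K := R_AbsRing)); assumption. Qed.

Lemma continuous_Radd {X : UniformSpace} (f g : X -> R) (x : X) :
  continuous f x -> continuous g x -> continuous (fun y => f y + g y) x.
Proof. intros; apply (continuous_plus (V := R_NormedModule)); assumption. Qed.

Lemma continuous_Ropp {X : UniformSpace} (f : X -> R) (x : X) :
  continuous f x -> continuous (fun y => - f y) x.
Proof. intros; apply (continuous_opp (V := R_NormedModule)); assumption. Qed.

Lemma continuous_Cplus {X : UniformSpace} (f g : X -> C) (x : X) :
  continuous f x -> continuous g x -> continuous (fun y => f y + g y)%C x.
Proof.
  intros Hf Hg. apply continuous_C_pair.
  - apply continuous_Radd; now apply continuous_Re.
  - apply continuous_Radd; now apply continuous_Im.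
Qed.

Lemma continuous_Copp {X : UniformSpace} (f : X -> C) (x : X) :
  continuous f x -> continuous (fun y => - f y)%C x.
Proof.
  intros Hf. apply continuous_C_pair.
  - now apply continuous_Ropp, continuous_Re.
  - now apply continuous_Ropp, continuous_Im.
Qed.

Lemma continuous_Cminus {X : UniformSpace} (f g : X -> C) (x : X) :
  continuous f x -> continuous g x -> continuous (fun y => f y - g y)%C x.
Proof.
  intros Hf Hg. apply continuous_Cplus; [exact Hf | now apply continuous_Copp].
Qed.

Lemma continuous_Cmult {X : UniformSpace} (f g : X -> C) (x : X) :
  continuous f x -> continuous g x -> continuous (fun y => f y * g y)%C x.
Proof.
  intros Hf Hg. apply continuous_C_pair.
  - apply (continuous_Radd (fun y => Re (f y) * Re (g y))
             (fun y => - (Im (f y) * Im (g y)))).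
    + apply continuous_Rmul; now apply continuous_Re.
    + apply continuous_Ropp, continuous_Rmul; now apply continuous_Im.
  - apply continuous_Radd; apply continuous_Rmul.
    + now apply continuous_Re.
    + now apply continuous_Im.
    + now apply continuous_Im.
    + now apply continuous_Re.
Qed.

Lemma Re_Im_sqr_pos (z : C) : z <> RtoC 0 -> 0 < Re z ^ 2 + Im z ^ 2.
Proof.
  intros Hz. rewrite <- Cmod2_alt.
  apply pow_lt, Cmod_gt_0, Hz.
Qed.

Lemma continuous_Cinv {X : UniformSpace} (f : X -> C) (x : X) :
  continuous f x -> f x <> RtoC 0 -> continuous (fun y => / f y)%C x.
Proof.
  intros Hf Hx.
  assert (Hd : continuous (fun y => / (Re (f y) ^ 2 + Im (f y) ^ 2)) x).
  { apply (continuous_comp (fun y => Re (f y) ^ 2 + Im (f y) ^ 2) Rinv).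
    - apply continuous_Radd.
      + apply continuous_Rmul; [now apply continuous_Re|].
        apply continuous_Rmul; [now apply continuous_Re | apply continuous_const].
      + apply continuous_Rmul; [now apply continuous_Im|].
        apply continuous_Rmul; [now apply continuous_Im | apply continuous_const].
    - apply continuous_Rinv.
      apply Rgt_not_eq, Re_Im_sqr_pos, Hx. }
  apply continuous_C_pair; apply continuous_Rmul; try exact Hd.
  - now apply continuous_Re.
  - apply continuous_Ropp. now apply continuous_Im.
Qed.

Lemma continuous_Cdiv {X : UniformSpace} (f g : X -> C) (x : X) :
  continuous f x -> continuous g x -> g x <> RtoC 0 ->
  continuous (fun y => f y / g y)%C x.
Proof.
  intros Hf Hg Hx. apply continuous_Cmult; [exact Hf | now apply continuous_Cinv].
Qed.

Lemma continuous_Cpow {X : UniformSpace} (f : X -> C) (n : nat) (x : X) :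
  continuous f x -> continuous (fun y => f y ^ n)%C x.
Proof.
  intros Hf. induction n as [|n IH]; simpl.
  - apply continuous_const.
  - now apply continuous_Cmult.
Qed.

Lemma continuous_CpowZ {X : UniformSpace} (f : X -> C) (n : Z) (x : X) :
  continuous f x -> f x <> RtoC 0 -> continuous (fun y => CpowZ (f y) n) x.
Proof.
  intros Hf Hx. destruct n as [|p|p]; unfold CpowZ.
  - apply continuous_const.
  - now apply continuous_Cpow.
  - apply continuous_Cinv; [now apply continuous_Cpow | now apply Cpow_nz].
Qed.

Lemma continuous_Cexp {X : UniformSpace} (f : X -> C) (x : X) :
  continuous f x -> continuous (fun y => Cexp (f y)) x.
Proof.
  intros Hf. unfold Cexp. apply continuous_Cmult.
  - apply continuous_RtoC. apply (continuous_comp (fun y => Re (f y)) exp).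
    + now apply continuous_Re.
    + apply continuous_exp.
  - apply continuous_C_pair.
    + apply (continuous_comp (fun y => Im (f y)) cos);
        [now apply continuous_Im | apply continuous_cos].
    + apply (continuous_comp (fun y => Im (f y)) sin);
        [now apply continuous_Im | apply continuous_sin].
Qed.

Lemma continuous_Cmod {X : UniformSpace} (f : X -> C) (x : X) :
  continuous f x -> continuous (fun y => Cmod (f y)) x.
Proof.
  intros Hf. apply (continuous_comp f Cmod); [exact Hf|].
  apply (continuous_ext (fun z : C_R_NormedModule => norm z)).
  - intros z. symmetry. apply Cmod_norm.
  - apply (filterlim_norm (V := C_R_NormedModule)).
Qed.

(** * The complex exponential and integer powers *)

Lemma Cexp_plus (a b : C) : Cexp (a + b) = (Cexp a * Cexp b)%C.
Proof.
  destruct a as [a1 a2], b as [b1 b2]. unfold Cexp, Cmult, RtoC; simpl.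
  rewrite exp_plus, cos_plus, sin_plus. f_equal; ring.
Qed.

Lemma Cexp_0 : Cexp (RtoC 0) = RtoC 1.
Proof.
  unfold Cexp, RtoC, Cmult; simpl. rewrite exp_0, cos_0, sin_0. f_equal; ring.
Qed.

Lemma Cmod_Cexp (z : C) : Cmod (Cexp z) = exp (Re z).
Proof.
  unfold Cexp. rewrite Cmod_mult, Cmod_R, Rabs_pos_eq by (left; apply exp_pos).
  generalize (Im z); intros y.
  replace (Cmod _) with 1; [ring|].
  unfold Cmod; cbn [fst snd]. rewrite <- sqrt_1. f_equal.
  rewrite <- (sin2_cos2 y). unfold Rsqr. ring.
Qed.

Lemma Cexp_neq_0 (z : C) : Cexp z <> RtoC 0.
Proof.
  apply Cmod_gt_0. rewrite Cmod_Cexp. apply exp_pos.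
Qed.

Lemma Cexp_opp (z : C) : Cexp (- z) = (/ Cexp z)%C.
Proof.
  assert (H : (Cexp (- z) * Cexp z)%C = RtoC 1).
  { rewrite <- Cexp_plus, <- Cexp_0. f_equal. ring. }
  transitivity (Cexp (- z) * Cexp z * / Cexp z)%C.
  - field. apply Cexp_neq_0.
  - rewrite H. ring.
Qed.

Lemma CpowZ_of_nat (z : C) (n : nat) : CpowZ z (Z.of_nat n) = (z ^ n)%C.
Proof.
  destruct n as [|n]; [reflexivity|].
  cbn [CpowZ Z.of_nat]. now rewrite SuccNat2Pos.id_succ.
Qed.

Lemma CpowZ_opp_of_nat (z : C) (n : nat) : CpowZ z (- Z.of_nat n) = (/ z ^ n)%C.
Proof.
  destruct n as [|n].
  - simpl. field; try apply C1_nz.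
  - cbn [CpowZ Z.of_nat Z.opp]. now rewrite SuccNat2Pos.id_succ.
Qed.

Lemma CpowZ_neq_0 (z : C) (n : Z) : z <> RtoC 0 -> CpowZ z n <> RtoC 0.
Proof.
  intros Hz. destruct n as [|p|p]; unfold CpowZ.
  - apply C1_nz.
  - now apply Cpow_nz.
  - apply Cmod_gt_0. rewrite Cmod_inv by now apply Cpow_nz.
    apply Rinv_0_lt_compat, Cmod_gt_0. now apply Cpow_nz.
Qed.

Lemma CpowZ_succ (z : C) (n : Z) :
  z <> RtoC 0 -> CpowZ z (n + 1) = (z * CpowZ z n)%C.
Proof.
  intros Hz. destruct (Z_lt_le_dec n 0) as [Hn|Hn].
  - replace n with (- Z.of_nat (S (Z.to_nat (- n - 1))))%Z by lia.
    set (k := Z.to_nat (- n - 1)).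
    replace (- Z.of_nat (S k) + 1)%Z with (- Z.of_nat k)%Z by lia.
    rewrite !CpowZ_opp_of_nat, Cpow_S. field.
    split; [now apply Cpow_nz | exact Hz].
  - replace n with (Z.of_nat (Z.to_nat n)) by lia.
    set (k := Z.to_nat n).
    replace (Z.of_nat k + 1)%Z with (Z.of_nat (S k)) by lia.
    rewrite !CpowZ_of_nat, Cpow_S. reflexivity.
Qed.

Lemma CpowZ_pred (z : C) (n : Z) :
  z <> RtoC 0 -> CpowZ z (n - 1) = (/ z * CpowZ z n)%C.
Proof.
  intros Hz. replace n with (n - 1 + 1)%Z at 2 by lia.
  rewrite (CpowZ_succ z (n - 1)) by exact Hz. now field.
Qed.

(** Recurrences in an integer exponent run in both directions. *)
Lemma Z_step_ind (P : Z -> Prop) :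
  P 0%Z -> (forall n, P n -> P (n + 1)%Z) -> (forall n, P n -> P (n - 1)%Z) ->
  forall n, P n.
Proof.
  intros H0 Hs Hp. apply Z.bi_induction.
  - intros a b ->. tauto.
  - exact H0.
  - intros n. split; intros H.
    + now rewrite <- Z.add_1_r; apply Hs.
    + replace n with (Z.succ n - 1)%Z by lia. now apply Hp.
Qed.

Lemma CpowZ_add (z : C) (m n : Z) :
  z <> RtoC 0 -> CpowZ z (m + n) = (CpowZ z m * CpowZ z n)%C.
Proof.
  intros Hz. revert m. apply Z_step_ind.
  - simpl. ring.
  - intros m IH. replace (m + 1 + n)%Z with (m + n + 1)%Z by lia.
    rewrite !CpowZ_succ, IH by exact Hz. ring.
  - intros m IH. replace (m - 1 + n)%Z with (m + n - 1)%Z by lia.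
    rewrite !CpowZ_pred, IH by exact Hz. ring.
Qed.

Lemma CpowZ_opp (z : C) (n : Z) :
  z <> RtoC 0 -> CpowZ z (- n) = (/ CpowZ z n)%C.
Proof.
  intros Hz.
  transitivity (CpowZ z (- n) * CpowZ z n * / CpowZ z n)%C.
  - field. now apply CpowZ_neq_0.
  - rewrite <- CpowZ_add by exact Hz. replace (- n + n)%Z with 0%Z by lia.
    simpl. ring.
Qed.

Lemma Cinv_neq_0 (z : C) : z <> RtoC 0 -> (/ z)%C <> RtoC 0.
Proof.
  intros Hz. apply Cmod_gt_0. rewrite Cmod_inv by exact Hz.
  now apply Rinv_0_lt_compat, Cmod_gt_0.
Qed.

Lemma CpowZ_inv (z : C) (n : Z) :
  z <> RtoC 0 -> CpowZ (/ z) n = CpowZ z (- n).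
Proof.
  intros Hz. rewrite CpowZ_opp by exact Hz.
  assert (Hi := Cinv_neq_0 z Hz). revert n. apply Z_step_ind.
  - simpl. field; try apply C1_nz.
  - intros n IH. rewrite !CpowZ_succ, IH by assumption. field.
    split; [now apply CpowZ_neq_0 | exact Hz].
  - intros n IH. rewrite !CpowZ_pred, IH by assumption. field.
    split; [exact Hz | now apply CpowZ_neq_0].
Qed.

Lemma CpowZ_mult (a z : C) (n : Z) :
  a <> RtoC 0 -> z <> RtoC 0 -> CpowZ (a * z) n = (CpowZ a n * CpowZ z n)%C.
Proof.
  intros Ha Hz. assert (Haz := Cmult_neq_0 _ _ Ha Hz). revert n. apply Z_step_ind.
  - simpl. ring.
  - intros n IH. rewrite !CpowZ_succ, IH by assumption. ring.
  - intros n IH. rewrite !CpowZ_pred, IH by assumption. field. tauto.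
Qed.

Lemma RtoC_neq_0 (x : R) : x <> 0 -> RtoC x <> RtoC 0.
Proof. intros H E. apply H. now apply RtoC_inj. Qed.

Lemma CpowZ_RtoC (x : R) (n : Z) :
  x <> 0 -> CpowZ (RtoC x) n = RtoC (powerRZ x n).
Proof.
  intros Hx. assert (Hc := RtoC_neq_0 x Hx). revert n. apply Z_step_ind.
  - reflexivity.
  - intros n IH. rewrite CpowZ_succ, IH, powerRZ_add by assumption.
    rewrite powerRZ_1, RtoC_mult. ring.
  - intros n IH. rewrite CpowZ_pred, IH by assumption.
    unfold Z.sub. rewrite powerRZ_add by assumption.
    rewrite RtoC_mult. replace (powerRZ x (- (1))) with (/ x).
    + rewrite RtoC_inv by exact Hx. ring.
    + simpl. rewrite Rmult_1_r. reflexivity.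
Qed.

(** * Integrals of complex-valued functions *)

Ltac Cring := match goal with |- @eq _ ?x ?y => change (@eq C x y); ring end.
Ltac Cfield := match goal with |- @eq _ ?x ?y => change (@eq C x y); field end.

Notation is_CInt := (is_RInt (V := C_R_NormedModule)).
Notation ex_CInt := (ex_RInt (V := C_R_NormedModule)).
(** A constant rather than a notation: its type is then literally [C], which is
    where [ring] and [field] look for their structure. *)
Definition CInt (f : R -> C) (a b : R) : C :=
  RInt (V := C_R_CompleteNormedModule) f a b.

Lemma CInt_correct (f : R -> C) (a b : R) :
  ex_CInt f a b -> is_CInt f a b (CInt f a b).
Proof. apply (RInt_correct (V := C_R_CompleteNormedModule)). Qed.

Lemma is_CInt_unique (f : R -> C) (a b : R) (l : C) :
  is_CInt f a b l -> CInt f a b = l.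
Proof. apply (is_RInt_unique (V := C_R_CompleteNormedModule)). Qed.

Lemma is_CInt_Cmult (c : C) (f : R -> C) (a b : R) (l : C) :
  is_CInt f a b l -> is_CInt (fun t => c * f t)%C a b (c * l)%C.
Proof.
  intros H.
  assert (H1 := is_RInt_fct_extend_fst (U := R_NormedModule) (V := R_NormedModule) _ _ _ _ H).
  assert (H2 := is_RInt_fct_extend_snd (U := R_NormedModule) (V := R_NormedModule) _ _ _ _ H).
  apply (is_RInt_fct_extend_pair (U := R_NormedModule) (V := R_NormedModule)); simpl.
  - apply (is_RInt_minus (V := R_NormedModule));
    apply (is_RInt_scal (V := R_NormedModule)); assumption.
  - apply (is_RInt_plus (V := R_NormedModule));
    apply (is_RInt_scal (V := R_NormedModule)); assumption.
Qed.

Lemma is_CInt_plus (f g : R -> C) (a b : R) (lf lg : C) :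
  is_CInt f a b lf -> is_CInt g a b lg ->
  is_CInt (fun t => f t + g t)%C a b (lf + lg)%C.
Proof. apply (is_RInt_plus (V := C_R_NormedModule)). Qed.

Lemma is_CInt_minus (f g : R -> C) (a b : R) (lf lg : C) :
  is_CInt f a b lf -> is_CInt g a b lg ->
  is_CInt (fun t => f t - g t)%C a b (lf - lg)%C.
Proof. apply (is_RInt_minus (V := C_R_NormedModule)). Qed.

Lemma is_CInt_ext (f g : R -> C) (a b : R) (l : C) :
  a <= b -> (forall t, a < t < b -> f t = g t) ->
  is_CInt f a b l -> is_CInt g a b l.
Proof.
  intros Hab H. apply is_RInt_ext. intros t.
  rewrite Rmin_left, Rmax_right by exact Hab. apply H.
Qed.

Lemma CInt_ext (f g : R -> C) (a b : R) :
  a <= b -> (forall t, a < t < b -> f t = g t) -> CInt f a b = CInt g a b.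
Proof.
  intros Hab H. apply (RInt_ext (V := C_R_CompleteNormedModule)). intros t.
  rewrite Rmin_left, Rmax_right by exact Hab. apply H.
Qed.

Lemma ex_CInt_continuous (f : R -> C) (a b : R) :
  a <= b -> (forall t, a <= t <= b -> continuous f t) -> ex_CInt f a b.
Proof.
  intros Hab H. apply (ex_RInt_continuous (V := C_R_CompleteNormedModule)).
  intros t. rewrite Rmin_left, Rmax_right by exact Hab. apply H.
Qed.

Lemma Cmod_CInt_le (f : R -> C) (a b : R) (l : C) (g : R -> R) (lg : R) :
  a <= b -> (forall t, a <= t <= b -> Cmod (f t) <= g t) ->
  is_CInt f a b l -> is_RInt g a b lg -> Cmod l <= lg.
Proof.
  intros Hab H Hf Hg. rewrite Cmod_norm.
  apply (norm_RInt_le (V := C_R_NormedModule) f g a b l lg); auto.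
  intros t Ht. rewrite <- Cmod_norm. now apply H.
Qed.

(** ** Uniformity over a compact parameter interval *)

(** The tube lemma for the slice {x0} x [a, b]; it turns joint continuity into
    continuity in x that is uniform in t. *)
Lemma tube {X : UniformSpace} (x0 : X) (P : X -> R -> Prop) (a b : R) :
  a <= b ->
  (forall t, a <= t <= b ->
     locally (x0, t) (fun q : X * R => P (fst q) (snd q))) ->
  locally x0 (fun x => forall t, a <= t <= b -> P x t).
Proof.
  intros Hab HP.
  pose (E := fun u => a <= u <= b /\
               locally x0 (fun x => forall t, a <= t <= u -> P x t)).
  (* A tube over [a, v] extends past every s that it comes close enough to. *)
  assert (Hext : forall s, a <= s <= b -> exists d : posreal,
            forall v u, E v -> s - d < v -> a <= u <= b -> u < s + d -> E u).
  { intros s Hs. destruct (HP s Hs) as [d Hd].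
    exists d. intros v u [Hv Lv] Hsv Hu Hus. split; [exact Hu|].
    assert (Hx : locally x0 (fun x => ball x0 d x)) by apply locally_ball.
    generalize (filter_and _ _ Lv Hx). apply filter_imp.
    intros x [H1 H2] t Ht.
    destruct (Rle_dec t v) as [Htv|Htv]; [apply H1; lra|].
    apply (Hd (x, t)). split; [exact H2|]. simpl.
    apply Rabs_def1; unfold minus, plus, opp; simpl; lra. }
  assert (Ha : E a).
  { split; [lra|]. assert (Haab : a <= a <= b) by lra.
    destruct (HP a Haab) as [d Hd].
    exists d. intros x Hx t Ht. apply (Hd (x, t)). split; [exact Hx|]. simpl.
    replace t with a by lra. apply ball_center. }
  destruct (completeness E) as [s [Hub Hlub]].
  { exists b. intros u [Hu _]. lra. }
  { exists a. exact Ha. }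
  assert (Hs : a <= s <= b).
  { split; [now apply Hub|]. apply Hlub. intros u [Hu _]. lra. }
  destruct (Hext s Hs) as [d Hd].
  assert (Hv : exists v, E v /\ s - d < v).
  { apply NNPP. intros Hn.
    assert (s <= s - d); [|destruct d as [d Hd0]; simpl in *; lra].
    apply Hlub. intros u Hu. destruct (Rle_dec u (s - d)) as [|Hgt]; [assumption|].
    exfalso. apply Hn. exists u. split; [exact Hu | lra]. }
  destruct Hv as [v [Ev Hv]].
  assert (Hb : E b); [|apply Hb].
  destruct (Rle_dec b s) as [Hbs|Hbs].
  - apply (Hd v b Ev Hv); destruct d as [d Hd0]; simpl in *; lra.
  - exfalso.
    assert (Hm : E (Rmin b (s + d / 2))).
    { apply (Hd v _ Ev Hv); destruct d as [d Hd0]; simpl in *;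
      unfold Rmin; destruct (Rle_dec b (s + d / 2)); lra. }
    apply Hub in Hm. revert Hm. destruct d as [d Hd0]; simpl in *.
    unfold Rmin; destruct (Rle_dec b (s + d / 2)); lra.
Qed.

Lemma ball_Cmod (x y : C) (e : R) : Cmod (y - x) < e -> ball x e y.
Proof. apply C_NormedModule_mixin_compat1. Qed.

Lemma locally_Cmod (z : C) (P : C -> Prop) :
  locally z P -> exists d, 0 < d /\ forall y, Cmod (y - z) < d -> P y.
Proof.
  intros [d Hd]. exists d. split; [apply cond_pos|].
  intros y Hy. apply Hd. now apply ball_Cmod.
Qed.

Lemma locally_Cmod_ball (z : C) (e : R) :
  0 < e -> locally z (fun y => Cmod (y - z) < e).
Proof.
  intros He. assert (He2 : 0 < e / 2) by lra.
  exists (mkposreal _ He2). intros y Hy.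
  apply C_NormedModule_mixin_compat2 in Hy. simpl in Hy.
  change (Cmod (y - z) < sqrt 2 * (e / 2)) in Hy.
  assert (Hs : sqrt 2 <= 2).
  { rewrite <- (sqrt_square 2) at 2 by lra. apply sqrt_le_1_alt. lra. }
  nra.
Qed.

Lemma continuous_Cmod_intro {X : UniformSpace} (f : X -> C) (x0 : X) :
  (forall e, 0 < e -> locally x0 (fun x => Cmod (f x - f x0) <= e)) ->
  continuous f x0.
Proof.
  intros H P HP. apply locally_Cmod in HP. destruct HP as [d [Hd HP]].
  assert (Hd2 : 0 < d / 2) by lra.
  change (locally x0 (fun x => P (f x))).
  generalize (H _ Hd2). apply filter_imp. intros x Hx. apply HP. lra.
Qed.

Lemma continuous_Cmod_elim {X : UniformSpace} (f : X -> C) (x0 : X) (e : R) :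
  continuous f x0 -> 0 < e -> locally x0 (fun x => Cmod (f x - f x0) < e).
Proof.
  intros H He. apply (H (fun y => Cmod (y - f x0) < e)).
  now apply locally_Cmod_ball.
Qed.

(** ** Piecewise continuous weights *)

(** Modelled on velocities of piecewise C1 paths, which may take any value at the
    corners. *)
Inductive pw_cont (v : R -> C) : R -> R -> Prop :=
  | pw_cont_one (a b : R) (c : R -> C) :
      a <= b -> (forall t, continuous c t) -> (forall t, a < t < b -> v t = c t) ->
      pw_cont v a b
  | pw_cont_cat (a b c : R) : pw_cont v a b -> pw_cont v b c -> pw_cont v a c.

Lemma pw_cont_le (v : R -> C) (a b : R) : pw_cont v a b -> a <= b.
Proof. induction 1; lra. Qed.

Lemma pw_cont_ex_CInt (v F : R -> C) (a b : R) :
  pw_cont v a b -> (forall t, continuous F t) ->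
  ex_CInt (fun t => F t * v t)%C a b.
Proof.
  intros Hv HF. induction Hv as [a b c Hab Hc Hvc | a b c _ IH1 _ IH2].
  - apply (ex_RInt_ext (V := C_R_NormedModule) (fun t => F t * c t)%C).
    + intros t. rewrite Rmin_left, Rmax_right by exact Hab.
      intros Ht. now rewrite Hvc.
    + apply ex_CInt_continuous; [exact Hab|]. intros t _.
      now apply continuous_Cmult.
  - now apply (ex_RInt_Chasles (V := C_R_NormedModule)) with b.
Qed.

Lemma CInt_Chasles (f : R -> C) (a b c : R) :
  ex_CInt f a b -> ex_CInt f b c -> CInt f a c = (CInt f a b + CInt f b c)%C.
Proof.
  intros H1 H2. symmetry.
  apply (RInt_Chasles (V := C_R_CompleteNormedModule) f a b c H1 H2).
Qed.

(** V is the total mass of the weight, the arc length when v is a velocity. *)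
Lemma pw_cont_mass (v : R -> C) (a b : R) :
  pw_cont v a b ->
  exists V, 0 <= V /\ forall (F : R -> C) (M : R),
    (forall t, continuous F t) -> (forall t, a <= t <= b -> Cmod (F t) <= M) ->
    Cmod (CInt (fun t => F t * v t)%C a b) <= V * M.
Proof.
  induction 1 as [a b c Hab Hc Hvc | a b c Hab [V1 [HV1 H1]] Hbc [V2 [HV2 H2]]].
  - assert (Hm : ex_RInt (fun t => Cmod (c t)) a b).
    { apply (ex_RInt_continuous (V := R_CompleteNormedModule)). intros t _.
      now apply continuous_Cmod. }
    exists (RInt (fun t => Cmod (c t)) a b). split.
    { apply RInt_ge_0; [exact Hab | exact Hm | intros; apply Cmod_ge_0]. }
    intros F M HF HM.
    rewrite (CInt_ext _ (fun t => F t * c t)%C) by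
      (try exact Hab; intros t Ht; now rewrite Hvc).
    apply (Cmod_CInt_le (fun t => F t * c t)%C a b _ (fun t => scal M (Cmod (c t)))).
    + exact Hab.
    + intros t Ht. rewrite Cmod_mult. apply Rmult_le_compat_r; [apply Cmod_ge_0|].
      now apply HM.
    + apply CInt_correct, ex_CInt_continuous; [exact Hab|]. intros t _.
      now apply continuous_Cmult.
    + rewrite Rmult_comm. apply (is_RInt_scal (V := R_NormedModule)).
      now apply (RInt_correct (V := R_CompleteNormedModule)).
  - exists (V1 + V2). split; [lra|]. intros F M HF HM.
    rewrite (CInt_Chasles _ a b c) by (apply pw_cont_ex_CInt; assumption).
    eapply Rle_trans; [apply Cmod_triangle|]. rewrite Rmult_plus_distr_r.
    apply pw_cont_le in Hab. apply pw_cont_le in Hbc.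
    apply Rplus_le_compat; [apply H1 | apply H2]; auto; intros; apply HM; lra.
Qed.

Lemma CInt_weight_minus (v F G : R -> C) (a b : R) :
  pw_cont v a b -> (forall t, continuous F t) -> (forall t, continuous G t) ->
  (CInt (fun t => F t * v t) a b - CInt (fun t => G t * v t) a b)%C
  = CInt (fun t => (F t - G t) * v t)%C a b.
Proof.
  intros Hv HF HG. symmetry. apply is_CInt_unique.
  apply (is_CInt_ext (fun t => F t * v t - G t * v t)%C).
  - now apply pw_cont_le in Hv.
  - intros; Cring.
  - apply is_CInt_minus; apply CInt_correct; now apply pw_cont_ex_CInt.
Qed.

Lemma continuous_slice {X : UniformSpace} (F : X -> R -> C) (x : X) (t : R) :
  continuous (fun q : X * R => F (fst q) (snd q)) (x, t) -> continuous (F x) t.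
Proof.
  intros H.
  apply (continuous_comp (fun s => (x, s)) (fun q : X * R => F (fst q) (snd q)));
    [|exact H].
  apply (continuous_comp_2 (fun _ : R => x) (fun s => s) (fun a b => (a, b))).
  - apply continuous_const.
  - apply continuous_id.
  - apply (continuous_ext (fun p => p)); [intros []; reflexivity | apply continuous_id].
Qed.

Lemma continuous_CInt_param {X : UniformSpace} (F : X -> R -> C) (v : R -> C)
    (a b : R) (x0 : X) :
  pw_cont v a b ->
  (forall x t, continuous (fun q : X * R => F (fst q) (snd q)) (x, t)) ->
  continuous (fun x => CInt (fun t => F x t * v t)%C a b) x0.
Proof.
  intros Hv HF. assert (Hab := pw_cont_le _ _ _ Hv).
  destruct (pw_cont_mass _ _ _ Hv) as [V [HV Hmass]].
  assert (Hsl : forall x t, continuous (F x) t).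
  { intros x t. now apply continuous_slice. }
  apply continuous_Cmod_intro. intros e He.
  assert (He' : 0 < e / (V + 1)) by (apply Rdiv_lt_0_compat; lra).
  assert (Ht : locally x0 (fun x => forall t, a <= t <= b ->
                 Cmod (F x t - F x0 t) < e / (V + 1))).
  { apply tube; [exact Hab|]. intros t _.
    assert (Hc : continuous (fun q : X * R => F (fst q) (snd q) - F x0 (snd q))%C (x0, t)).
    { apply continuous_Cminus; [apply HF|].
      apply (continuous_comp snd (F x0)); [apply continuous_snd | apply Hsl]. }
    generalize (continuous_Cmod_elim _ _ _ Hc He'). apply filter_imp.
    intros [x s]; simpl. replace (F x s - F x0 s - (F x0 t - F x0 t))%C
      with (F x s - F x0 s)%C by ring. tauto. }
  generalize Ht. apply filter_imp. intros x Hx.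
  rewrite CInt_weight_minus by auto.
  eapply Rle_trans.
  - apply (Hmass _ (e / (V + 1))).
    + intros t. now apply continuous_Cminus.
    + intros t Htab. left. now apply Hx.
  - apply Rle_trans with ((V + 1) * (e / (V + 1))); [nra|].
    right. field. lra.
Qed.

Lemma continuous_pair_swap {X Y Z : UniformSpace} (F : X * Y -> Z) (x : X) (y : Y) :
  continuous F (x, y) -> continuous (fun q : Y * X => F (snd q, fst q)) (y, x).
Proof.
  intros H. apply (continuous_comp_2 snd fst (fun a b => F (a, b)) (y, x)).
  - apply continuous_snd.
  - apply continuous_fst.
  - apply (continuous_ext F); [intros []; reflexivity | exact H].
Qed.

Lemma is_CInt_point (f : R -> C) (a : R) : is_CInt f a a (RtoC 0).
Proof. apply (is_RInt_point (V := C_R_NormedModule)). Qed.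

Lemma Cmod_CInt_const_abs (f : R -> C) (a b M : R) :
  (forall t, continuous f t) ->
  (forall t, Rmin a b <= t <= Rmax a b -> Cmod (f t) <= M) ->
  Cmod (CInt f a b) <= Rabs (b - a) * M.
Proof.
  intros Hf HM. rewrite Cmod_norm.
  apply (norm_RInt_le_const_abs (V := C_R_NormedModule) f a b).
  - intros t Ht. rewrite <- Cmod_norm. now apply HM.
  - apply CInt_correct, (ex_RInt_continuous (V := C_R_CompleteNormedModule)).
    intros t _. apply Hf.
Qed.

Lemma ex_CInt_all (f : R -> C) (a b : R) :
  (forall t, continuous f t) -> ex_CInt f a b.
Proof.
  intros Hf. apply (ex_RInt_continuous (V := C_R_CompleteNormedModule)).
  intros t _. apply Hf.
Qed.

Lemma pw_cont_1 (a b : R) : a <= b -> pw_cont (fun _ => RtoC 1) a b.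
Proof.
  intros Hab. apply pw_cont_one with (fun _ => RtoC 1); auto.
  intros t. apply continuous_const.
Qed.

Lemma continuous_CInt_param_1 {X : UniformSpace} (F : X -> R -> C) (a b : R) (x0 : X) :
  (forall x t, continuous (fun q : X * R => F (fst q) (snd q)) (x, t)) ->
  continuous (fun x => CInt (F x) a b) x0.
Proof.
  intros HF.
  assert (Hle : forall a b, a <= b -> continuous (fun x => CInt (F x) a b) x0).
  { intros u v Huv.
    apply (continuous_ext (fun x => CInt (fun t => F x t * RtoC 1)%C u v)).
    - intros x. apply CInt_ext; [exact Huv | intros; Cring].
    - apply continuous_CInt_param; [now apply pw_cont_1 | exact HF]. }
  destruct (Rle_dec a b) as [Hab|Hab]; [now apply Hle|].
  apply (continuous_ext (fun x => - CInt (F x) b a)%C).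
  - intros x.
    apply (opp_RInt_swap (V := C_R_CompleteNormedModule) (F x) b a).
    apply ex_CInt_all. intros t. now apply continuous_slice.
  - apply continuous_Copp, Hle. lra.
Qed.

(** The derivative of the other iterated integral in the same bound is the same by
    the fundamental theorem; this proves Fubini's theorem. *)
Lemma is_derive_CInt_swap (F : R -> R -> C) (v : R -> C) (a c d x : R) :
  pw_cont v c d ->
  (forall s t, continuous (fun q : R * R => F (fst q) (snd q)) (s, t)) ->
  is_derive (K := R_AbsRing) (V := C_R_NormedModule)
    (fun y => CInt (fun t => CInt (fun s => F s t) a y * v t)%C c d) x
    (CInt (fun t => F x t * v t)%C c d).
Proof.
  intros Hv HF. assert (Hcd := pw_cont_le _ _ _ Hv).
  destruct (pw_cont_mass _ _ _ Hv) as [V [HV Hmass]].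
  assert (HFs : forall s t, continuous (fun s => F s t) s).
  { intros s t. apply (continuous_slice (fun t s => F s t)).
    now apply (continuous_pair_swap (fun q : R * R => F (fst q) (snd q))). }
  assert (HFt : forall s t, continuous (F s) t).
  { intros s t. now apply continuous_slice. }
  assert (Hin : forall u w t, continuous (fun t => CInt (fun s => F s t) u w) t).
  { intros u w t. apply (continuous_CInt_param_1 (fun t s => F s t)).
    intros t' s'. now apply (continuous_pair_swap (fun q : R * R => F (fst q) (snd q))). }
  split; [apply is_linear_scal_l|].
  intros y Hy. 
  apply (is_filter_lim_locally_unique (K := R_AbsRing) (V := R_NormedModule)) in Hy.
  subst y.
  intros [e He]; simpl.
  assert (He' : 0 < e / (V + 1)) by (apply Rdiv_lt_0_compat; lra).
  assert (Ht : locally x (fun y => forall t, c <= t <= d ->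
                 Cmod (F y t - F x t) < e / (V + 1))).
  { apply tube; [exact Hcd|]. intros t _.
    assert (Hc : continuous (fun q : R * R => F (fst q) (snd q) - F x (snd q))%C (x, t)).
    { apply continuous_Cminus; [apply HF|].
      apply (continuous_comp snd (F x)); [apply continuous_snd | apply HFt]. }
    generalize (continuous_Cmod_elim _ _ _ Hc He'). apply filter_imp.
    intros [y s]; simpl. replace (F y s - F x s - (F x t - F x t))%C
      with (F y s - F x s)%C by ring. tauto. }
  destruct Ht as [r Hr]. exists r. intros y Hy.
  rewrite <- Cmod_norm.
  replace (minus _ _) with (CInt (fun t =>
    (CInt (fun s => F s t) x y - RtoC (y - x) * F x t) * v t)%C c d).
  2:{ rewrite <- CInt_weight_minus; auto.
      2:{ intros t. apply continuous_Cmult; [apply continuous_const | apply HFt]. }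
      repeat match goal with |- context [@minus ?G ?a ?b] =>
        lazymatch type of a with
        | R => fail
        | _ => lazymatch G with R_AbsRing => fail | _ =>
               change (@minus G a b) with (Cminus a b) end
        end end.
      rewrite (CInt_weight_minus v (fun t => CInt (fun s => F s t) a y)) by auto.
      unfold Cminus. f_equal.
      - apply CInt_ext; [exact Hcd|]. intros t _. f_equal.
        rewrite (CInt_Chasles (fun s => F s t) a x y) by (apply ex_CInt_all; auto).
        Cring.
      - apply (f_equal Copp). change (scal (minus y x) ?l) with (scal (y - x) l).
        etransitivity; [|symmetry; apply scal_R_Cmult].
        apply is_CInt_unique.
        apply (is_CInt_ext (fun t => RtoC (y - x) * (F x t * v t))%C);
          [exact Hcd | intros; Cring|].
        apply is_CInt_Cmult, CInt_correct. now apply pw_cont_ex_CInt. }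
  eapply Rle_trans.
  - apply (Hmass _ (Rabs (y - x) * (e / (V + 1)))).
    + intros t. apply continuous_Cminus; [apply Hin|].
      apply continuous_Cmult; [apply continuous_const | apply HFt].
    + intros t Ht.
      replace (CInt (fun s => F s t) x y - RtoC (y - x) * F x t)%C
        with (CInt (fun s => F s t - F x t)%C x y).
      * apply Cmod_CInt_const_abs.
        -- intros s. apply continuous_Cminus; [apply HFs | apply continuous_const].
        -- intros s Hs. left. apply Hr; [|exact Ht].
           revert Hy. unfold ball; simpl. unfold AbsRing_ball, abs, minus, plus, opp; simpl.
           intros Hy. revert Hs. unfold Rmin, Rmax; destruct (Rle_dec x y);
           intros Hs; apply Rabs_def1; apply Rabs_def2 in Hy; lra.
      * apply is_CInt_unique. apply is_CInt_minus.
        -- apply CInt_correct, ex_CInt_all; auto.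
        -- rewrite <- scal_R_Cmult. apply (is_RInt_const (V := C_R_NormedModule)).
  - change (norm (minus y x)) with (Rabs (y - x)).
    assert (H0 := Rabs_pos (y - x)).
    apply Rle_trans with ((V + 1) * (Rabs (y - x) * (e / (V + 1)))).
    + apply Rmult_le_compat_r; [|lra]. apply Rmult_le_pos; lra.
    + right. field. lra.
Qed.

Lemma fubini_one (F : R -> R -> C) (v : R -> C) (a b c d : R) :
  a <= b -> pw_cont v c d ->
  (forall s t, continuous (fun q : R * R => F (fst q) (snd q)) (s, t)) ->
  CInt (fun s => CInt (fun t => F s t * v t)%C c d) a b
  = CInt (fun t => CInt (fun s => F s t) a b * v t)%C c d.
Proof.
  intros Hab Hv HF. apply is_CInt_unique.
  replace (CInt (fun t => CInt (fun s => F s t) a b * v t)%C c d)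
    with (minus (G := C_R_NormedModule)
      (CInt (fun t => CInt (fun s => F s t) a b * v t)%C c d)
      (CInt (fun t => CInt (fun s => F s t) a a * v t)%C c d)).
  - apply (is_RInt_derive (V := C_R_CompleteNormedModule)
      (fun y => CInt (fun t => CInt (fun s => F s t) a y * v t)%C c d)).
    + intros x _. now apply is_derive_CInt_swap.
    + intros x _. now apply continuous_CInt_param.
  - rewrite (CInt_ext (fun t => CInt (fun s => F s t) a a * v t)%C
      (fun t => RtoC 0 * v t)%C).
    + rewrite (is_CInt_unique (fun t => RtoC 0 * v t)%C c d (RtoC 0 * CInt v c d)%C).
      * match goal with |- context[@minus ?G ?x ?y] =>
          change (@minus G x y) with (Cminus x y) end.
        Cring.
      * apply is_CInt_Cmult, CInt_correct.
        apply (ex_RInt_ext (V := C_R_NormedModule) (fun t => RtoC 1 * v t)%C).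
        -- intros; apply Cmult_1_l.
        -- apply pw_cont_ex_CInt; [exact Hv | intros; apply continuous_const].
    + now apply pw_cont_le in Hv.
    + intros t _. f_equal. apply is_CInt_unique, is_CInt_point.
Qed.

Theorem fubini (F : R -> R -> C) (v w : R -> C) (a b c d : R) :
  pw_cont v a b -> pw_cont w c d ->
  (forall s t, continuous (fun q : R * R => F (fst q) (snd q)) (s, t)) ->
  CInt (fun s => CInt (fun t => F s t * w t) c d * v s)%C a b
  = CInt (fun t => CInt (fun s => F s t * v s) a b * w t)%C c d.
Proof.
  intros Hv Hw HF. assert (Hcd := pw_cont_le _ _ _ Hw).
  assert (HG : forall t s, continuous (fun q : R * R => F (snd q) (fst q)) (t, s)).
  { intros t s. now apply (continuous_pair_swap (fun q : R * R => F (fst q) (snd q))). }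
  assert (Hs : forall s, continuous (fun s => CInt (fun t => F s t * w t)%C c d) s).
  { intros s. now apply continuous_CInt_param. }
  induction Hv as [a b k Hab Hk Hvk | a b e H1 IH1 H2 IH2].
  - rewrite (CInt_ext _ (fun s => CInt (fun t => (F s t * k s) * w t)%C c d)).
    + rewrite (fubini_one (fun s t => F s t * k s)%C); try assumption.
      * apply CInt_ext; [exact Hcd|]. intros t _. f_equal.
        apply CInt_ext; [exact Hab|]. intros s Hs'. now rewrite Hvk.
      * intros s t. apply continuous_Cmult; [apply HF|].
        apply (continuous_comp fst k); [apply continuous_fst | apply Hk].
    + exact Hab.
    + intros s Hs'. rewrite Hvk by exact Hs'. symmetry. apply is_CInt_unique.
      apply (is_CInt_ext (fun t => k s * (F s t * w t))%C);
        [exact Hcd | intros; Cring|].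
      rewrite Cmult_comm. apply is_CInt_Cmult, CInt_correct.
      apply pw_cont_ex_CInt; [exact Hw|]. intros t. now apply continuous_slice.
  - rewrite (CInt_Chasles _ a b e) by now apply pw_cont_ex_CInt.
    rewrite IH1, IH2.
    assert (Hex : forall a b, pw_cont v a b ->
      ex_CInt (fun t => CInt (fun s => F s t * v s) a b * w t)%C c d).
    { intros x y Hxy. apply pw_cont_ex_CInt; [exact Hw|]. intros t.
      now apply (continuous_CInt_param (fun t s => F s t)). }
    symmetry. apply is_CInt_unique.
    apply (is_CInt_ext (fun t => CInt (fun s => F s t * v s) a b * w t
                          + CInt (fun s => F s t * v s) b e * w t)%C).
    + exact Hcd.
    + intros t _. rewrite (CInt_Chasles _ a b e); [Cring| |];
        apply pw_cont_ex_CInt; try assumption; intros s;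
        now apply (continuous_slice (fun t s => F s t)).
    + apply is_CInt_plus; apply CInt_correct; now apply Hex.
Qed.

(** * Complex derivatives and path integrals *)

(** Complex differentiability and differentiability of curves R -> C are the same
    condition read along two inclusions of the parameter space in C, so that
    the rules of calculus need only be proved once. *)
Definition deriv_wrt {T : Type} (iota : T -> C) (f : T -> C) (x : T) (l : C) : Prop :=
  forall e, 0 < e -> exists d, 0 < d /\ forall y, Cmod (iota y - iota x) < d ->
    Cmod (f y - f x - l * (iota y - iota x)) <= e * Cmod (iota y - iota x).

Notation cderiv := (deriv_wrt (fun z : C => z)).
Notation rderiv := (deriv_wrt RtoC).

Lemma Cmod_RtoC_minus (s t : R) : Cmod (RtoC s - RtoC t) = Rabs (s - t).
Proof. now rewrite <- RtoC_minus, Cmod_R. Qed.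

Lemma rderiv_is_derive (f : R -> C) (t : R) (l : C) :
  rderiv f t l -> is_derive (K := R_AbsRing) (V := C_R_NormedModule) f t l.
Proof.
  intros H. split; [apply is_linear_scal_l|].
  intros y Hy.
  apply (is_filter_lim_locally_unique (K := R_AbsRing) (V := R_NormedModule)) in Hy.
  subst y. intros [e He]. destruct (H e He) as [d [Hd Hf]].
  exists (mkposreal d Hd). intros s Hs. simpl.
  change (Rabs (s - t) < d) in Hs. rewrite <- Cmod_RtoC_minus in Hs.
  rewrite <- Cmod_norm. change (norm (minus s t)) with (Rabs (s - t)).
  replace (minus _ _) with (f s - f t - l * (RtoC s - RtoC t))%C;
    [rewrite <- Cmod_RtoC_minus; now apply Hf|].
  repeat match goal with |- context [@minus ?G (f s) ?b] =>
    change (@minus G (f s) b) with (f s - b)%C end.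
  match goal with |- context [@minus ?G (f s - f t)%C ?b] =>
    change (@minus G (f s - f t)%C b) with ((f s - f t) - b)%C end.
  f_equal. f_equal.
  change (scal (minus s t) l) with (scal (V := C_R_NormedModule) (s - t) l).
  rewrite scal_R_Cmult, RtoC_minus. apply Cmult_comm.
Qed.

Lemma CInt_derive (f df : R -> C) (a b : R) :
  a <= b -> (forall t, a <= t <= b -> rderiv f t (df t)) ->
  (forall t, a <= t <= b -> continuous df t) ->
  is_CInt df a b (f b - f a)%C.
Proof.
  intros Hab H1 H2. apply (is_RInt_derive (V := C_R_CompleteNormedModule));
  intros t; rewrite Rmin_left, Rmax_right by exact Hab; intros Ht.
  - now apply rderiv_is_derive, H1.
  - now apply H2.
Qed.

Lemma Cmod_le_Re_Im (z : C) : Cmod z <= Rabs (Re z) + Rabs (Im z).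
Proof.
  replace z with (RtoC (Re z) + Ci * RtoC (Im z))%C at 1.
  - eapply Rle_trans; [apply Cmod_triangle|].
    rewrite Cmod_mult, !Cmod_R, Cmod_Ci. lra.
  - destruct z as [x y]. unfold Cplus, Cmult, RtoC, Ci; simpl. f_equal; ring.
Qed.

Lemma is_derive_eps (f : R -> R) (t l e : R) :
  is_derive f t l -> 0 < e -> exists d, 0 < d /\ forall s, Rabs (s - t) < d ->
    Rabs (f s - f t - l * (s - t)) <= e * Rabs (s - t).
Proof.
  intros [_ H] He.
  destruct (H t (fun P HP => HP) (mkposreal e He)) as [d Hd].
  exists d. split; [apply cond_pos|]. intros s Hs.
  specialize (Hd s Hs). simpl in Hd.
  change (Rabs (f s - f t - (s - t) * l) <= e * Rabs (s - t)) in Hd.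
  now rewrite (Rmult_comm l).
Qed.

Lemma rderiv_components (f : R -> C) (t : R) (l1 l2 : R) :
  is_derive (fun s => Re (f s)) t l1 -> is_derive (fun s => Im (f s)) t l2 ->
  rderiv f t (l1, l2).
Proof.
  intros H1 H2 e He. assert (He2 : 0 < e / 2) by lra.
  destruct (is_derive_eps _ _ _ _ H1 He2) as [d1 [Hd1 K1]].
  destruct (is_derive_eps _ _ _ _ H2 He2) as [d2 [Hd2 K2]].
  exists (Rmin d1 d2). split; [now apply Rmin_glb_lt|]. intros s.
  rewrite Cmod_RtoC_minus, <- RtoC_minus. intros Hs.
  specialize (K1 s (Rlt_le_trans _ _ _ Hs (Rmin_l _ _))).
  specialize (K2 s (Rlt_le_trans _ _ _ Hs (Rmin_r _ _))).
  eapply Rle_trans; [apply Cmod_le_Re_Im|].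
  replace (Re (f s - f t - (l1, l2) * RtoC (s - t))%C)
    with (Re (f s) - Re (f t) - l1 * (s - t))
    by (destruct (f s), (f t); simpl; ring).
  replace (Im (f s - f t - (l1, l2) * RtoC (s - t))%C)
    with (Im (f s) - Im (f t) - l2 * (s - t))
    by (destruct (f s), (f t); simpl; ring).
  lra.
Qed.

Lemma deriv_comp {T : Type} (iota : T -> C) (f : C -> C) (g : T -> C) (z : T) (l m : C) :
  cderiv f (g z) l -> deriv_wrt iota g z m ->
  deriv_wrt iota (fun y => f (g y)) z (l * m)%C.
Proof.
  intros Hf Hg e He.
  set (L := Cmod l). set (N := Cmod m).
  assert (HL : 0 <= L) by apply Cmod_ge_0. assert (HN : 0 <= N) by apply Cmod_ge_0.
  assert (He1 : 0 < e / 2 / (N + 1)) by (repeat apply Rdiv_lt_0_compat; lra).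
  assert (He2 : 0 < Rmin 1 (e / 2 / (L + 1))).
  { apply Rmin_glb_lt; [lra|]. repeat apply Rdiv_lt_0_compat; lra. }
  destruct (Hf _ He1) as [d1 [Hd1 K1]].
  destruct (Hg _ He2) as [d2 [Hd2 K2]].
  exists (Rmin d2 (d1 / (N + 1))). split.
  { apply Rmin_glb_lt; [exact Hd2|]. apply Rdiv_lt_0_compat; lra. }
  intros s Hs. assert (Hs0 := Cmod_ge_0 (iota s - iota z)).
  assert (Hs2 : Cmod (iota s - iota z) < d2) by (eapply Rlt_le_trans; [exact Hs | apply Rmin_l]).
  assert (Hs1 : Cmod (iota s - iota z) < d1 / (N + 1)) by (eapply Rlt_le_trans; [exact Hs | apply Rmin_r]).
  specialize (K2 s Hs2).
  assert (K2a : Cmod (g s - g z - m * (iota s - iota z)) <= 1 * Cmod (iota s - iota z)).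
  { eapply Rle_trans; [exact K2|]. apply Rmult_le_compat_r; [lra | apply Rmin_l]. }
  assert (K2b : Cmod (g s - g z - m * (iota s - iota z)) <= e / 2 / (L + 1) * Cmod (iota s - iota z)).
  { eapply Rle_trans; [exact K2|]. apply Rmult_le_compat_r; [lra | apply Rmin_r]. }
  assert (Hgs : Cmod (g s - g z) <= (N + 1) * Cmod (iota s - iota z)).
  { replace (g s - g z)%C with ((g s - g z - m * (iota s - iota z)) + m * (iota s - iota z))%C by ring.
    eapply Rle_trans; [apply Cmod_triangle|]. rewrite Cmod_mult. fold N. lra. }
  assert (Hg1 : Cmod (g s - g z) < d1).
  { eapply Rle_lt_trans; [exact Hgs|].
    apply Rlt_le_trans with ((N + 1) * (d1 / (N + 1))).
    - apply Rmult_lt_compat_l; lra.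
    - right. field. lra. }
  specialize (K1 _ Hg1).
  replace (f (g s) - f (g z) - l * m * (iota s - iota z))%C
    with ((f (g s) - f (g z) - l * (g s - g z)) + l * (g s - g z - m * (iota s - iota z)))%C by ring.
  eapply Rle_trans; [apply Cmod_triangle|]. rewrite Cmod_mult. fold L.
  assert (A1 : e / 2 / (N + 1) * Cmod (g s - g z) <= e / 2 * Cmod (iota s - iota z)).
  { apply Rle_trans with (e / 2 / (N + 1) * ((N + 1) * Cmod (iota s - iota z))).
    - apply Rmult_le_compat_l; lra.
    - right. field. lra. }
  assert (A2 : L * Cmod (g s - g z - m * (iota s - iota z)) <= e / 2 * Cmod (iota s - iota z)).
  { apply Rle_trans with ((L + 1) * (e / 2 / (L + 1) * Cmod (iota s - iota z))).
    - apply Rmult_le_compat; try lra. apply Cmod_ge_0.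
    - right. field. lra. }
  lra.
Qed.

Lemma deriv_ext {T : Type} (iota f g : T -> C) (x : T) (l m : C) :
  (forall y, f y = g y) -> l = m -> deriv_wrt iota f x l -> deriv_wrt iota g x m.
Proof.
  intros H <- Hf e He. destruct (Hf e He) as [d [Hd K]].
  exists d. split; [exact Hd|]. intros y Hy. rewrite <- !H. now apply K.
Qed.

Lemma deriv_ext_near (f g : C -> C) (z l r : C) :
  r <> RtoC 0 -> (forall y, Cmod (y - z) < Cmod r -> f y = g y) ->
  cderiv f z l -> cderiv g z l.
Proof.
  intros Hr H Hf e He. destruct (Hf e He) as [d [Hd K]].
  exists (Rmin d (Cmod r)). split; [apply Rmin_glb_lt; [exact Hd | now apply Cmod_gt_0]|].
  intros y Hy. rewrite <- !H.
  - apply K. eapply Rlt_le_trans; [exact Hy | apply Rmin_l].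
  - replace (z - z)%C with (RtoC 0) by ring. rewrite Cmod_0. now apply Cmod_gt_0.
  - eapply Rlt_le_trans; [exact Hy | apply Rmin_r].
Qed.

Lemma deriv_const {T : Type} (iota : T -> C) (c : C) (x : T) :
  deriv_wrt iota (fun _ => c) x (RtoC 0).
Proof.
  intros e He. exists 1. split; [lra|]. intros y _.
  replace (c - c - RtoC 0 * (iota y - iota x))%C with (RtoC 0) by ring.
  rewrite Cmod_0. apply Rmult_le_pos; [lra | apply Cmod_ge_0].
Qed.

Lemma deriv_id {T : Type} (iota : T -> C) (x : T) : deriv_wrt iota iota x (RtoC 1).
Proof.
  intros e He. exists 1. split; [lra|]. intros y _.
  replace (iota y - iota x - RtoC 1 * (iota y - iota x))%C with (RtoC 0) by ring.
  rewrite Cmod_0. apply Rmult_le_pos; [lra | apply Cmod_ge_0].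
Qed.

Lemma deriv_plus {T : Type} (iota f g : T -> C) (x : T) (l m : C) :
  deriv_wrt iota f x l -> deriv_wrt iota g x m ->
  deriv_wrt iota (fun y => f y + g y)%C x (l + m)%C.
Proof.
  intros Hf Hg e He. assert (He2 : 0 < e / 2) by lra.
  destruct (Hf _ He2) as [d1 [Hd1 K1]]. destruct (Hg _ He2) as [d2 [Hd2 K2]].
  exists (Rmin d1 d2). split; [now apply Rmin_glb_lt|]. intros y Hy.
  specialize (K1 y (Rlt_le_trans _ _ _ Hy (Rmin_l _ _))).
  specialize (K2 y (Rlt_le_trans _ _ _ Hy (Rmin_r _ _))).
  replace (f y + g y - (f x + g x) - (l + m) * (iota y - iota x))%C
    with ((f y - f x - l * (iota y - iota x)) + (g y - g x - m * (iota y - iota x)))%C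
    by ring.
  eapply Rle_trans; [apply Cmod_triangle|]. lra.
Qed.

Lemma deriv_scal {T : Type} (iota f : T -> C) (x : T) (c l : C) :
  deriv_wrt iota f x l -> deriv_wrt iota (fun y => c * f y)%C x (c * l)%C.
Proof.
  intros Hf.
  apply (deriv_comp iota (fun z => c * z)%C f x c l); [|exact Hf].
  intros e He. exists 1. split; [lra|]. intros y _.
  replace (c * y - c * f x - c * (y - f x))%C with (RtoC 0) by ring.
  rewrite Cmod_0. apply Rmult_le_pos; [lra | apply Cmod_ge_0].
Qed.

Lemma cderiv_sqr (z : C) : cderiv (fun y => y * y)%C z (RtoC 2 * z)%C.
Proof.
  intros e He. exists e. split; [exact He|]. intros y Hy.
  replace (y * y - z * z - RtoC 2 * z * (y - z))%C with ((y - z) * (y - z))%C by ring.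
  rewrite Cmod_mult. apply Rmult_le_compat_r; [apply Cmod_ge_0 | lra].
Qed.

(** By polarisation of the square. *)
Lemma deriv_mult {T : Type} (iota f g : T -> C) (x : T) (l m : C) :
  deriv_wrt iota f x l -> deriv_wrt iota g x m ->
  deriv_wrt iota (fun y => f y * g y)%C x (l * g x + f x * m)%C.
Proof.
  intros Hf Hg.
  assert (Hs := deriv_comp iota _ _ x _ _ (cderiv_sqr (f x + g x)) (deriv_plus _ _ _ _ _ _ Hf Hg)).
  assert (Hd := deriv_comp iota _ _ x _ _ (cderiv_sqr (f x + RtoC (-1) * g x))
    (deriv_plus _ _ _ _ _ _ Hf (deriv_scal _ _ _ (RtoC (-1)) _ Hg))).
  assert (H := deriv_plus _ _ _ _ _ _ (deriv_scal _ _ _ (RtoC (1 / 4)) _ Hs)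
                 (deriv_scal _ _ _ (RtoC (- (1 / 4))) _ Hd)).
  assert (E4 : RtoC (1 / 4) = (/ RtoC 4)%C).
  { rewrite <- RtoC_inv by lra. f_equal. field. }
  assert (N4 : RtoC 4 <> RtoC 0) by (apply RtoC_neq_0; lra).
  assert (E1 : RtoC (-1) = (- RtoC 1)%C) by now rewrite <- RtoC_opp.
  assert (E2 : RtoC 2 = (RtoC 1 + RtoC 1)%C) by (rewrite <- RtoC_plus; f_equal; ring).
  assert (E44 : RtoC 4 = (RtoC 1 + RtoC 1 + RtoC 1 + RtoC 1)%C)
    by (rewrite <- !RtoC_plus; f_equal; ring).
  revert H. apply deriv_ext; [intros y|];
  rewrite RtoC_opp, E4, E1; try rewrite E2; rewrite E44 in *; field; exact N4.
Qed.

Lemma cderiv_inv (z : C) : z <> RtoC 0 -> cderiv Cinv z (- / (z * z))%C.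
Proof.
  intros Hz e He. assert (Hm := proj1 (Cmod_gt_0 z) Hz). set (r := Cmod z) in *.
  exists (Rmin (r / 2) (e * (r * r * r) / 2)). split.
  { apply Rmin_glb_lt; [lra|]. apply Rdiv_lt_0_compat; [|lra].
    repeat apply Rmult_lt_0_compat; lra. }
  intros y Hy.
  assert (Hy1 : Cmod (y - z) < r / 2) by (eapply Rlt_le_trans; [exact Hy | apply Rmin_l]).
  assert (Hy2 : Cmod (y - z) < e * (r * r * r) / 2)
    by (eapply Rlt_le_trans; [exact Hy | apply Rmin_r]).
  assert (Hyr : r / 2 <= Cmod y).
  { assert (H := Cmod_triangle y (z - y)). replace (y + (z - y))%C with z in H by ring.
    replace (z - y)%C with (- (y - z))%C in H by ring. rewrite Cmod_opp in H.
    fold r in H. lra. }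
  assert (Hy0 : y <> RtoC 0) by (apply Cmod_gt_0; lra).
  replace (/ y - / z - - / (z * z) * (y - z))%C with ((y - z) * ((y - z) * / (z * z * y)))%C
    by (field; tauto).
  rewrite !Cmod_mult, Rmult_comm. apply Rmult_le_compat_r; [apply Cmod_ge_0|].
  rewrite Cmod_inv by (repeat apply Cmult_neq_0; assumption).
  rewrite !Cmod_mult. fold r.
  apply Rle_trans with (e * (r * r * r) / 2 * / (r * r * (r / 2))).
  - apply Rmult_le_compat.
    + apply Cmod_ge_0.
    + left. apply Rinv_0_lt_compat. repeat apply Rmult_lt_0_compat; lra.
    + lra.
    + apply Rinv_le_contravar.
      * repeat apply Rmult_lt_0_compat; lra.
      * apply Rmult_le_compat_l; [|exact Hyr]. apply Rmult_le_pos; lra.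
  - right. field. lra.
Qed.

Lemma deriv_continuous {X : UniformSpace} (f : C -> C) (z l : C) :
  cderiv f z l -> continuous f z.
Proof.
  intros H. apply continuous_Cmod_intro. intros e He.
  destruct (H 1 Rlt_0_1) as [d [Hd K]].
  assert (HL := Cmod_ge_0 l).
  assert (Hr : 0 < Rmin d (e / (Cmod l + 1))).
  { apply Rmin_glb_lt; [exact Hd|]. apply Rdiv_lt_0_compat; lra. }
  generalize (locally_Cmod_ball z _ Hr). apply filter_imp. intros y Hy.
  assert (H1 : Cmod (y - z) < d) by (eapply Rlt_le_trans; [exact Hy | apply Rmin_l]).
  assert (H2 : Cmod (y - z) < e / (Cmod l + 1))
    by (eapply Rlt_le_trans; [exact Hy | apply Rmin_r]).
  specialize (K y H1).
  replace (f y - f z)%C with ((f y - f z - l * (y - z)) + l * (y - z))%C by ring.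
  eapply Rle_trans; [apply Cmod_triangle|]. rewrite Cmod_mult.
  apply Rle_trans with ((Cmod l + 1) * (e / (Cmod l + 1))).
  - assert (H0 := Cmod_ge_0 (y - z)). nra.
  - right. field. lra.
Qed.

(** ** Derivative of the exponential *)

Lemma rderiv_Cexp_ray (z : C) (t : R) :
  rderiv (fun s => Cexp (RtoC s * z)) t (z * Cexp (RtoC t * z))%C.
Proof.
  destruct z as [x y].
  apply (deriv_ext _ (fun s => (exp (s * x) * cos (s * y), exp (s * x) * sin (s * y)) : C) _ _
    (x * (exp (t * x) * cos (t * y)) - y * (exp (t * x) * sin (t * y)),
     x * (exp (t * x) * sin (t * y)) + y * (exp (t * x) * cos (t * y)))).
  - intros s. unfold Cexp, Cmult, RtoC; simpl. f_equal;
    replace (s * x - 0 * y) with (s * x) by ring;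
    replace (s * y + 0 * x) with (s * y) by ring; ring.
  - unfold Cexp, Cmult, RtoC; simpl.
    replace (t * x - 0 * y) with (t * x) by ring.
    replace (t * y + 0 * x) with (t * y) by ring. f_equal; ring.
  - apply rderiv_components; simpl; auto_derive; auto; ring.
Qed.

Lemma cderiv_Cexp_0 : cderiv Cexp (RtoC 0) (RtoC 1).
Proof.
  intros e He.
  assert (Hc : continuous Cexp (RtoC 0)) by (apply (continuous_Cexp (fun z => z)), continuous_id).
  assert (Hl := continuous_Cmod_elim _ _ _ Hc He).
  apply locally_Cmod in Hl. destruct Hl as [d [Hd K]].
  exists d. split; [exact Hd|]. intros h Hh.
  replace (Cexp h - Cexp (RtoC 0) - RtoC 1 * (h - RtoC 0))%C
    with ((Cexp (RtoC 1 * h) - RtoC 1 * h) - (Cexp (RtoC 0 * h) - RtoC 0 * h))%C.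
  2:{ replace (RtoC 1 * h)%C with h by ring. replace (RtoC 0 * h)%C with (RtoC 0) by ring.
      rewrite Cexp_0. ring. }
  apply (Cmod_CInt_le (fun t => h * Cexp (RtoC t * h) - h)%C 0 1 _
           (fun _ => e * Cmod (h - RtoC 0))).
  - lra.
  - intros t Ht.
    replace (h * Cexp (RtoC t * h) - h)%C with ((Cexp (RtoC t * h) - Cexp (RtoC 0)) * (h - RtoC 0))%C
      by (rewrite Cexp_0; ring).
    rewrite Cmod_mult. apply Rmult_le_compat_r; [apply Cmod_ge_0|].
    left. apply K. replace (RtoC t * h - RtoC 0)%C with (RtoC t * (h - RtoC 0))%C by ring.
    rewrite Cmod_mult, Cmod_R, Rabs_pos_eq by lra.
    assert (H0 := Cmod_ge_0 (h - RtoC 0)). nra.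
  - apply (CInt_derive (fun t => Cexp (RtoC t * h) - RtoC t * h)%C); [lra| |].
    + intros t _.
      apply (deriv_ext _ (fun t => Cexp (RtoC t * h) + (- h) * RtoC t)%C _ _
               (h * Cexp (RtoC t * h) + (- h) * RtoC 1)%C); [intros; ring | ring|].
      apply deriv_plus; [apply rderiv_Cexp_ray | apply deriv_scal, deriv_id].
    + intros t _. apply continuous_Cminus; [|apply continuous_const].
      apply continuous_Cmult; [apply continuous_const|]. apply continuous_Cexp.
      apply continuous_Cmult; [|apply continuous_const].
      apply continuous_RtoC, continuous_id.
  - assert (Hint := is_RInt_const (V := R_NormedModule) 0 1 (e * Cmod (h - RtoC 0))).
    change (scal ?x ?y) with (x * y) in Hint.
    now rewrite Rminus_0_r, Rmult_1_l in Hint.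
Qed.

Lemma cderiv_Cexp (z : C) : cderiv Cexp z (Cexp z).
Proof.
  apply (deriv_ext _ (fun y => Cexp z * Cexp (y + - z))%C _ _ (Cexp z * (RtoC 1 * (RtoC 1 + RtoC 0)))%C).
  - intros y. rewrite <- Cexp_plus. f_equal. ring.
  - ring.
  - apply deriv_scal. apply (deriv_comp _ Cexp (fun y => y + - z)%C).
    + replace (z + - z)%C with (RtoC 0) by ring. apply cderiv_Cexp_0.
    + apply deriv_plus; [apply (deriv_id (fun z : C => z)) | apply deriv_const].
Qed.

(** ** Piecewise C1 paths *)

Lemma piecewise_C1_le (g : R -> C) (a b : R) : piecewise_C1 g a b -> a <= b.
Proof. induction 1; lra. Qed.

Lemma velocity_ext_loc (g h : R -> C) (a b t : R) :
  a < t < b -> (forall s, a <= s <= b -> g s = h s) -> velocity g t = velocity h t.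
Proof.
  intros Ht H.
  assert (Hl : locally t (fun s => g s = h s)).
  { assert (Hd : 0 < Rmin (t - a) (b - t)) by (apply Rmin_glb_lt; lra).
    exists (mkposreal _ Hd). intros s Hs. apply H.
    change (Rabs (s - t) < Rmin (t - a) (b - t)) in Hs. apply Rabs_def2 in Hs.
    assert (H1 := Rmin_l (t - a) (b - t)). assert (H2 := Rmin_r (t - a) (b - t)). lra. }
  unfold velocity. f_equal; apply Derive_ext_loc;
  revert Hl; apply filter_imp; intros s ->; reflexivity.
Qed.

Lemma pw_cont_velocity (g : R -> C) (a b : R) :
  piecewise_C1 g a b -> pw_cont (velocity g) a b.
Proof.
  induction 1 as [a b h Hab Hh Hg | a b c _ IH1 _ IH2].
  - apply pw_cont_one with (velocity h); [exact Hab | intros; apply Hh|].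
    intros t Ht. now apply (velocity_ext_loc g h a b).
  - now apply pw_cont_cat with b.
Qed.

Lemma C1_path_rderiv (h : R -> C) (t : R) : C1_path h -> rderiv h t (velocity h t).
Proof.
  intros Hh. destruct (Hh t) as [H1 [H2 _]].
  apply rderiv_components; now apply Derive_correct.
Qed.

Lemma rderiv_continuous (f : R -> C) (t : R) (l : C) : rderiv f t l -> continuous f t.
Proof.
  intros H. apply (ex_derive_continuous (K := R_AbsRing) (V := C_R_NormedModule)).
  exists l. now apply rderiv_is_derive.
Qed.

Definition clamp (a b t : R) : R := Rmax a (Rmin b t).

Lemma clamp_in (a b t : R) : a <= b -> a <= clamp a b t <= b.
Proof.
  intros H. unfold clamp, Rmax, Rmin.
  destruct (Rle_dec b t); destruct (Rle_dec _ _); lra.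
Qed.

Lemma clamp_id (a b t : R) : a <= t <= b -> clamp a b t = t.
Proof.
  intros H. unfold clamp, Rmax, Rmin.
  destruct (Rle_dec b t); destruct (Rle_dec _ _); lra.
Qed.

Lemma continuous_clamp {X : UniformSpace} (a b : R) (f : X -> R) (x : X) :
  continuous f x -> continuous (fun y => clamp a b (f y)) x.
Proof.
  intros Hf. apply (continuous_comp f (clamp a b)); [exact Hf|].
  assert (H : forall s, filterlim (clamp a b) (locally s) (locally (clamp a b s))).
  { intros s P [d Hd]. exists d. intros t Ht. apply Hd.
    change (Rabs (t - s) < d) in Ht. change (Rabs (clamp a b t - clamp a b s) < d).
    eapply Rle_lt_trans; [|exact Ht].
    unfold clamp, Rmax, Rmin.
    destruct (Rle_dec b t), (Rle_dec b s);
    repeat destruct (Rle_dec a _);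
    unfold Rabs; repeat destruct (Rcase_abs _); lra. }
  apply H.
Qed.

(** A path prolonged by its end values is continuous on the whole line; gluing
    two such prolongations is a sum minus the common value. *)
Lemma continuous_path_clamp (g : R -> C) (a b t : R) :
  piecewise_C1 g a b -> continuous (fun s => g (clamp a b s)) t.
Proof.
  intros H. revert t.
  induction H as [a b h Hab Hh Hg | a b c H1 IH1 H2 IH2]; intros t.
  - apply (continuous_ext (fun s => h (clamp a b s))).
    + intros s. symmetry. now apply Hg, clamp_in.
    + apply (continuous_comp (clamp a b) h).
      * apply (continuous_clamp a b (fun s => s)), continuous_id.
      * apply rderiv_continuous with (velocity h (clamp a b t)).
        now apply C1_path_rderiv.
  - apply piecewise_C1_le in H1. apply piecewise_C1_le in H2.
    apply (continuous_ext (fun s => g (clamp a b s) + g (clamp b c s) - g b)%C).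
    + intros s. destruct (Rle_dec s b) as [Hs|Hs].
      * replace (clamp b c s) with b by
          (unfold clamp, Rmax, Rmin; destruct (Rle_dec c s); destruct (Rle_dec b _); lra).
        replace (clamp a c s) with (clamp a b s); [Cring|].
        unfold clamp, Rmax, Rmin; destruct (Rle_dec b s), (Rle_dec c s);
        repeat destruct (Rle_dec a _); lra.
      * replace (clamp a b s) with b by
          (unfold clamp, Rmax, Rmin; destruct (Rle_dec b s); destruct (Rle_dec a _); lra).
        replace (clamp a c s) with (clamp b c s); [Cring|].
        unfold clamp, Rmax, Rmin; destruct (Rle_dec c s);
        destruct (Rle_dec a _); destruct (Rle_dec b _); lra.
    + apply continuous_Cminus; [|apply continuous_const].
      apply continuous_Cplus; [apply IH1 | apply IH2].
Qed.

Lemma is_derive_of_eps (f : R -> R) (t l : R) :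
  (forall e, 0 < e -> exists d, 0 < d /\ forall s, Rabs (s - t) < d ->
    Rabs (f s - f t - l * (s - t)) <= e * Rabs (s - t)) ->
  is_derive f t l.
Proof.
  intros H. split; [apply is_linear_scal_l|].
  intros y Hy.
  apply (is_filter_lim_locally_unique (K := R_AbsRing) (V := R_NormedModule)) in Hy.
  subst y. intros [e He]. destruct (H e He) as [d [Hd Hf]].
  exists (mkposreal d Hd). intros s Hs.
  change (Rabs (f s - f t - (s - t) * l) <= e * Rabs (s - t)).
  rewrite (Rmult_comm _ l). now apply Hf.
Qed.

Lemma im_le_Cmod (z : C) : Rabs (Im z) <= Cmod z.
Proof. eapply Rle_trans; [apply Rmax_r | apply Rmax_Cmod]. Qed.

Lemma rderiv_Re (g : R -> C) (t : R) (l : C) :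
  rderiv g t l -> is_derive (fun s => Re (g s)) t (Re l).
Proof.
  intros H. apply is_derive_of_eps. intros e He. destruct (H e He) as [d [Hd K]].
  exists d. split; [exact Hd|]. intros s Hs.
  rewrite <- Cmod_RtoC_minus in Hs. specialize (K s Hs).
  rewrite Cmod_RtoC_minus in K. rewrite <- RtoC_minus in K.
  eapply Rle_trans; [|exact K]. eapply Rle_trans; [|apply re_le_Cmod]. right. f_equal.
  destruct (g s), (g t), l; simpl; ring.
Qed.

Lemma rderiv_Im (g : R -> C) (t : R) (l : C) :
  rderiv g t l -> is_derive (fun s => Im (g s)) t (Im l).
Proof.
  intros H. apply is_derive_of_eps. intros e He. destruct (H e He) as [d [Hd K]].
  exists d. split; [exact Hd|]. intros s Hs.
  rewrite <- Cmod_RtoC_minus in Hs. specialize (K s Hs).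
  rewrite Cmod_RtoC_minus in K. rewrite <- RtoC_minus in K.
  eapply Rle_trans; [|exact K]. eapply Rle_trans; [|apply im_le_Cmod]. right. f_equal.
  destruct (g s), (g t), l; simpl; ring.
Qed.

Lemma velocity_rderiv (g : R -> C) (t : R) (l : C) : rderiv g t l -> velocity g t = l.
Proof.
  intros H. assert (H1 := rderiv_Re _ _ _ H). assert (H2 := rderiv_Im _ _ _ H).
  unfold velocity. apply is_derive_unique in H1. apply is_derive_unique in H2.
  transitivity (Re l, Im l); [f_equal; assumption | destruct l; reflexivity].
Qed.

Lemma path_ftc (g : R -> C) (G dG : C -> C) (a b : R) :
  piecewise_C1 g a b ->
  (forall t, a <= t <= b -> cderiv G (g t) (dG (g t)) /\ continuous dG (g t)) ->
  is_CInt (fun t => dG (g t) * velocity g t)%C a b (G (g b) - G (g a))%C.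
Proof.
  intros H. induction H as [a b h Hab Hh Hg | a b c H1 IH1 H2 IH2]; intros HG.
  - apply (is_CInt_ext (fun t => dG (h t) * velocity h t)%C); [exact Hab| |].
    { intros t Ht. rewrite (velocity_ext_loc g h a b t Ht Hg). now rewrite Hg by lra. }
    rewrite !Hg by lra.
    apply (CInt_derive (fun t => G (h t))); [exact Hab| |]; intros t Ht.
    + apply (deriv_comp RtoC); [rewrite <- Hg by lra; now apply HG | now apply C1_path_rderiv].
    + apply continuous_Cmult; [|apply Hh].
      apply (continuous_comp h dG); [|rewrite <- Hg by lra; now apply HG].
      apply rderiv_continuous with (velocity h t). now apply C1_path_rderiv.
  - apply piecewise_C1_le in H1. apply piecewise_C1_le in H2.
    replace (G (g c) - G (g a))%C with ((G (g b) - G (g a)) + (G (g c) - G (g b)))%C by ring.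
    apply (is_RInt_Chasles (V := C_R_NormedModule)) with b;
      [apply IH1 | apply IH2]; intros t Ht; apply HG; lra.
Qed.

(** Cauchy's theorem for the dilations of a path about a centre c: since
    d/ds (s f(c + s (z - c))) = d/dz ((z - c) f(c + s (z - c))),
    only the end points contribute to the change of the integral. *)
Lemma dilation (g : R -> C) (f df : C -> C) (a b : R) (c : C) (s0 s1 : R) :
  piecewise_C1 g a b -> s0 <= s1 ->
  (forall s t, s0 <= s <= s1 -> a <= t <= b ->
     cderiv f (c + RtoC s * (g t - c))%C (df (c + RtoC s * (g t - c))%C) /\
     continuous df (c + RtoC s * (g t - c))%C) ->
  (CInt (fun t => f (c + RtoC s1 * (g t - c)) * RtoC s1 * velocity g t) a b
   - CInt (fun t => f (c + RtoC s0 * (g t - c)) * RtoC s0 * velocity g t) a b)%C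
  = CInt (fun s => f (c + RtoC s * (g b - c)) * (g b - c)
                   - f (c + RtoC s * (g a - c)) * (g a - c))%C s0 s1.
Proof.
  intros Hg Hs Hf. assert (Hab := piecewise_C1_le _ _ _ Hg).
  pose (gc := fun t => g (clamp a b t)). pose (sc := clamp s0 s1).
  assert (Hgc : forall t, continuous gc t) by (intros; now apply continuous_path_clamp).
  pose (z := fun s t => (c + RtoC (sc s) * (gc t - c))%C).
  assert (Hz : forall s t, s0 <= s <= s1 -> a <= t <= b ->
            z s t = (c + RtoC s * (g t - c))%C).
  { intros s t H1 H2. unfold z, sc, gc. now rewrite !clamp_id. }
  assert (Hfz : forall s t, cderiv f (z s t) (df (z s t)) /\ continuous df (z s t)).
  { intros s t. apply Hf; now apply clamp_in. }
  assert (Hzc : forall s t, continuous (fun q : R * R => z (fst q) (snd q)) (s, t)).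
  { intros s t. apply continuous_Cplus; [apply continuous_const|].
    apply continuous_Cmult.
    - apply continuous_RtoC. apply (continuous_clamp s0 s1 fst). apply continuous_fst.
    - apply continuous_Cminus; [|apply continuous_const].
      apply (continuous_comp snd gc); [apply continuous_snd | apply Hgc]. }
  assert (Hfc : forall s t, continuous (fun q : R * R => f (z (fst q) (snd q))) (s, t)).
  { intros s t. apply (continuous_comp (fun q : R * R => z (fst q) (snd q)) f); [apply Hzc|].
    apply (deriv_continuous (X := C_UniformSpace) f _ (df (z s t))), Hfz. }
  pose (K := fun s t => (df (z s t) * RtoC (sc s) * (gc t - c) + f (z s t))%C).
  assert (HK : forall s t, continuous (fun q : R * R => K (fst q) (snd q)) (s, t)).
  { intros s t. apply continuous_Cplus; [|apply Hfc].
    apply continuous_Cmult; [apply continuous_Cmult|].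
    - apply (continuous_comp (fun q : R * R => z (fst q) (snd q)) df); [apply Hzc | apply Hfz].
    - apply continuous_RtoC. apply (continuous_clamp s0 s1 fst). apply continuous_fst.
    - apply continuous_Cminus; [|apply continuous_const].
      apply (continuous_comp snd gc); [apply continuous_snd | apply Hgc]. }
  assert (Hv := pw_cont_velocity _ _ _ Hg).
  assert (Hray : forall s, s0 <= s <= s1 -> forall u, continuous (fun t => f (z s t) * RtoC s)%C u).
  { intros s _ u. apply continuous_Cmult; [|apply continuous_const].
    apply (continuous_slice (fun s t => f (z s t))), Hfc. }
  transitivity (CInt (fun t => CInt (fun s => K s t) s0 s1 * velocity g t)%C a b).
  - rewrite (CInt_ext _ (fun t => (f (z s1 t) * RtoC s1) * velocity g t)%C); [|exact Hab|].
    2:{ intros t Ht. now rewrite Hz by lra. }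
    rewrite (CInt_ext (fun t => f (c + RtoC s0 * (g t - c)) * RtoC s0 * velocity g t)%C
      (fun t => (f (z s0 t) * RtoC s0) * velocity g t)%C); [|exact Hab|].
    2:{ intros t Ht. now rewrite Hz by lra. }
    rewrite CInt_weight_minus; [|exact Hv | now apply Hray; lra | now apply Hray; lra].
    apply CInt_ext; [exact Hab|]. intros t Ht. f_equal.
    symmetry. apply is_CInt_unique.
    rewrite !Hz by lra.
    apply (is_CInt_ext (fun s => (df (c + RtoC s * (g t - c)) * (g t - c)) * RtoC s
                                 + f (c + RtoC s * (g t - c)) * RtoC 1)%C); [exact Hs| |].
    { intros s Hs'. unfold K. rewrite Hz by lra. unfold sc, gc. rewrite !clamp_id by lra. ring. }
    apply (is_CInt_ext (fun s => (df (z s t) * (gc t - c)) * RtoC (sc s) + f (z s t) * RtoC 1)%C);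
      [exact Hs| |].
    { intros s Hs'. rewrite Hz by lra. unfold sc, gc. rewrite !clamp_id by lra. reflexivity. }
    apply (CInt_derive (fun s => f (c + RtoC s * (g t - c)) * RtoC s)%C); [exact Hs| |].
    + intros s Hs'.
      apply (deriv_ext _ (fun s => f (c + RtoC s * (g t - c)) * RtoC s)%C _ _
        ((df (c + RtoC s * (g t - c)) * (g t - c)) * RtoC s
         + f (c + RtoC s * (g t - c)) * RtoC 1)%C).
      * reflexivity.
      * rewrite Hz by lra. unfold sc, gc. rewrite !clamp_id by lra. reflexivity.
      * apply (deriv_mult RtoC (fun s => f (c + RtoC s * (g t - c)))%C RtoC); [|apply deriv_id].
        apply (deriv_comp RtoC f (fun s => c + RtoC s * (g t - c))%C).
        -- apply Hf; lra.
        -- apply (deriv_ext _ (fun s => c + (g t - c) * RtoC s)%C _ _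
             (RtoC 0 + (g t - c) * RtoC 1)%C); [intros; ring | ring|].
           apply deriv_plus; [apply deriv_const | apply deriv_scal, deriv_id].
    + intros s _.
      apply (continuous_ext (fun s => K s t)).
      { intros u. unfold K. Cring. }
      apply (continuous_slice (fun t s => K s t)).
      apply (continuous_pair_swap (fun q : R * R => K (fst q) (snd q))), HK.
  - rewrite <- (fubini_one K); [|exact Hs | exact Hv | exact HK].
    apply CInt_ext; [exact Hs|]. intros s Hs'. apply is_CInt_unique.
    apply (is_CInt_ext (fun t => (df (c + RtoC s * (g t - c)) * RtoC s * (g t - c)
             + f (c + RtoC s * (g t - c))) * velocity g t)%C); [exact Hab| |].
    { intros t Ht. unfold K. rewrite Hz by lra. unfold sc, gc. rewrite !clamp_id by lra.
      reflexivity. }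
    apply (path_ftc g (fun y => f (c + RtoC s * (y - c)) * (y - c))%C
      (fun y => df (c + RtoC s * (y - c)) * RtoC s * (y - c) + f (c + RtoC s * (y - c)))%C);
      [exact Hg|].
    intros t Ht. assert (Hst := Hf s t (conj (Rlt_le _ _ (proj1 Hs')) (Rlt_le _ _ (proj2 Hs'))) Ht).
    assert (Haff : continuous (fun y => c + RtoC s * (y - c))%C (g t)).
    { apply continuous_Cplus; [apply continuous_const|].
      apply continuous_Cmult; [apply continuous_const|].
      apply continuous_Cminus; [apply continuous_id | apply continuous_const]. }
    split.
    + apply (deriv_ext _ (fun y => f (c + RtoC s * (y - c)) * (y - c))%C _ _
        ((df (c + RtoC s * (g t - c)) * RtoC s) * (g t - c)
         + f (c + RtoC s * (g t - c)) * RtoC 1)%C); [reflexivity | ring|].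
      assert (Hid : cderiv (fun y => y - c)%C (g t) (RtoC 1)).
      { apply (deriv_ext _ (fun y => y + - c)%C _ _ (RtoC 1 + RtoC 0)%C);
          [reflexivity | ring|].
        apply deriv_plus; [apply (deriv_id (fun z : C => z)) | apply deriv_const]. }
      apply (deriv_mult _ (fun y => f (c + RtoC s * (y - c)))%C (fun y => y - c)%C);
        [|exact Hid].
      apply (deriv_comp _ f (fun y => c + RtoC s * (y - c))%C); [apply Hst|].
      apply (deriv_ext _ (fun y => c + RtoC s * (y - c))%C _ _
               (RtoC 0 + RtoC s * RtoC 1)%C); [reflexivity | ring|].
      apply deriv_plus; [apply deriv_const | apply deriv_scal, Hid].
    + apply continuous_Cplus; [apply continuous_Cmult; [apply continuous_Cmult|]|].
      * apply (continuous_comp _ df _ Haff), Hst.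
      * apply continuous_const.
      * apply continuous_Cminus; [apply continuous_id | apply continuous_const].
      * apply (continuous_comp _ f _ Haff).
        apply (deriv_continuous (X := C_UniformSpace) f _ _ (proj1 Hst)).
Qed.

Lemma velocity_inv_path (g : R -> C) (t : R) (l : C) :
  rderiv g t l -> g t <> RtoC 0 ->
  velocity (inv_path g) t = (- / (g t * g t) * l)%C.
Proof.
  intros Hg H0. apply velocity_rderiv. unfold inv_path.
  apply (deriv_comp RtoC); [now apply cderiv_inv | exact Hg].
Qed.

(** Away from the corners, inverting a path multiplies its velocity by -1/g^2. *)
Lemma is_CInt_inv_path (g F : R -> C) (a b : R) :
  piecewise_C1 g a b -> (forall t, continuous g t) -> (forall t, g t <> RtoC 0) ->
  (forall t, continuous F t) ->
  is_CInt (fun t => F t * velocity (inv_path g) t)%C a b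
    (CInt (fun t => F t * (- / (g t * g t)) * velocity g t)%C a b).
Proof.
  intros Hg Hc H0 HF.
  assert (HF' : forall t, continuous (fun t => F t * (- / (g t * g t)))%C t).
  { intros t. apply continuous_Cmult; [apply HF|].
    apply continuous_Copp, continuous_Cinv.
    - now apply continuous_Cmult.
    - now apply Cmult_neq_0. }
  induction Hg as [a b h Hab Hh Hgh | a b c H1 IH1 H2 IH2].
  - apply (is_CInt_ext (fun t => F t * (- / (g t * g t)) * velocity g t)%C); [exact Hab| |].
    + intros t Ht.
      rewrite (velocity_ext_loc (inv_path g) (inv_path h) a b t Ht).
      2:{ intros s Hs. unfold inv_path. now rewrite Hgh. }
      rewrite (velocity_ext_loc g h a b t Ht Hgh).
      rewrite (velocity_inv_path h t (velocity h t)).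
      * rewrite Hgh by lra. ring.
      * now apply C1_path_rderiv.
      * rewrite <- Hgh by lra. apply H0.
    + apply CInt_correct, pw_cont_ex_CInt; [|exact HF'].
      apply pw_cont_velocity. now apply piecewise_C1_one with h.
  - rewrite (CInt_Chasles _ a b c) by
      (apply pw_cont_ex_CInt; [now apply pw_cont_velocity | exact HF']).
    now apply (is_RInt_Chasles (V := C_R_NormedModule)) with b.
Qed.

(** * Integrals along the infinite contour *)

Lemma line_continuous (Sg : R -> C) (t : R) : from_pioo_to_mioo Sg -> continuous Sg t.
Proof.
  intros HS.
  assert (H : piecewise_C1 Sg (t - 1) (t + 1)) by (apply HS; lra).
  apply (continuous_ext_loc _ (fun s => Sg (clamp (t - 1) (t + 1) s))).
  - exists (mkposreal 1 Rlt_0_1). intros s Hs. change (Rabs (s - t) < 1) in Hs.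
    apply Rabs_def2 in Hs. now rewrite clamp_id by lra.
  - now apply continuous_path_clamp.
Qed.

Lemma line_neq_0 (Sg : R -> C) (t : R) : from_pioo_to_mioo Sg -> Sg t <> RtoC 0.
Proof.
  intros HS E. assert (H := line_right _ HS t). rewrite E in H. simpl in H. lra.
Qed.

(** Beyond time T both ends of the contour lie in the double sector
    Y <= |Im z|, 2 |Re z| <= |Im z|, the start above the real axis. *)
Lemma line_ends (Sg : R -> C) (Y : R) :
  from_pioo_to_mioo Sg ->
  exists T, 0 < T /\
    (forall t, t <= - T -> Y <= Im (Sg t) /\ 0 < Im (Sg t) /\ 2 * Rabs (Re (Sg t)) <= Rabs (Im (Sg t))) /\
    (forall t, T <= t -> Y <= - Im (Sg t) /\ Im (Sg t) < 0 /\ 2 * Rabs (Re (Sg t)) <= Rabs (Im (Sg t))).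
Proof.
  intros HS.
  assert (Hb : locally 0 (fun r : R => Rabs r < / 2)).
  { assert (H2 : 0 < / 2) by lra. exists (mkposreal _ H2). intros r Hr.
    change (Rabs (r - 0) < / 2) in Hr. now rewrite Rminus_0_r in Hr. }
  destruct (line_start _ HS (fun y => Rmax Y 0 < y)) as [T1 H1]; [now exists (Rmax Y 0)|].
  destruct (line_end _ HS (fun y => y < - Rmax Y 0)) as [T2 H2]; [now exists (- Rmax Y 0)|].
  destruct (line_start_dir _ HS _ Hb) as [T3 H3].
  destruct (line_end_dir _ HS _ Hb) as [T4 H4].
  assert (HM1 := Rmax_l Y 0). assert (HM2 := Rmax_r Y 0).
  assert (Hdir : forall t, Im (Sg t) <> 0 -> Rabs (Re (Sg t) / Im (Sg t)) < / 2 ->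
            2 * Rabs (Re (Sg t)) <= Rabs (Im (Sg t))).
  { intros t H0 Hd. unfold Rdiv in Hd. rewrite Rabs_mult, Rabs_inv in Hd.
    assert (Hp := Rabs_pos_lt _ H0).
    apply Rmult_lt_compat_r with (r := Rabs (Im (Sg t))) in Hd; [|exact Hp].
    rewrite Rmult_assoc, Rinv_l in Hd by lra. lra. }
  exists (Rabs T1 + Rabs T2 + Rabs T3 + Rabs T4 + 1).
  assert (P1 := Rabs_pos T1). assert (P2 := Rabs_pos T2).
  assert (P3 := Rabs_pos T3). assert (P4 := Rabs_pos T4).
  assert (Q1 := Rle_abs (- T1)). assert (Q2 := Rle_abs T2).
  assert (Q3 := Rle_abs (- T3)). assert (Q4 := Rle_abs T4).
  rewrite Rabs_Ropp in Q1, Q3.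
  split; [lra|]. split; intros t Ht.
  - assert (K1 : Rmax Y 0 < Im (Sg t)) by (apply H1; lra).
    repeat split; try lra. apply Hdir; [lra | apply H3; lra].
  - assert (K2 : Im (Sg t) < - Rmax Y 0) by (apply H2; lra).
    repeat split; try lra. apply Hdir; [lra | apply H4; lra].
Qed.

(** Quartic decay is what the chord estimate below consumes. The constants are
    arguments, so that all members of a family can share them. *)
Definition tail_ok (f : C -> C) (M Y : R) : Prop :=
  exists df, forall z, Y <= Rabs (Im z) -> 2 * Rabs (Re z) <= Rabs (Im z) ->
    cderiv f z (df z) /\ continuous df z /\ Cmod (f z) * Rabs (Im z) ^ 4 <= M.

Lemma Rabs_convex (s x0 x1 : R) :
  0 <= s <= 1 -> Rabs (x0 + s * (x1 - x0)) <= Rabs x0 + s * (Rabs x1 - Rabs x0).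
Proof.
  intros Hs. replace (x0 + s * (x1 - x0)) with ((1 - s) * x0 + s * x1) by ring.
  eapply Rle_trans; [apply Rabs_triang|].
  rewrite !Rabs_mult, (Rabs_pos_eq s), (Rabs_pos_eq (1 - s)) by lra. lra.
Qed.

Lemma Rabs_convex_same_sign (s y0 y1 : R) :
  0 <= s <= 1 -> 0 < y0 * y1 ->
  Rabs (y0 + s * (y1 - y0)) = Rabs y0 + s * (Rabs y1 - Rabs y0).
Proof.
  intros Hs Hy. destruct (Rle_dec 0 y0) as [H0|H0].
  - assert (0 < y1) by nra. rewrite !Rabs_pos_eq; nra.
  - assert (y1 < 0) by nra. rewrite (Rabs_left y0), (Rabs_left y1) by lra.
    rewrite Rabs_left; nra.
Qed.

Lemma is_RInt_inv_sqr (a b : R) :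
  0 < a -> 0 < b ->
  is_RInt (fun s => / (a + s * (b - a)) ^ 2) 0 1 (/ (a * b)).
Proof.
  intros Ha Hb.
  assert (Hp : forall s, 0 <= s <= 1 -> 0 < a + s * (b - a)) by (intros s Hs; nra).
  replace (/ (a * b)) with (1 / (a * (a + 1 * (b - a))) - 0 / (a * (a + 0 * (b - a))))
    by (field; lra).
  apply (is_RInt_derive (V := R_CompleteNormedModule) (fun s => s / (a * (a + s * (b - a)))));
  intros s; rewrite Rmin_left, Rmax_right by lra; intros Hs; specialize (Hp s Hs).
  - auto_derive.
    + apply Rmult_integral_contrapositive. lra.
    + field. lra.
  - apply (ex_derive_continuous (K := R_AbsRing) (V := R_NormedModule)).
    auto_derive. apply Rgt_not_eq. nra.
Qed.

(** The chord estimate for a piece of contour inside one of the two sectors: by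
    dilation about its first end point it may be replaced by its chord, along
    which the imaginary part interpolates linearly. *)
Lemma tail_bound (g : R -> C) (f : C -> C) (M Y u v : R) :
  0 < Y -> 0 <= M -> piecewise_C1 g u v -> tail_ok f M Y ->
  (forall t, u <= t <= v -> Y <= Rabs (Im (g t)) /\ 2 * Rabs (Re (g t)) <= Rabs (Im (g t))
     /\ 0 < Im (g u) * Im (g t)) ->
  Cmod (CInt (fun t => f (g t) * velocity g t)%C u v) <= 4 * M / Y ^ 3.
Proof.
  intros HY HM Hg [df Hf] Hsec. assert (Huv := piecewise_C1_le _ _ _ Hg).
  set (c := g u).
  assert (Hcone : forall s t, 0 <= s <= 1 -> u <= t <= v ->
    let z := (c + RtoC s * (g t - c))%C in
    Rabs (Im z) = Rabs (Im c) + s * (Rabs (Im (g t)) - Rabs (Im c)) /\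
    Y <= Rabs (Im z) /\ 2 * Rabs (Re z) <= Rabs (Im z)).
  { intros s t Hs Ht z.
    assert (Iz : Im z = Im c + s * (Im (g t) - Im c)).
    { unfold z. destruct c, (g t); simpl; ring. }
    assert (Rz : Re z = Re c + s * (Re (g t) - Re c)).
    { unfold z. destruct c, (g t); simpl; ring. }
    destruct (Hsec t Ht) as [A1 [A2 A3]].
    destruct (Hsec u (conj (Rle_refl _) Huv)) as [B1 [B2 _]].
    fold c in A3, B1, B2.
    rewrite Iz, Rabs_convex_same_sign by assumption.
    split; [reflexivity|]. split; [nra|].
    rewrite Rz. assert (K := Rabs_convex s (Re c) (Re (g t)) Hs). nra. }
  assert (Hd := dilation g f df u v c 0 1 Hg Rle_0_1).
  rewrite (CInt_ext (fun t => f (c + RtoC 0 * (g t - c)) * RtoC 0 * velocity g t)%C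
    (fun t => RtoC 0 * velocity g t)%C u v) in Hd; [|exact Huv | intros; ring].
  assert (H0 : CInt (fun t => RtoC 0 * velocity g t)%C u v = RtoC 0).
  { destruct (pw_cont_mass _ _ _ (pw_cont_velocity _ _ _ Hg)) as [V [_ K]].
    apply Cmod_eq_0. apply Rle_antisym; [|apply Cmod_ge_0].
    apply Rle_trans with (V * 0); [|lra]. apply K.
    - intros; apply continuous_const.
    - intros; rewrite Cmod_0; lra. }
  rewrite H0 in Hd.
  rewrite (CInt_ext _ (fun t => f (g t) * velocity g t)%C u v) in Hd; [|exact Huv|].
  2:{ intros t _. replace (c + RtoC 1 * (g t - c))%C with (g t) by ring. ring. }
  replace (CInt (fun t => f (g t) * velocity g t)%C u v)
    with (CInt (fun t => f (g t) * velocity g t)%C u v - RtoC 0)%C by ring.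
  rewrite Hd.
  2:{ intros s t Hs Ht. destruct (Hcone s t Hs Ht) as [_ [K1 K2]].
      destruct (Hf _ K1 K2) as [L1 [L2 _]]. now split. }
  clear Hd H0.
  assert (Hvv : u <= v <= v) by lra.
  destruct (Hsec v Hvv) as [A1 [A2 A3]].
  destruct (Hsec u (conj (Rle_refl _) Huv)) as [B1 [B2 _]]. fold c in A3, B1, B2.
  set (y0 := Rabs (Im c)) in *. set (y1 := Rabs (Im (g v))) in *.
  assert (Hchord : Cmod (g v - c) <= 2 * (y0 + y1)).
  { eapply Rle_trans; [apply Cmod_triangle|]. rewrite Cmod_opp.
    assert (K1 := Cmod_le_Re_Im (g v)). assert (K2 := Cmod_le_Re_Im c).
    fold y1 in K1. fold y0 in K2. lra. }
  pose (z := fun s => (c + RtoC s * (g v - c))%C).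
  apply Rle_trans with (2 * (y0 + y1) * M / Y ^ 2 * / (y0 * y1)).
  - apply (Cmod_CInt_le (fun s => f (c + RtoC s * (g v - c)) * (g v - c)
                   - f (c + RtoC s * (g u - c)) * (g u - c))%C 0 1 _
      (fun s => 2 * (y0 + y1) * M / Y ^ 2 * / (y0 + s * (y1 - y0)) ^ 2)).
    + lra.
    + intros s Hs. destruct (Hcone s v Hs Hvv) as [K0 [K1 K2]].
      fold c. replace (f (c + RtoC s * (g v - c)) * (g v - c)
                   - f (c + RtoC s * (c - c)) * (c - c))%C
        with (f (c + RtoC s * (g v - c)) * (g v - c))%C by ring.
      destruct (Hf _ K1 K2) as [_ [_ K3]].
      fold y0 y1 in K0. rewrite K0 in K1, K3. set (y := y0 + s * (y1 - y0)) in *.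
      rewrite Cmod_mult.
      assert (Hfz : Cmod (f (c + RtoC s * (g v - c))%C) <= M / Y ^ 2 * / y ^ 2).
      { apply Rmult_le_reg_r with (y ^ 4); [apply pow_lt; lra|].
        eapply Rle_trans; [exact K3|].
        replace (M / Y ^ 2 * / y ^ 2 * y ^ 4) with (M * ((y / Y) * (y / Y))) by (field; lra).
        assert (Hq : 1 <= y / Y).
        { apply Rmult_le_reg_r with Y; [exact HY|]. unfold Rdiv.
          rewrite Rmult_assoc, Rinv_l by lra. lra. }
        rewrite <- (Rmult_1_r M) at 1. apply Rmult_le_compat_l; [exact HM|].
        generalize (y / Y), Hq. intros q Hq'. nra. }
      replace (2 * (y0 + y1) * M / Y ^ 2 * / y ^ 2)
        with ((M / Y ^ 2 * / y ^ 2) * (2 * (y0 + y1))) by (field; lra).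
      apply Rmult_le_compat; auto using Cmod_ge_0.
    + apply CInt_correct, ex_CInt_continuous; [lra|]. intros s Hs.
      assert (Hz : forall w, u <= w <= v ->
        continuous (fun s => f (c + RtoC s * (g w - c)) * (g w - c))%C s).
      { intros w Hw. apply continuous_Cmult; [|apply continuous_const].
        destruct (Hcone s w Hs Hw) as [_ [K1 K2]].
        apply (continuous_comp (fun s => c + RtoC s * (g w - c))%C f).
        - apply continuous_Cplus; [apply continuous_const|].
          apply continuous_Cmult; [|apply continuous_const].
          apply continuous_RtoC, continuous_id.
        - apply (deriv_continuous (X := C_UniformSpace) f _ _ (proj1 (Hf _ K1 K2))). }
      apply continuous_Cminus; apply Hz; lra.
    + apply (is_RInt_scal (V := R_NormedModule)). apply is_RInt_inv_sqr; lra.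
  - assert (E : 2 * (y0 + y1) * M / Y ^ 2 * / (y0 * y1) = 2 * M / Y ^ 2 * (/ y0 + / y1))
      by (field; lra).
    rewrite E.
    replace (4 * M / Y ^ 3) with (2 * M / Y ^ 2 * (/ Y + / Y)) by (field; lra).
    assert (I0 : / y0 <= / Y) by (apply Rinv_le_contravar; lra).
    assert (I1 : / y1 <= / Y) by (apply Rinv_le_contravar; lra).
    apply Rmult_le_compat_l; [|lra].
    apply Rmult_le_pos; [lra|]. left. apply Rinv_0_lt_compat, pow_lt, HY.
Qed.

Notation line_integrand Sg f := (fun t => Cmult (f (Sg t)) (velocity Sg t)).

Lemma ex_CInt_line (Sg : R -> C) (f : C -> C) (a b : R) :
  from_pioo_to_mioo Sg -> (forall t, continuous (fun s => f (Sg s)) t) ->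
  ex_CInt (line_integrand Sg f) a b.
Proof.
  intros HS Hf.
  assert (Hle : forall a b, a <= b -> ex_CInt (line_integrand Sg f) a b).
  { intros u v Huv. apply pw_cont_ex_CInt; [|exact Hf].
    apply pw_cont_velocity. now apply HS. }
  destruct (Rle_dec a b) as [H|H]; [now apply Hle|].
  apply (ex_RInt_swap (V := C_R_NormedModule)). apply Hle. lra.
Qed.

(** The truncation time T depends on the contour and on the decay constants, not
    on the integrand: this is the source of all uniformity below. *)
Lemma line_cauchy (Sg : R -> C) (M Y e : R) :
  from_pioo_to_mioo Sg -> 0 <= M -> 0 < e ->
  exists T, 0 < T /\ forall f, tail_ok f M Y ->
    (forall t, continuous (fun s => f (Sg s)) t) ->
    forall a b a' b', a <= - T -> a' <= - T -> T <= b -> T <= b' ->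
    Cmod (CInt (line_integrand Sg f) a b - CInt (line_integrand Sg f) a' b')%C <= e.
Proof.
  intros HS HM He.
  pose (Y' := Rmax (Rmax Y 1) (8 * M / e)).
  assert (HY1 : 1 <= Y') by (eapply Rle_trans; [apply Rmax_r | apply Rmax_l]).
  assert (HYY : Y <= Y') by (eapply Rle_trans; [apply Rmax_l | apply Rmax_l]).
  assert (HYe : 8 * M / e <= Y') by apply Rmax_r.
  destruct (line_ends Sg Y' HS) as [T [HT [Hl Hr]]].
  assert (H4 : 2 * (4 * M / Y' ^ 3) <= e).
  { apply Rmult_le_reg_r with (Y' ^ 3); [apply pow_lt; lra|].
    replace (2 * (4 * M / Y' ^ 3) * Y' ^ 3) with (8 * M / e * e) by (field; lra).
    rewrite (Rmult_comm e). apply Rmult_le_compat_r; [lra|].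
    apply Rle_trans with (Y' * 1); [lra|]. simpl. apply Rmult_le_compat_l; nra. }
  exists T. split; [exact HT|]. intros f Hf Hc.
  assert (Hf' : tail_ok f M Y').
  { destruct Hf as [df Hf]. exists df. intros z Hz. apply Hf. lra. }
  assert (Hex := fun a b => ex_CInt_line Sg f a b HS Hc).
  assert (HR : forall u v, T <= u -> u <= v ->
            Cmod (CInt (line_integrand Sg f) u v) <= 4 * M / Y' ^ 3).
  { intros u v Hu Huv. apply tail_bound; try lra; [now apply HS | exact Hf'|].
    intros t Ht. destruct (Hr u Hu) as [_ [U2 _]].
    assert (Ht' : T <= t) by lra. destruct (Hr t Ht') as [R1 [R2 R3]].
    repeat split; [|exact R3 | nra]. rewrite Rabs_left; lra. }
  assert (HL : forall u v, v <= - T -> u <= v ->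
            Cmod (CInt (line_integrand Sg f) u v) <= 4 * M / Y' ^ 3).
  { intros u v Hv Huv. apply tail_bound; try lra; [now apply HS | exact Hf'|].
    intros t Ht. assert (Hu : u <= - T) by lra. destruct (Hl u Hu) as [_ [U2 _]].
    assert (Ht' : t <= - T) by lra. destruct (Hl t Ht') as [R1 [R2 R3]].
    repeat split; [|exact R3 | nra]. rewrite Rabs_pos_eq; lra. }
  assert (Habs : forall u v, (T <= u /\ T <= v) \/ (u <= - T /\ v <= - T) ->
            Cmod (CInt (line_integrand Sg f) u v) <= 4 * M / Y' ^ 3).
  { intros u v Huv. destruct (Rle_dec u v) as [Hle|Hle].
    - destruct Huv as [[H1 H2]|[H1 H2]]; [now apply HR | now apply HL].
    - assert (E : CInt (line_integrand Sg f) u v = (- CInt (line_integrand Sg f) v u)%C).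
      { symmetry. apply (opp_RInt_swap (V := C_R_CompleteNormedModule)), Hex. }
      rewrite E, Cmod_opp.
      destruct Huv as [[H1 H2]|[H1 H2]]; [apply HR | apply HL]; lra. }
  intros a b a' b' Ha Ha' Hb Hb'.
  rewrite (CInt_Chasles _ a a' b), (CInt_Chasles _ a' b' b) by apply Hex.
  match goal with |- Cmod ?x <= _ => replace x with
    (CInt (line_integrand Sg f) a a' + CInt (line_integrand Sg f) b' b)%C by ring end.
  eapply Rle_trans; [apply Cmod_triangle|].
  assert (K1 := Habs a a' (or_intror (conj Ha Ha'))).
  assert (K2 := Habs b' b (or_introl (conj Hb' Hb))). lra.
Qed.

Lemma is_line_int_of_limit (f : R -> C) (L : C) :
  (forall a b, ex_CInt f a b) ->
  (forall e, 0 < e -> exists T, 0 < T /\ forall a b, a <= - T -> T <= b ->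
     Cmod (CInt f a b - L) <= e) ->
  is_RInt_gen (V := C_R_NormedModule) f (Rbar_locally m_infty) (Rbar_locally p_infty) L.
Proof.
  intros Hex H P HP.
  apply locally_Cmod in HP. destruct HP as [d [Hd HP]].
  assert (Hd2 : 0 < d / 2) by lra. destruct (H _ Hd2) as [T [HT K]].
  apply (Filter_prod _ _ _ (fun a => a < - T) (fun b => T < b)).
  - now exists (- T).
  - now exists T.
  - intros a b Ha Hb. exists (CInt f a b). split; [now apply CInt_correct, Hex|].
    apply HP. eapply Rle_lt_trans; [apply K; lra | lra].
Qed.

Lemma line_limit_exists (f : R -> C) :
  (forall e, 0 < e -> exists T, 0 < T /\ forall a b a' b',
     a <= - T -> a' <= - T -> T <= b -> T <= b' ->
     Cmod (CInt f a b - CInt f a' b') <= e) ->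
  exists L : C, forall e, 0 < e -> exists T, 0 < T /\ forall a b, a <= - T -> T <= b ->
     Cmod (CInt f a b - L) <= e.
Proof.
  intros H.
  pose (F := filter_prod (Rbar_locally m_infty) (Rbar_locally p_infty)).
  assert (HF : ProperFilter F) by (apply filter_prod_proper; apply Rbar_locally_filter).
  destruct (proj1 (filterlim_locally_cauchy (U := C_R_CompleteNormedModule) (F := F)
              (fun ab => CInt f (fst ab) (snd ab)))) as [L HL].
  - intros [e He]. assert (He2 : 0 < e / 2) by lra.
    destruct (H _ He2) as [T [HT K]].
    exists (fun ab => fst ab < - T /\ T < snd ab). split.
    + apply (Filter_prod _ _ _ (fun a => a < - T) (fun b => T < b)).
      * now exists (- T).
      * now exists T.
      * now split.
    + intros [a b] [a' b'] [A B] [A' B']; simpl in *. apply ball_Cmod.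
      eapply Rle_lt_trans; [apply K; lra | simpl; lra].
  - exists L. intros e He. assert (He2 : 0 < e / 2) by lra.
    destruct (H _ He2) as [T [HT K]]. exists T. split; [exact HT|].
    intros a b Ha Hb.
    destruct (HL _ (locally_Cmod_ball L _ He2)) as [Q1 Q2 [N1 HQ1] [N2 HQ2] HQ].
    pose (a' := Rmin (- T) (N1 - 1)). pose (b' := Rmax T (N2 + 1)).
    assert (Ha' : a' <= - T) by apply Rmin_l. assert (Hb' : T <= b') by apply Rmax_l.
    assert (Ha1 : a' <= N1 - 1) by apply Rmin_r. assert (Hb1 : N2 + 1 <= b') by apply Rmax_r.
    assert (K1 : Cmod (CInt f a' b' - L) < e / 2) by (apply (HQ a' b'); [apply HQ1 | apply HQ2]; lra).
    assert (K2 := K a b a' b' Ha Ha' Hb Hb').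
    replace (CInt f a b - L)%C with ((CInt f a b - CInt f a' b') + (CInt f a' b' - L))%C by ring.
    eapply Rle_trans; [apply Cmod_triangle|]. lra.
Qed.

Lemma is_line_int_unique (Sg : R -> C) (f : C -> C) (L : C) :
  is_RInt_gen (V := C_R_NormedModule) (line_integrand Sg f)
    (Rbar_locally m_infty) (Rbar_locally p_infty) L -> line_int Sg f = L.
Proof.
  intros H. unfold line_int.
  apply (is_RInt_gen_unique (V := C_R_CompleteNormedModule)
    (Fa := Rbar_locally m_infty) (Fb := Rbar_locally p_infty) (line_integrand Sg f) L H).
Qed.

Lemma line_int_close (Sg : R -> C) (M Y e : R) :
  from_pioo_to_mioo Sg -> 0 <= M -> 0 < e ->
  exists T, 0 < T /\ forall f, tail_ok f M Y ->
    (forall t, continuous (fun s => f (Sg s)) t) ->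
    forall a b, a <= - T -> T <= b ->
    Cmod (CInt (line_integrand Sg f) a b - line_int Sg f)%C <= e.
Proof.
  intros HS HM He. assert (He2 : 0 < e / 2) by lra.
  destruct (line_cauchy Sg M Y (e / 2) HS HM He2) as [T [HT K]].
  exists T. split; [exact HT|]. intros f Hf Hc a b Ha Hb.
  destruct (line_limit_exists (line_integrand Sg f)) as [L HL].
  { intros d Hd. destruct (line_cauchy Sg M Y d HS HM Hd) as [T' [HT' K']].
    exists T'. split; [exact HT' | now apply K']. }
  assert (Hex := fun a b => ex_CInt_line Sg f a b HS Hc).
  rewrite (is_line_int_unique Sg f L) by now apply is_line_int_of_limit.
  destruct (HL _ He2) as [T' [HT' K']].
  pose (T2 := Rmax T T'). assert (H1 : T <= T2) by apply Rmax_l.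
  assert (H2 : T' <= T2) by apply Rmax_r.
  assert (K1 : Cmod (CInt (line_integrand Sg f) (- T2) T2 - L) <= e / 2) by (apply K'; lra).
  assert (K2 : Cmod (CInt (line_integrand Sg f) a b - CInt (line_integrand Sg f) (- T2) T2) <= e / 2)
    by (apply K; try assumption; lra).
  match goal with |- Cmod (?x - L) <= _ => replace (x - L)%C
    with ((x - CInt (line_integrand Sg f) (- T2) T2) + (CInt (line_integrand Sg f) (- T2) T2 - L))%C
    by ring end.
  eapply Rle_trans; [apply Cmod_triangle|]. lra.
Qed.

(** A uniform limit of the integrals over [-T, T]. *)
Lemma continuous_line_int {X : UniformSpace} (Sg : R -> C) (f : X -> C -> C) (M Y : R) (x0 : X) :
  from_pioo_to_mioo Sg -> 0 <= M -> (forall x, tail_ok (f x) M Y) ->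
  (forall x t, continuous (fun q : X * R => f (fst q) (Sg (snd q))) (x, t)) ->
  continuous (fun x => line_int Sg (f x)) x0.
Proof.
  intros HS HM Hf Hc. apply continuous_Cmod_intro. intros e He.
  assert (He3 : 0 < e / 3) by lra.
  destruct (line_int_close Sg M Y _ HS HM He3) as [T [HT K]].
  assert (Hsl : forall x t, continuous (fun s => f x (Sg s)) t).
  { intros x t. apply (continuous_slice (fun x s => f x (Sg s))), Hc. }
  assert (Hcont : continuous (fun x => CInt (fun t => f x (Sg t) * velocity Sg t)%C (- T) T) x0).
  { apply (continuous_CInt_param (fun x t => f x (Sg t))); [|exact Hc].
    apply pw_cont_velocity, HS. lra. }
  generalize (continuous_Cmod_elim _ _ _ Hcont He3). apply filter_imp. intros x Hx.
  assert (K1 := K (f x) (Hf x) (Hsl x) (- T) T (Rle_refl _) (Rle_refl _)).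
  assert (K2 := K (f x0) (Hf x0) (Hsl x0) (- T) T (Rle_refl _) (Rle_refl _)).
  set (A := CInt (fun t => f x (Sg t) * velocity Sg t)%C (- T) T) in *.
  set (B := CInt (fun t => f x0 (Sg t) * velocity Sg t)%C (- T) T) in *.
  replace (line_int Sg (f x) - line_int Sg (f x0))%C
    with (- (A - line_int Sg (f x)) + ((A - B) + (B - line_int Sg (f x0))))%C by ring.
  eapply Rle_trans; [apply Cmod_triangle|]. rewrite Cmod_opp.
  assert (K3 := Cmod_triangle (A - B) (B - line_int Sg (f x0))). lra.
Qed.

Lemma line_int_ext (Sg : R -> C) (f g : C -> C) :
  (forall t, f (Sg t) = g (Sg t)) -> line_int Sg f = line_int Sg g.
Proof.
  intros H. unfold line_int.
  assert (E : (line_integrand Sg f) = (line_integrand Sg g)).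
  { apply functional_extensionality. intros t. now rewrite (H t). }
  rewrite E. reflexivity.
Qed.

(** * Double integrals with a Cauchy kernel *)

Lemma RtoC_m1 : RtoC (-1) = (- RtoC 1)%C.
Proof. unfold RtoC, Copp; simpl. f_equal; lra. Qed.

Lemma cderiv_Cminus_l (p z : C) : cderiv (fun y => p - y)%C z (RtoC (-1)).
Proof.
  apply (deriv_ext _ (fun y => p + RtoC (-1) * y)%C _ _ (RtoC 0 + RtoC (-1) * RtoC 1)%C).
  - intros y. rewrite RtoC_m1. ring.
  - rewrite RtoC_m1. ring.
  - apply deriv_plus; [apply deriv_const | apply deriv_scal, (deriv_id (fun z : C => z))].
Qed.

Lemma cderiv_cauchy_kernel (A : C -> C) (p z l : C) :
  cderiv A z l -> p <> z ->
  cderiv (fun y => A y / (p - y))%C z (l / (p - z) + A z / ((p - z) * (p - z)))%C.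
Proof.
  intros HA Hp. assert (H0 : (p - z)%C <> RtoC 0) by now apply Cminus_eq_contra.
  apply (deriv_ext _ (fun y => A y * / (p - y))%C _ _
    (l * / (p - z) + A z * (- / ((p - z) * (p - z)) * RtoC (-1)))%C); [reflexivity| |].
  - rewrite RtoC_m1. field. exact H0.
  - apply (deriv_mult _ A (fun y => / (p - y))%C); [exact HA|].
    apply (deriv_comp _ Cinv (fun y => p - y)%C); [now apply cderiv_inv | apply cderiv_Cminus_l].
Qed.

Lemma continuous_cauchy_kernel_deriv (A dA : C -> C) (p z : C) :
  continuous A z -> continuous dA z -> p <> z ->
  continuous (fun y => dA y / (p - y) + A y / ((p - y) * (p - y)))%C z.
Proof.
  intros HA HdA Hp. assert (H0 : (p - z)%C <> RtoC 0) by now apply Cminus_eq_contra.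
  assert (Hc : continuous (fun y => p - y)%C z).
  { apply continuous_Cminus; [apply continuous_const | apply continuous_id]. }
  apply continuous_Cplus; apply continuous_Cdiv; auto.
  - now apply continuous_Cmult.
  - now apply Cmult_neq_0.
Qed.

Lemma tail_ok_cauchy_kernel (A : C -> C) (M Y P : R) (p : C) :
  0 <= P -> tail_ok A M Y -> Cmod p <= P ->
  tail_ok (fun z => A z / (p - z))%C M (Rmax Y (P + 1)).
Proof.
  intros HP0 [dA HA] HP.
  exists (fun y => dA y / (p - y) + A y / ((p - y) * (p - y)))%C. intros z Hz1 Hz2.
  assert (HY : Y <= Rabs (Im z)) by (eapply Rle_trans; [apply Rmax_l | exact Hz1]).
  assert (HZ : P + 1 <= Rabs (Im z)) by (eapply Rle_trans; [apply Rmax_r | exact Hz1]).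
  destruct (HA z HY Hz2) as [A1 [A2 A3]].
  assert (Hd : 1 <= Cmod (p - z)).
  { assert (H := im_le_Cmod z).
    assert (Ht := Cmod_triangle p (- (p - z))).
    replace (p + - (p - z))%C with z in Ht by ring. rewrite Cmod_opp in Ht. lra. }
  assert (Hne : p <> z).
  { intros E. rewrite E in Hd. replace (z - z)%C with (RtoC 0) in Hd by ring.
    rewrite Cmod_0 in Hd. lra. }
  split; [now apply cderiv_cauchy_kernel|]. split.
  { apply continuous_cauchy_kernel_deriv; auto.
    apply (deriv_continuous (X := C_UniformSpace) A z _ A1). }
  rewrite Cmod_div by now apply Cminus_eq_contra.
  eapply Rle_trans; [|exact A3]. apply Rmult_le_compat_r; [apply pow_le, Rabs_pos|].
  assert (H := Cmod_ge_0 (A z)).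
  apply Rmult_le_reg_r with (Cmod (p - z)); [lra|].
  unfold Rdiv. rewrite Rmult_assoc, Rinv_l by lra. nra.
Qed.

(** Every double integral of the theorem has this form, with p the loop or its
    inverse and om the velocity of the loop. *)
Definition cauchy_int (Sg : R -> C) (A : C -> C) (p b om : R -> C) : C :=
  CInt (fun s => b s * line_int Sg (fun z => A z / (p s - z)) * om s)%C 0 1.

(** The loop data of [cauchy_int] are prolonged from [0, 1] to the whole line, so
    that continuity can be required everywhere. *)
Record loop_ok (Sg : R -> C) (p b om : R -> C) (P : R) : Prop := {
  loop_ok_p : forall s, continuous p s;
  loop_ok_b : forall s, continuous b s;
  loop_ok_om : pw_cont om 0 1;
  loop_ok_disj : forall s t, p s <> Sg t;
  loop_ok_bound : forall s, Cmod (p s) <= P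
}.

Arguments loop_ok_p {Sg p b om P}.
Arguments loop_ok_b {Sg p b om P}.
Arguments loop_ok_om {Sg p b om P}.
Arguments loop_ok_disj {Sg p b om P}.
Arguments loop_ok_bound {Sg p b om P}.

Lemma continuous_bounded (b : R -> C) (u v : R) :
  u <= v -> (forall s, continuous b s) ->
  exists B, 0 <= B /\ forall s, u <= s <= v -> Cmod (b s) <= B.
Proof.
  intros Huv Hb. destruct (continuity_ab_maj (fun s => Cmod (b s)) u v Huv) as [s0 [H0 _]].
  - intros s _. apply continuity_pt_filterlim. apply continuous_Cmod, Hb.
  - exists (Cmod (b s0)). split; [apply Cmod_ge_0 | exact H0].
Qed.

Lemma loop_ok_bound_pos (Sg : R -> C) (p b om : R -> C) (P : R) : loop_ok Sg p b om P -> 0 <= P.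
Proof. intros H. eapply Rle_trans; [apply Cmod_ge_0 | apply (loop_ok_bound H 0)]. Qed.

Lemma loop_ok_kernel_continuous (Sg : R -> C) (A : C -> C) (p b om : R -> C) (P s t : R) :
  from_pioo_to_mioo Sg -> (forall t, continuous (fun s => A (Sg s)) t) ->
  loop_ok Sg p b om P ->
  continuous (fun q : R * R => A (Sg (snd q)) / (p (fst q) - Sg (snd q)))%C (s, t).
Proof.
  intros HS HA Hl. apply continuous_Cdiv.
  - apply (continuous_comp snd (fun s => A (Sg s))); [apply continuous_snd | apply HA].
  - apply continuous_Cminus.
    + apply (continuous_comp fst p); [apply continuous_fst | apply (loop_ok_p Hl)].
    + apply (continuous_comp snd Sg); [apply continuous_snd | now apply line_continuous].
  - simpl. apply Cminus_eq_contra, (loop_ok_disj Hl).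
Qed.

Lemma loop_ok_line_continuous (Sg : R -> C) (A : C -> C) (p b om : R -> C) (P M Y s : R) :
  from_pioo_to_mioo Sg -> 0 <= M -> tail_ok A M Y ->
  (forall t, continuous (fun s => A (Sg s)) t) -> loop_ok Sg p b om P ->
  continuous (fun s => line_int Sg (fun z => A z / (p s - z)))%C s.
Proof.
  intros HS HM Ht HA Hl.
  apply (continuous_line_int Sg (fun s z => A z / (p s - z))%C M (Rmax Y (P + 1))); auto.
  - intros x. apply tail_ok_cauchy_kernel; auto; [now apply (loop_ok_bound_pos _ _ _ _ _ Hl) | apply (loop_ok_bound Hl)].
  - intros x t. now apply (loop_ok_kernel_continuous Sg A p b om P).
Qed.

Lemma ex_cauchy_int (Sg : R -> C) (A : C -> C) (p b om : R -> C) (P M Y : R) :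
  from_pioo_to_mioo Sg -> 0 <= M -> tail_ok A M Y ->
  (forall t, continuous (fun s => A (Sg s)) t) -> loop_ok Sg p b om P ->
  ex_CInt (fun s => b s * line_int Sg (fun z => A z / (p s - z)) * om s)%C 0 1.
Proof.
  intros HS HM Ht HA Hl. apply pw_cont_ex_CInt; [apply (loop_ok_om Hl)|].
  intros s. apply continuous_Cmult; [apply (loop_ok_b Hl)|].
  now apply (loop_ok_line_continuous Sg A p b om P M Y).
Qed.

(** Truncating the infinite contour to [-T, T] allows the two integrations to be
    interchanged. *)
Lemma cauchy_int_truncate (Sg : R -> C) (A : C -> C) (p b om : R -> C) (P M Y : R) :
  from_pioo_to_mioo Sg -> 0 <= M -> tail_ok A M Y ->
  (forall t, continuous (fun s => A (Sg s)) t) -> loop_ok Sg p b om P ->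
  forall e, 0 < e -> exists T0, 0 < T0 /\ forall T, T0 <= T ->
    Cmod (CInt (fun t => (A (Sg t) * CInt (fun s => b s / (p s - Sg t) * om s) 0 1)
                         * velocity Sg t)%C (- T) T - cauchy_int Sg A p b om) <= e.
Proof.
  intros HS HM Ht HA Hl e He.
  destruct (continuous_bounded b 0 1 Rle_0_1 (loop_ok_b Hl)) as [B [HB0 HB]].
  destruct (pw_cont_mass _ _ _ (loop_ok_om Hl)) as [V [HV0 HV]].
  assert (HVB : 0 < V * B + 1) by nra.
  assert (He' : 0 < e / (V * B + 1)) by (apply Rdiv_lt_0_compat; lra).
  destruct (line_int_close Sg M (Rmax Y (P + 1)) _ HS HM He') as [T0 [HT0 K]].
  exists T0. split; [exact HT0|]. intros T HT.
  pose (F := fun s t => (A (Sg t) / (p s - Sg t))%C).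
  assert (HF : forall s t, continuous (fun q : R * R => F (fst q) (snd q)) (s, t)).
  { intros s t. now apply (loop_ok_kernel_continuous Sg A p b om P). }
  assert (Hv : pw_cont (velocity Sg) (- T) T) by (apply pw_cont_velocity, HS; lra).
  assert (E : CInt (fun t => (A (Sg t) * CInt (fun s => b s / (p s - Sg t) * om s) 0 1)
                         * velocity Sg t)%C (- T) T
    = CInt (fun s => (b s * CInt (fun t => F s t * velocity Sg t) (- T) T) * om s)%C 0 1).
  { transitivity (CInt (fun s => CInt (fun t => b s * F s t * velocity Sg t) (- T) T * om s)%C 0 1).
    - rewrite (fubini (fun s t => b s * F s t)%C om (velocity Sg)); [|exact (loop_ok_om Hl) | exact Hv|].
      2:{ intros s t. apply continuous_Cmult; [|apply HF].
          apply (continuous_comp fst b); [apply continuous_fst | apply (loop_ok_b Hl)]. }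
      apply CInt_ext; [lra|]. intros t _. f_equal. symmetry. apply is_CInt_unique.
      apply (is_CInt_ext (fun s => A (Sg t) * (b s / (p s - Sg t) * om s))%C); [lra| |].
      { intros s _. unfold F. field. apply Cminus_eq_contra, (loop_ok_disj Hl). }
      apply is_CInt_Cmult, CInt_correct, pw_cont_ex_CInt; [exact (loop_ok_om Hl)|].
      intros s. apply continuous_Cdiv; [apply (loop_ok_b Hl) | |apply Cminus_eq_contra, (loop_ok_disj Hl)].
      apply continuous_Cminus; [apply (loop_ok_p Hl) | apply continuous_const].
    - apply CInt_ext; [lra|]. intros s _. f_equal. apply is_CInt_unique.
      apply (is_CInt_ext (fun t => b s * (F s t * velocity Sg t))%C); [lra | intros; ring|].
      apply is_CInt_Cmult, CInt_correct, pw_cont_ex_CInt; [exact Hv|].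
      intros t. now apply (continuous_slice F). }
  rewrite E. unfold cauchy_int.
  assert (HlimC := fun s => loop_ok_line_continuous Sg A p b om P M Y s HS HM Ht HA Hl).
  assert (HtrC : forall s, continuous (fun s => CInt (fun t => F s t * velocity Sg t)%C (- T) T) s).
  { intros s. now apply continuous_CInt_param. }
  rewrite (CInt_weight_minus om (fun s => b s * CInt (fun t => F s t * velocity Sg t) (- T) T)%C
    (fun s => b s * line_int Sg (fun z => A z / (p s - z)))%C).
  - apply Rle_trans with (V * (B * (e / (V * B + 1)))).
    + apply HV.
      * intros s. apply continuous_Cminus; (apply continuous_Cmult; [apply (loop_ok_b Hl)|]); [apply HtrC | apply HlimC].
      * intros s Hs.
        replace (b s * CInt (fun t => F s t * velocity Sg t) (- T) T
                 - b s * line_int Sg (fun z => A z / (p s - z)))%C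
          with (b s * (CInt (fun t => F s t * velocity Sg t) (- T) T
                 - line_int Sg (fun z => A z / (p s - z))))%C by ring.
        rewrite Cmod_mult. apply Rmult_le_compat; try apply Cmod_ge_0; [now apply HB|].
        apply (K (fun z => A z / (p s - z))%C); try lra.
        -- apply tail_ok_cauchy_kernel; auto;
             [now apply (loop_ok_bound_pos _ _ _ _ _ Hl) | apply (loop_ok_bound Hl)].
        -- intros t. now apply (continuous_slice F).
    + apply Rle_trans with ((V * B + 1) * (e / (V * B + 1))); [nra|].
      right. field. lra.
  - exact (loop_ok_om Hl).
  - intros s. apply continuous_Cmult; [apply (loop_ok_b Hl) | apply HtrC].
  - intros s. apply continuous_Cmult; [apply (loop_ok_b Hl) | apply HlimC].
Qed.

Lemma C_eq_of_close (x y : C) : (forall e, 0 < e -> Cmod (x - y) <= e) -> x = y.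
Proof.
  intros H. apply Ceq_minus, Cmod_eq_0. apply Rle_antisym; [|apply Cmod_ge_0].
  apply le_epsilon. intros e He. rewrite Rplus_0_l. now apply H.
Qed.

(** The double integral depends on the loop only through its Cauchy transform
    on the line. *)
Lemma cauchy_int_loop_change (Sg : R -> C) (A : C -> C) (M Y : R)
    (p1 b1 om1 p2 b2 om2 : R -> C) (P1 P2 : R) :
  from_pioo_to_mioo Sg -> 0 <= M -> tail_ok A M Y ->
  (forall t, continuous (fun s => A (Sg s)) t) ->
  loop_ok Sg p1 b1 om1 P1 -> loop_ok Sg p2 b2 om2 P2 ->
  (forall t, CInt (fun s => b1 s / (p1 s - Sg t) * om1 s)%C 0 1
             = CInt (fun s => b2 s / (p2 s - Sg t) * om2 s)%C 0 1) ->
  cauchy_int Sg A p1 b1 om1 = cauchy_int Sg A p2 b2 om2.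
Proof.
  intros HS HM Ht HA Hl1 Hl2 Heq. apply C_eq_of_close. intros e He.
  assert (He2 : 0 < e / 2) by lra.
  destruct (cauchy_int_truncate Sg A p1 b1 om1 P1 M Y HS HM Ht HA Hl1 _ He2) as [T1 [H1 K1]].
  destruct (cauchy_int_truncate Sg A p2 b2 om2 P2 M Y HS HM Ht HA Hl2 _ He2) as [T2 [H2 K2]].
  specialize (K1 _ (Rmax_l T1 T2)). specialize (K2 _ (Rmax_r T1 T2)).
  assert (HT : 0 < Rmax T1 T2) by (eapply Rlt_le_trans; [exact H1 | apply Rmax_l]).
  set (T := Rmax T1 T2) in *.
  rewrite (CInt_ext _ (fun t => (A (Sg t) * CInt (fun s => b2 s / (p2 s - Sg t) * om2 s) 0 1)
                         * velocity Sg t)%C) in K1; [|lra | intros t _; now rewrite Heq].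
  match type of K1 with Cmod (?x - ?y) <= _ => match type of K2 with Cmod (_ - ?w) <= _ =>
    replace (y - w)%C with (- (x - y) + (x - w))%C by ring end end.
  eapply Rle_trans; [apply Cmod_triangle|]. rewrite Cmod_opp. lra.
Qed.

(** With e = eps^2 as the parameter x, this replaces limits by values at e = 0. *)
Lemma continuous_cauchy_int {X : UniformSpace} (Sg : R -> C) (A : X -> C -> C)
    (p b : X -> R -> C) (om : R -> C) (P M Y : R) (x0 : X) :
  from_pioo_to_mioo Sg -> 0 <= M -> (forall x, tail_ok (A x) M Y) ->
  (forall x t, continuous (fun q : X * R => A (fst q) (Sg (snd q))) (x, t)) ->
  pw_cont om 0 1 ->
  (forall x s, continuous (fun q : X * R => p (fst q) (snd q)) (x, s)) ->
  (forall x s, continuous (fun q : X * R => b (fst q) (snd q)) (x, s)) ->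
  (forall x s t, p x s <> Sg t) -> (forall x s, Cmod (p x s) <= P) ->
  continuous (fun x => cauchy_int Sg (A x) (p x) (b x) om) x0.
Proof.
  intros HS HM Ht HA Hom Hp Hb Hd HP. unfold cauchy_int.
  assert (HP0 : 0 <= P) by (eapply Rle_trans; [apply Cmod_ge_0 | apply (HP x0 0)]).
  apply (continuous_CInt_param
    (fun x s => b x s * line_int Sg (fun z => A x z / (p x s - z)))%C); [exact Hom|].
  intros x s. apply continuous_Cmult; [apply Hb|].
  apply (continuous_line_int Sg (fun (q : X * R) z => A (fst q) z / (p (fst q) (snd q) - z))%C
           M (Rmax Y (P + 1))); auto.
  - intros q. apply tail_ok_cauchy_kernel; auto.
  - intros [x1 s1] t. apply continuous_Cdiv.
    + apply (continuous_comp_2 (fun q : X * R * R => fst (fst q)) snd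
        (fun u v => A u (Sg v))).
      * apply (continuous_comp fst fst); apply continuous_fst.
      * apply continuous_snd.
      * apply HA.
    + apply continuous_Cminus.
      * apply (continuous_comp fst (fun q : X * R => p (fst q) (snd q)));
          [apply continuous_fst | apply Hp].
      * apply (continuous_comp snd Sg); [apply continuous_snd | now apply line_continuous].
    + simpl. apply Cminus_eq_contra, Hd.
Qed.

Lemma tail_ok_scale (f : C -> C) (M Y k : R) (c : C) :
  0 < k -> tail_ok f M Y -> tail_ok (fun z => c * f (RtoC k * z))%C (Cmod c * M / k ^ 4) (Y / k).
Proof.
  intros Hk [df Hf]. exists (fun z => c * (df (RtoC k * z) * RtoC k))%C. intros z Hz1 Hz2.
  assert (I1 : Im (RtoC k * z) = k * Im z) by (destruct z; simpl; ring).
  assert (I2 : Re (RtoC k * z) = k * Re z) by (destruct z; simpl; ring).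
  assert (Hka : Rabs (Im (RtoC k * z)) = k * Rabs (Im z))
    by (rewrite I1, Rabs_mult, (Rabs_pos_eq k); lra).
  assert (Hkb : Rabs (Re (RtoC k * z)) = k * Rabs (Re z))
    by (rewrite I2, Rabs_mult, (Rabs_pos_eq k); lra).
  destruct (Hf (RtoC k * z)%C) as [T1 [T2 T3]].
  { rewrite Hka. apply Rmult_le_reg_r with (/ k); [now apply Rinv_0_lt_compat|].
    replace (k * Rabs (Im z) * / k) with (Rabs (Im z)) by (field; lra). exact Hz1. }
  { rewrite Hka, Hkb. nra. }
  split; [|split].
  - apply deriv_scal, (deriv_comp _ f (fun z => RtoC k * z)%C); [exact T1|].
    apply (deriv_ext _ (fun z => RtoC k * z)%C _ _ (RtoC k * RtoC 1)%C); [reflexivity | ring|].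
    apply deriv_scal, (deriv_id (fun z : C => z)).
  - apply continuous_Cmult; [apply continuous_const|].
    apply continuous_Cmult; [|apply continuous_const].
    apply (continuous_comp (fun z => RtoC k * z)%C df); [|exact T2].
    apply continuous_Cmult; [apply continuous_const | apply continuous_id].
  - rewrite Cmod_mult. rewrite Hka, Rpow_mult_distr in T3.
    apply Rmult_le_reg_r with (k ^ 4); [now apply pow_lt|].
    replace (Cmod c * M / k ^ 4 * k ^ 4) with (Cmod c * M) by (field; lra).
    replace (Cmod c * Cmod (f (RtoC k * z)%C) * Rabs (Im z) ^ 4 * k ^ 4)
      with (Cmod c * (Cmod (f (RtoC k * z)%C) * (k ^ 4 * Rabs (Im z) ^ 4))) by ring.
    apply Rmult_le_compat_l; [apply Cmod_ge_0 | exact T3].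
Qed.

(** Dilating the infinite contour: the two end contributions decay. *)
Lemma line_int_dilate (Sg : R -> C) (f df : C -> C) (M Y k : R) :
  from_pioo_to_mioo Sg -> 0 <= M -> 1 <= k -> tail_ok f M Y ->
  (forall s t, 1 <= s -> cderiv f (RtoC s * Sg t)%C (df (RtoC s * Sg t)%C)
                         /\ continuous df (RtoC s * Sg t)%C) ->
  line_int Sg f = line_int Sg (fun u => RtoC k * f (RtoC k * u))%C.
Proof.
  intros HS HM Hk Ht Hf.
  set (fk := fun u => (RtoC k * f (RtoC k * u))%C).
  assert (HMk : 0 <= Cmod (RtoC k) * M / k ^ 4).
  { apply Rmult_le_pos; [apply Rmult_le_pos; [apply Cmod_ge_0 | exact HM]|].
    left. apply Rinv_0_lt_compat, pow_lt. lra. }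
  assert (Hc : forall s t, 1 <= s -> continuous (fun t => f (RtoC s * Sg t))%C t).
  { intros s t Hs. apply (continuous_comp (fun t => RtoC s * Sg t)%C f).
    - apply continuous_Cmult; [apply continuous_const | now apply line_continuous].
    - apply (deriv_continuous (X := C_UniformSpace) f _ _ (proj1 (Hf s t Hs))). }
  assert (Hc1 : forall t, continuous (fun t => f (Sg t)) t).
  { intros t. apply (continuous_ext (fun t => f (RtoC 1 * Sg t))%C).
    - intros u. now rewrite Cmult_1_l.
    - apply Hc. lra. }
  assert (Hck : forall t, continuous (fun t => fk (Sg t)) t).
  { intros t. apply continuous_Cmult; [apply continuous_const | now apply Hc]. }
  assert (Hscale : forall s z, 1 <= s -> 
            Im (RtoC s * z) = s * Im z /\ Re (RtoC s * z) = s * Re z).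
  { intros s [x y] _. simpl. split; ring. }
  assert (Htk : tail_ok fk (Cmod (RtoC k) * M / k ^ 4) (Y / k)) by (apply tail_ok_scale; [lra | exact Ht]).
  apply C_eq_of_close. intros e He. assert (He3 : 0 < e / 3) by lra.
  destruct (line_int_close Sg M Y _ HS HM He3) as [T1 [HT1 K1]].
  destruct (line_int_close Sg _ (Y / k) _ HS HMk He3) as [T2 [HT2 K2]].
  pose (Y' := Rmax (Rmax Y 1) (12 * M * k / e)).
  assert (HY1 : 1 <= Y') by (eapply Rle_trans; [apply Rmax_r | apply Rmax_l]).
  assert (HYY : Y <= Y') by (eapply Rle_trans; [apply Rmax_l | apply Rmax_l]).
  assert (HYe : 12 * M * k / e <= Y') by apply Rmax_r.
  destruct (line_ends Sg Y' HS) as [T3 [HT3 [Hl Hr]]].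
  pose (T := Rmax (Rmax T1 T2) T3).
  assert (HT1' : T1 <= T) by (eapply Rle_trans; [apply Rmax_l | apply Rmax_l]).
  assert (HT2' : T2 <= T) by (eapply Rle_trans; [apply Rmax_r | apply Rmax_l]).
  assert (HT3' : T3 <= T) by apply Rmax_r.
  assert (HTT : - T <= T) by lra.
  assert (Q1 : Cmod (CInt (line_integrand Sg f) (- T) T - line_int Sg f) <= e / 3)
    by (apply K1; auto; lra).
  assert (Q2 : Cmod (CInt (line_integrand Sg fk) (- T) T - line_int Sg fk) <= e / 3)
    by (apply K2; auto; lra).
  assert (Hgp := line_C1 _ HS _ _ HTT).
  assert (E0 : forall s t, (RtoC 0 + RtoC s * (Sg t - RtoC 0))%C = (RtoC s * Sg t)%C)
    by (intros; ring).
  assert (Hd := dilation Sg f df (- T) T (RtoC 0) 1 k Hgp Hk).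
  rewrite (CInt_ext _ (line_integrand Sg fk)) in Hd; [|exact HTT|].
  2:{ intros t _. unfold fk. rewrite E0. ring. }
  rewrite (CInt_ext (fun t => f (RtoC 0 + RtoC 1 * (Sg t - RtoC 0)) * RtoC 1 * velocity Sg t)%C
    (line_integrand Sg f)) in Hd; [|exact HTT|].
  2:{ intros t _. rewrite E0, Cmult_1_l. ring. }
  assert (Hend : forall t s, 1 <= s -> (t = T \/ t = - T) ->
    Cmod (f (RtoC s * Sg t) * Sg t)%C <= 2 * M / Y' ^ 3).
  { intros t s Hs Htt.
    assert (A : Y' <= Rabs (Im (Sg t)) /\ 2 * Rabs (Re (Sg t)) <= Rabs (Im (Sg t))).
    { destruct Htt as [-> | ->].
      - destruct (Hr T HT3') as [R1 [R2 R3]]. split; [rewrite Rabs_left; lra | exact R3].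
      - assert (HT' : - T <= - T3) by lra. destruct (Hl _ HT') as [R1 [R2 R3]].
        split; [rewrite Rabs_pos_eq; lra | exact R3]. }
    destruct A as [A1 A2]. destruct Ht as [df' Ht].
    destruct (Hscale s (Sg t) Hs) as [I1 I2].
    assert (Hp := Rabs_pos (Im (Sg t))).
    assert (Hka : Rabs (Im (RtoC s * Sg t)) = s * Rabs (Im (Sg t)))
      by (rewrite I1, Rabs_mult, (Rabs_pos_eq s); lra).
    assert (Hkb : Rabs (Re (RtoC s * Sg t)) = s * Rabs (Re (Sg t)))
      by (rewrite I2, Rabs_mult, (Rabs_pos_eq s); lra).
    destruct (Ht (RtoC s * Sg t)%C) as [_ [_ T4]]; [rewrite Hka; nra | rewrite Hka, Hkb; nra|].
    set (y := Rabs (Im (Sg t))) in *. rewrite Hka in T4.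
    assert (T5 : Cmod (f (RtoC s * Sg t)%C) * y ^ 4 <= M).
    { eapply Rle_trans; [|exact T4]. apply Rmult_le_compat_l; [apply Cmod_ge_0|].
      apply pow_incr. split; nra. }
    rewrite Cmod_mult.
    assert (T6 : Cmod (Sg t) <= 2 * y) by (assert (K := Cmod_le_Re_Im (Sg t)); fold y in K; lra).
    assert (Hfp := Cmod_ge_0 (f (RtoC s * Sg t)%C)).
    apply Rle_trans with (Cmod (f (RtoC s * Sg t)%C) * (2 * y)); [now apply Rmult_le_compat_l|].
    apply Rmult_le_reg_r with (Y' ^ 3); [apply pow_lt; lra|].
    replace (2 * M / Y' ^ 3 * Y' ^ 3) with (2 * M) by (field; lra).
    apply Rle_trans with (Cmod (f (RtoC s * Sg t)%C) * (2 * y) * y ^ 3).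
    - apply Rmult_le_compat_l; [apply Rmult_le_pos; lra|]. apply pow_incr. lra.
    - replace (Cmod (f (RtoC s * Sg t)%C) * (2 * y) * y ^ 3)
        with (2 * (Cmod (f (RtoC s * Sg t)%C) * y ^ 4)) by ring. lra. }
  assert (Q3 : Cmod (CInt (line_integrand Sg fk) (- T) T - CInt (line_integrand Sg f) (- T) T) <= e / 3).
  { rewrite Hd by (intros s t Hs _; rewrite E0; apply Hf; lra).
    apply Rle_trans with ((k - 1) * (4 * M / Y' ^ 3)).
    - assert (Hint := is_RInt_const (V := R_NormedModule) 1 k (4 * M / Y' ^ 3)).
      change (scal ?x ?y) with (x * y) in Hint.
      refine (Cmod_CInt_le (fun s => f (RtoC 0 + RtoC s * (Sg T - RtoC 0)) * (Sg T - RtoC 0)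
        - f (RtoC 0 + RtoC s * (Sg (- T)%R - RtoC 0)) * (Sg (- T)%R - RtoC 0))%C
        1 k _ _ _ Hk _ _ Hint).
      + intros s Hs. rewrite !E0.
        replace (Sg T - RtoC 0)%C with (Sg T) by ring.
        replace (Sg (- T)%R - RtoC 0)%C with (Sg (- T)) by ring.
        eapply Rle_trans; [apply Cmod_triangle|]. rewrite Cmod_opp.
        assert (X1 := Hend T s (proj1 Hs) (or_introl eq_refl)).
        assert (X2 := Hend (- T) s (proj1 Hs) (or_intror eq_refl)).
        replace (4 * M / Y' ^ 3) with (2 * M / Y' ^ 3 + 2 * M / Y' ^ 3) by (field; lra). lra.
      + apply CInt_correct, ex_CInt_continuous; [exact Hk|]. intros s Hs.
        assert (Hs' : forall t, continuous (fun s => f (RtoC 0 + RtoC s * (Sg t - RtoC 0))%C) s).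
        { intros t. apply (continuous_comp (fun s => RtoC 0 + RtoC s * (Sg t - RtoC 0))%C f).
          - apply continuous_Cplus; [apply continuous_const|].
            apply continuous_Cmult; [apply continuous_RtoC, continuous_id | apply continuous_const].
          - rewrite E0.
            apply (deriv_continuous (X := C_UniformSpace) f _ _ (proj1 (Hf s t (proj1 Hs)))). }
        apply continuous_Cminus; (apply continuous_Cmult; [apply Hs' | apply continuous_const]).
    - apply Rmult_le_reg_r with (Y' ^ 3); [apply pow_lt; lra|].
      replace ((k - 1) * (4 * M / Y' ^ 3) * Y' ^ 3) with ((k - 1) * (4 * M)) by (field; lra).
      apply Rle_trans with (e / 3 * (12 * M * k / e)).
      + replace (e / 3 * (12 * M * k / e)) with (4 * M * k) by (field; lra). nra.
      + apply Rmult_le_compat_l; [lra|]. apply Rle_trans with (Y' * 1); [lra|].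
        simpl. apply Rmult_le_compat_l; nra. }
  match goal with |- Cmod (?x - ?y) <= _ =>
    replace (x - y)%C with (- (CInt (line_integrand Sg f) (- T)%R T - x)
      + (- (CInt (line_integrand Sg fk) (- T)%R T - CInt (line_integrand Sg f) (- T)%R T)
      + (CInt (line_integrand Sg fk) (- T)%R T - y)))%C by ring end.
  eapply Rle_trans; [apply Cmod_triangle|]. rewrite Cmod_opp.
  eapply Rle_trans; [apply Rplus_le_compat_l, Cmod_triangle|]. rewrite Cmod_opp. lra.
Qed.

(** * Loop integrals of exponentials of Laurent polynomials *)

(** ** Uniform Taylor approximation of the exponential *)

Fixpoint texp (n : nat) (z : C) : C :=
  match n with
  | O => RtoC 1
  | S k => (texp k z + RtoC (/ INR (fact (S k))) * z ^ S k)%C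
  end.

Lemma INR_fact_pos (n : nat) : 0 < INR (fact n).
Proof. apply lt_0_INR, lt_O_fact. Qed.

Lemma cderiv_pow (n : nat) (z : C) :
  cderiv (fun y => y ^ S n)%C z (RtoC (INR (S n)) * z ^ n)%C.
Proof.
  induction n as [|n IH].
  - apply (deriv_ext _ (fun y => y) _ _ (RtoC 1)); [intros y; simpl; ring | simpl; ring|].
    apply (deriv_id (fun z : C => z)).
  - apply (deriv_ext _ (fun y => y * y ^ S n)%C _ _
      (RtoC 1 * z ^ S n + z * (RtoC (INR (S n)) * z ^ n))%C).
    + reflexivity.
    + rewrite (S_INR (S n)), RtoC_plus, (Cpow_S z n). ring.
    + apply (deriv_mult _ (fun y => y) (fun y => y ^ S n)%C); [|exact IH].
      apply (deriv_id (fun z : C => z)).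
Qed.

Lemma cderiv_texp (n : nat) (z : C) : cderiv (texp (S n)) z (texp n z).
Proof.
  assert (Hterm : forall k, cderiv (fun y => RtoC (/ INR (fact (S k))) * y ^ S k)%C z
                    (RtoC (/ INR (fact k)) * z ^ k)%C).
  { intros k. apply (deriv_ext _ (fun y => RtoC (/ INR (fact (S k))) * y ^ S k)%C _ _
      (RtoC (/ INR (fact (S k))) * (RtoC (INR (S k)) * z ^ k))%C); [reflexivity| |].
    - rewrite Cmult_assoc, <- RtoC_mult. f_equal. f_equal.
      rewrite fact_simpl, mult_INR. field. split; apply Rgt_not_eq.
      + apply INR_fact_pos.
      + apply lt_0_INR. lia.
    - apply deriv_scal, cderiv_pow. }
  induction n as [|n IH].
  - apply (deriv_ext _ (texp 1) _ _ (RtoC 0 + RtoC (/ INR (fact 0)) * z ^ 0)%C).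
    + reflexivity.
    + simpl. rewrite Rinv_1. ring.
    + apply deriv_plus; [apply (deriv_const _ (RtoC 1)) | apply Hterm].
  - apply (deriv_plus _ (texp (S n)) (fun y => RtoC (/ INR (fact (S (S n)))) * y ^ S (S n))%C);
      [exact IH | apply Hterm].
Qed.

Lemma texp_0 (n : nat) : texp n (RtoC 0) = RtoC 1.
Proof.
  induction n as [|n IH]; [reflexivity|].
  cbn [texp]. rewrite IH, Cpow_S. ring.
Qed.

Lemma Re_le_Cmod (z : C) : Re z <= Cmod z.
Proof. eapply Rle_trans; [apply Rle_abs | apply re_le_Cmod]. Qed.

(** d/dt (exp (-t z) T_n (t z)) = - z exp (-t z) (t z)^n / n! for the Taylor
    polynomial T_n. *)
Lemma texp_remainder (n : nat) (z : C) :
  Cmod (texp (S n) z - Cexp z)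
  <= exp (2 * Cmod z) * (Cmod z * (Cmod z ^ S n / INR (fact (S n)))).
Proof.
  assert (Hz := Cmod_ge_0 z).
  pose (phi := fun t => (Cexp (RtoC t * - z) * texp (S n) (RtoC t * z))%C).
  pose (dphi := fun t => (- z * Cexp (RtoC t * - z)
    * (RtoC (/ INR (fact (S n))) * (RtoC t * z) ^ S n))%C).
  assert (Hd : forall t, rderiv phi t (dphi t)).
  { intros t. unfold phi.
    apply (deriv_ext _ (fun t => Cexp (RtoC t * - z) * texp (S n) (RtoC t * z))%C _ _
      (- z * Cexp (RtoC t * - z) * texp (S n) (RtoC t * z)
       + Cexp (RtoC t * - z) * (texp n (RtoC t * z) * (z * RtoC 1)))%C); [reflexivity| |].
    - unfold dphi. cbn [texp]. ring.
    - apply (deriv_mult RtoC (fun t => Cexp (RtoC t * - z)) (fun t => texp (S n) (RtoC t * z)))%C.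
      + apply rderiv_Cexp_ray.
      + apply (deriv_comp RtoC (texp (S n)) (fun t => RtoC t * z)%C); [apply cderiv_texp|].
        apply (deriv_ext _ (fun t => z * RtoC t)%C _ _ (z * RtoC 1)%C);
          [intros; ring | reflexivity | apply deriv_scal, deriv_id]. }
  assert (Hc : forall t, continuous dphi t).
  { intros t. assert (Hr : forall c, continuous (fun t => RtoC t * c)%C t).
    { intros c. apply continuous_Cmult; [|apply continuous_const].
      apply continuous_RtoC, continuous_id. }
    apply continuous_Cmult.
    - apply continuous_Cmult; [apply continuous_const|]. apply continuous_Cexp, Hr.
    - apply continuous_Cmult; [apply continuous_const|]. apply continuous_Cpow, Hr. }
  assert (H1 : Cmod (phi 1 - phi 0)
            <= exp (Cmod z) * (Cmod z * (Cmod z ^ S n / INR (fact (S n))))).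
  { assert (Hint := is_RInt_const (V := R_NormedModule) 0 1
      (exp (Cmod z) * (Cmod z * (Cmod z ^ S n / INR (fact (S n)))))).
    change (scal ?x ?y) with (x * y) in Hint.
    rewrite Rminus_0_r, Rmult_1_l in Hint.
    refine (Cmod_CInt_le dphi 0 1 _ _ _ Rle_0_1 _ (CInt_derive phi dphi 0 1 Rle_0_1
      (fun t _ => Hd t) (fun t _ => Hc t)) Hint).
    intros t Ht. unfold dphi.
    rewrite !Cmod_mult, Cmod_opp, Cmod_Cexp, Cmod_pow, Cmod_mult, !Cmod_R.
    rewrite (Rabs_pos_eq t), (Rabs_pos_eq (/ _)) by
      (try (left; apply Rinv_0_lt_compat, INR_fact_pos); lra).
    assert (E1 : exp (Re (RtoC t * - z)) <= exp (Cmod z)).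
    { destruct (Rle_lt_or_eq_dec (Re (RtoC t * - z)) (Cmod z)) as [H|H].
      - eapply Rle_trans; [apply Re_le_Cmod|].
        rewrite Cmod_mult, Cmod_opp, Cmod_R, Rabs_pos_eq by lra. nra.
      - left. now apply exp_increasing.
      - right. now rewrite H. }
    assert (E2 : (t * Cmod z) ^ S n <= Cmod z ^ S n) by (apply pow_incr; nra).
    assert (Hf := Rinv_0_lt_compat _ (INR_fact_pos (S n))).
    replace (Cmod z * exp (Re (RtoC t * - z)%C) * (/ INR (fact (S n)) * (t * Cmod z) ^ S n))
      with (exp (Re (RtoC t * - z)%C) * (Cmod z * (/ INR (fact (S n)) * (t * Cmod z) ^ S n)))
      by ring.
    assert (E3 : 0 <= (t * Cmod z) ^ S n) by (apply pow_le; nra).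
    apply Rmult_le_compat; [left; apply exp_pos | | exact E1|].
    - apply Rmult_le_pos; [exact Hz|]. apply Rmult_le_pos; lra.
    - apply Rmult_le_compat_l; [exact Hz|]. unfold Rdiv. rewrite (Rmult_comm (Cmod z ^ S n)).
      apply Rmult_le_compat_l; lra. }
  replace (texp (S n) z - Cexp z)%C with (Cexp z * (phi 1 - phi 0))%C.
  - rewrite Cmod_mult, Cmod_Cexp. replace (2 * Cmod z) with (Cmod z + Cmod z) by ring.
    rewrite exp_plus, Rmult_assoc.
    apply Rmult_le_compat; [left; apply exp_pos | apply Cmod_ge_0 | | exact H1].
    destruct (Re_le_Cmod z) as [H|H]; [left; now apply exp_increasing | rewrite H; lra].
  - unfold phi. rewrite !Cmult_1_l, !Cmult_0_l, texp_0, Cexp_0, Cexp_opp. field.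
    apply Cexp_neq_0.
Qed.

Lemma texp_uniform (B e : R) :
  0 <= B -> 0 < e -> exists N, forall n, (N <= n)%nat ->
    forall z, Cmod z <= B -> Cmod (texp (S n) z - Cexp z) <= e.
Proof.
  intros HB He.
  assert (Hk : 0 < exp (2 * B) * (B + 1)) by (apply Rmult_lt_0_compat; [apply exp_pos | lra]).
  destruct (cv_speed_pow_fact B (e / (exp (2 * B) * (B + 1)))) as [N HN].
  { now apply Rdiv_lt_0_compat. }
  exists N. intros n Hn z Hz. assert (Hz0 := Cmod_ge_0 z).
  assert (Hn' : (S n >= N)%nat) by lia.
  specialize (HN (S n) Hn'). unfold Rdist in HN. rewrite Rminus_0_r in HN.
  apply Rabs_def2 in HN. destruct HN as [HN _].
  assert (Hf := INR_fact_pos (S n)).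
  assert (Hpow : 0 <= Cmod z ^ S n / INR (fact (S n)) <= B ^ S n / INR (fact (S n))).
  { unfold Rdiv. assert (Hi := Rinv_0_lt_compat _ Hf). split.
    - apply Rmult_le_pos; [apply pow_le, Hz0 | lra].
    - apply Rmult_le_compat_r; [lra | now apply pow_incr]. }
  eapply Rle_trans; [apply texp_remainder|].
  apply Rle_trans with (exp (2 * B) * (B + 1) * (e / (exp (2 * B) * (B + 1)))).
  - rewrite Rmult_assoc. apply Rmult_le_compat.
    + left; apply exp_pos.
    + apply Rmult_le_pos; lra.
    + destruct (Rle_lt_or_eq_dec (2 * Cmod z) (2 * B)) as [H|H]; [lra| |].
      * left. now apply exp_increasing.
      * rewrite H; lra.
    + apply Rmult_le_compat; lra.
  - right. field. split; [lra | apply Rgt_not_eq, exp_pos].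
Qed.

(** ** Functionals determined by their moments *)

(** Integration of f against the complex measure k om ds carried by the curve g. *)
Definition arc_int (g k om : R -> C) (f : C -> C) : C :=
  CInt (fun s => f (g s) * k s * om s)%C 0 1.

Record arc_ok (g k om : R -> C) : Prop := {
  arc_g : forall s, continuous g s;
  arc_k : forall s, continuous k s;
  arc_om : pw_cont om 0 1;
  arc_neq_0 : forall s, g s <> RtoC 0
}.
Arguments arc_g {g k om}.
Arguments arc_k {g k om}.
Arguments arc_om {g k om}.
Arguments arc_neq_0 {g k om}.

Definition cont_off_0 (f : C -> C) : Prop := forall z, z <> RtoC 0 -> continuous f z.

Lemma arc_continuous (g k om : R -> C) (f : C -> C) (s : R) :
  arc_ok g k om -> cont_off_0 f -> continuous (fun s => f (g s) * k s)%C s.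
Proof.
  intros Ha Hf. apply continuous_Cmult; [|apply (arc_k Ha)].
  apply (continuous_comp g f); [apply (arc_g Ha) | apply Hf, (arc_neq_0 Ha)].
Qed.

Lemma is_arc_int (g k om : R -> C) (f : C -> C) :
  arc_ok g k om -> cont_off_0 f ->
  is_CInt (fun s => f (g s) * k s * om s)%C 0 1 (arc_int g k om f).
Proof.
  intros Ha Hf. apply CInt_correct, pw_cont_ex_CInt; [exact (arc_om Ha)|].
  intros s. now apply arc_continuous with om.
Qed.

Lemma arc_int_plus (g k om : R -> C) (f h : C -> C) :
  arc_ok g k om -> cont_off_0 f -> cont_off_0 h ->
  arc_int g k om (fun z => f z + h z)%C = (arc_int g k om f + arc_int g k om h)%C.
Proof.
  intros Ha Hf Hh. apply is_CInt_unique.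
  apply (is_CInt_ext (fun s => f (g s) * k s * om s + h (g s) * k s * om s)%C);
    [lra | intros; ring|].
  apply is_CInt_plus; now apply is_arc_int.
Qed.

Lemma arc_int_scal (g k om : R -> C) (c : C) (f : C -> C) :
  arc_ok g k om -> cont_off_0 f ->
  arc_int g k om (fun z => c * f z)%C = (c * arc_int g k om f)%C.
Proof.
  intros Ha Hf. apply is_CInt_unique.
  apply (is_CInt_ext (fun s => c * (f (g s) * k s * om s))%C); [lra | intros; ring|].
  apply is_CInt_Cmult. now apply is_arc_int.
Qed.

Lemma arc_int_ext (g k om : R -> C) (f h : C -> C) :
  arc_ok g k om -> (forall z, z <> RtoC 0 -> f z = h z) ->
  arc_int g k om f = arc_int g k om h.
Proof.
  intros Ha Hf. apply CInt_ext; [lra|]. intros s _. now rewrite Hf by apply (arc_neq_0 Ha).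
Qed.

Lemma cont_off_0_CpowZ (n : Z) : cont_off_0 (fun z => CpowZ z n).
Proof. intros z Hz. apply (continuous_CpowZ (fun z => z)); [apply continuous_id | exact Hz]. Qed.

Lemma arc_int_limit (g k om : R -> C) (f : C -> C) (fn : nat -> C -> C) :
  arc_ok g k om -> cont_off_0 f -> (forall n, cont_off_0 (fn n)) ->
  (forall e, 0 < e -> exists N, forall n, (N <= n)%nat ->
     forall s, 0 <= s <= 1 -> Cmod (fn n (g s) - f (g s)) <= e) ->
  forall e, 0 < e -> exists N, forall n, (N <= n)%nat ->
     Cmod (arc_int g k om (fn n) - arc_int g k om f) <= e.
Proof.
  intros Ha Hf Hfn Hu e He.
  destruct (pw_cont_mass _ _ _ (arc_om Ha)) as [V [HV HVm]].
  destruct (continuous_bounded k 0 1 Rle_0_1 (arc_k Ha)) as [B [HB HBk]].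
  assert (HVB : 0 < V * B + 1) by nra.
  assert (He' : 0 < e / (V * B + 1)) by (apply Rdiv_lt_0_compat; lra).
  destruct (Hu _ He') as [N HN]. exists N. intros n Hn.
  unfold arc_int.
  rewrite (CInt_weight_minus om (fun s => fn n (g s) * k s)%C (fun s => f (g s) * k s)%C).
  - apply Rle_trans with (V * (e / (V * B + 1) * B)).
    + apply HVm.
      * intros s. apply continuous_Cminus; now apply arc_continuous with om.
      * intros s Hs. replace (fn n (g s) * k s - f (g s) * k s)%C
          with ((fn n (g s) - f (g s)) * k s)%C by ring.
        rewrite Cmod_mult. apply Rmult_le_compat; try apply Cmod_ge_0; [now apply HN | now apply HBk].
    + apply Rle_trans with ((V * B + 1) * (e / (V * B + 1))); [nra|]. right. field. lra.
  - exact (arc_om Ha).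
  - intros s. now apply arc_continuous with om.
  - intros s. now apply arc_continuous with om.
Qed.

(** Laurent polynomials supported in degrees -2, ..., 2: the exponents of all
    weights below. *)
Definition laurent (c0 a1 a2 b1 b2 : C) (z : C) : C :=
  (c0 * CpowZ z 0 + a1 * CpowZ z 1 + a2 * CpowZ z 2
   + b1 * CpowZ z (-1) + b2 * CpowZ z (-2))%C.

Lemma cont_off_0_laurent (c0 a1 a2 b1 b2 : C) : cont_off_0 (laurent c0 a1 a2 b1 b2).
Proof.
  intros z Hz. unfold laurent.
  assert (H : forall c n, continuous (fun z => c * CpowZ z n)%C z).
  { intros c n. apply continuous_Cmult; [apply continuous_const | now apply cont_off_0_CpowZ]. }
  do 4 (apply continuous_Cplus; [|apply H]). apply H.
Qed.

(** Two such functionals with the same moments of all integer orders agree on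
    w^n exp(q(w)) for every Laurent polynomial q, because the Taylor polynomials
    of exp(q) converge uniformly on the two curves. *)
Lemma arc_int_agree (g1 k1 om1 g2 k2 om2 : R -> C) (c0 a1 a2 b1 b2 : C) (n : Z) :
  arc_ok g1 k1 om1 -> arc_ok g2 k2 om2 ->
  (forall m, arc_int g1 k1 om1 (fun z => CpowZ z m) = arc_int g2 k2 om2 (fun z => CpowZ z m)) ->
  arc_int g1 k1 om1 (fun z => CpowZ z n * Cexp (laurent c0 a1 a2 b1 b2 z))%C
  = arc_int g2 k2 om2 (fun z => CpowZ z n * Cexp (laurent c0 a1 a2 b1 b2 z))%C.
Proof.
  intros H1 H2 Hm. set (q := laurent c0 a1 a2 b1 b2).
  pose (good := fun Q : C -> C => cont_off_0 Q /\ forall m,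
    arc_int g1 k1 om1 (fun z => CpowZ z m * Q z)%C = arc_int g2 k2 om2 (fun z => CpowZ z m * Q z)%C).
  assert (Hmul : forall Q m, cont_off_0 Q -> cont_off_0 (fun z => CpowZ z m * Q z)%C).
  { intros Q m HQ z Hz. apply continuous_Cmult; [now apply cont_off_0_CpowZ | now apply HQ]. }
  assert (Gone : good (fun _ => RtoC 1)).
  { split; [intros z _; apply continuous_const|]. intros m.
    rewrite !(arc_int_ext _ _ _ (fun z => CpowZ z m * RtoC 1)%C (fun z => CpowZ z m))
      by (try assumption; intros; ring). apply Hm. }
  assert (Gscal : forall c Q, good Q -> good (fun z => c * Q z)%C).
  { intros c Q [HQ1 HQ2]. split.
    - intros z Hz. apply continuous_Cmult; [apply continuous_const | now apply HQ1].
    - intros m.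
      rewrite !(arc_int_ext _ _ _ (fun z => CpowZ z m * (c * Q z))%C (fun z => c * (CpowZ z m * Q z))%C)
        by (try assumption; intros; ring).
      rewrite !arc_int_scal by auto. now rewrite HQ2. }
  assert (Gplus : forall Q Q', good Q -> good Q' -> good (fun z => Q z + Q' z)%C).
  { intros Q Q' [HQ1 HQ2] [HQ1' HQ2']. split.
    - intros z Hz. apply continuous_Cplus; [now apply HQ1 | now apply HQ1'].
    - intros m.
      rewrite !(arc_int_ext _ _ _ (fun z => CpowZ z m * (Q z + Q' z))%C
        (fun z => CpowZ z m * Q z + CpowZ z m * Q' z)%C) by (try assumption; intros; ring).
      rewrite !arc_int_plus by auto. now rewrite HQ2, HQ2'. }
  assert (Gpow : forall j Q, good Q -> good (fun z => CpowZ z j * Q z)%C).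
  { intros j Q [HQ1 HQ2]. split; [now apply Hmul|]. intros m.
    rewrite !(arc_int_ext _ _ _ (fun z => CpowZ z m * (CpowZ z j * Q z))%C
      (fun z => CpowZ z (m + j) * Q z)%C); try assumption; [apply HQ2| |];
    intros z Hz; rewrite CpowZ_add by exact Hz; ring. }
  assert (Gext : forall Q Q', (forall z, Q z = Q' z) -> good Q -> good Q').
  { intros Q Q' E HQ. replace Q' with Q; [exact HQ|]. apply functional_extensionality, E. }
  assert (Gq : forall Q, good Q -> good (fun z => q z * Q z)%C).
  { intros Q HQ.
    apply (Gext (fun z => c0 * (CpowZ z 0 * Q z) + a1 * (CpowZ z 1 * Q z) + a2 * (CpowZ z 2 * Q z)
      + b1 * (CpowZ z (-1) * Q z) + b2 * (CpowZ z (-2) * Q z))%C).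
    - intros z. unfold q, laurent. ring.
    - assert (H : forall c j, good (fun z => c * (CpowZ z j * Q z))%C).
      { intros c j. apply Gscal, Gpow, HQ. }
      exact (Gplus _ _ (Gplus _ _ (Gplus _ _ (Gplus _ _ (H _ _) (H _ _)) (H _ _)) (H _ _)) (H _ _)). }
  assert (Gqn : forall j, good (fun z => q z ^ j)%C).
  { induction j as [|j IH]; [exact Gone|].
    apply (Gext (fun z => q z * q z ^ j)%C); [reflexivity | now apply Gq]. }
  assert (Gt : forall N, good (fun z => texp N (q z))).
  { induction N as [|N IH]; [exact Gone|].
    apply (Gplus (fun z => texp N (q z)) (fun z => RtoC (/ INR (fact (S N))) * q z ^ S N)%C);
      [exact IH | apply Gscal, Gqn]. }
  assert (Hqe : cont_off_0 (fun z => CpowZ z n * Cexp (q z))%C).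
  { apply Hmul. intros z Hz. apply continuous_Cexp. now apply cont_off_0_laurent. }
  assert (Hlim : forall g k om, arc_ok g k om -> forall e, 0 < e -> exists N, forall j, (N <= j)%nat ->
    Cmod (arc_int g k om (fun z => CpowZ z n * texp (S j) (q z))%C
          - arc_int g k om (fun z => CpowZ z n * Cexp (q z))%C) <= e).
  { intros g k om Ha.
    apply (arc_int_limit g k om _ (fun j z => CpowZ z n * texp (S j) (q z))%C Ha Hqe).
    - intros j. apply Hmul, Gt.
    - intros e He.
      destruct (continuous_bounded (fun s => q (g s)) 0 1 Rle_0_1) as [B [HB HBq]].
      { intros s. apply (continuous_comp g q); [apply (arc_g Ha)|].
        apply cont_off_0_laurent, (arc_neq_0 Ha). }
      destruct (continuous_bounded (fun s => CpowZ (g s) n) 0 1 Rle_0_1) as [D [HD HDp]].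
      { intros s. apply continuous_CpowZ; [apply (arc_g Ha) | apply (arc_neq_0 Ha)]. }
      assert (He' : 0 < e / (D + 1)) by (apply Rdiv_lt_0_compat; lra).
      destruct (texp_uniform B _ HB He') as [N HN]. exists N. intros j Hj s Hs.
      replace (CpowZ (g s) n * texp (S j) (q (g s)) - CpowZ (g s) n * Cexp (q (g s)))%C
        with (CpowZ (g s) n * (texp (S j) (q (g s)) - Cexp (q (g s))))%C by ring.
      rewrite Cmod_mult. apply Rle_trans with ((D + 1) * (e / (D + 1))).
      + apply Rmult_le_compat; try apply Cmod_ge_0.
        * eapply Rle_trans; [now apply HDp | lra].
        * apply HN; [exact Hj | now apply HBq].
      + right. field. lra. }
  apply C_eq_of_close. intros e He. assert (He2 : 0 < e / 2) by lra.
  destruct (Hlim _ _ _ H1 _ He2) as [N1 K1]. destruct (Hlim _ _ _ H2 _ He2) as [N2 K2].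
  specialize (K1 _ (Nat.le_max_l N1 N2)). specialize (K2 _ (Nat.le_max_r N1 N2)).
  destruct (Gt (S (Nat.max N1 N2))) as [_ Gm]. rewrite Gm in K1.
  match type of K1 with Cmod (?x - ?y) <= _ => match type of K2 with Cmod (_ - ?w) <= _ =>
    replace (y - w)%C with (- (x - y) + (x - w))%C by ring end end.
  eapply Rle_trans; [apply Cmod_triangle|]. rewrite Cmod_opp. lra.
Qed.

(** ** Moments of loops *)

Lemma cderiv_CpowZ (z : C) (n : Z) :
  z <> RtoC 0 -> cderiv (fun y => CpowZ y n) z (RtoC (IZR n) * CpowZ z (n - 1))%C.
Proof.
  intros Hz. assert (Hnear : forall y, Cmod (y - z) < Cmod z -> y <> RtoC 0).
  { intros y Hy ->. replace (RtoC 0 - z)%C with (- z)%C in Hy by ring.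
    rewrite Cmod_opp in Hy. lra. }
  revert n. apply Z_step_ind.
  - apply (deriv_ext _ (fun _ => RtoC 1) _ _ (RtoC 0)); [reflexivity | simpl; ring|].
    apply deriv_const.
  - intros n IH. apply (deriv_ext_near (fun y => y * CpowZ y n)%C _ _ _ z Hz).
    { intros y Hy. rewrite CpowZ_succ; [reflexivity | now apply Hnear]. }
    apply (deriv_ext _ (fun y => y * CpowZ y n)%C _ _
      (RtoC 1 * CpowZ z n + z * (RtoC (IZR n) * CpowZ z (n - 1)))%C); [reflexivity| |].
    + replace (n + 1 - 1)%Z with n by lia.
      rewrite CpowZ_pred by exact Hz. rewrite plus_IZR, RtoC_plus. field. exact Hz.
    + apply (deriv_mult _ (fun y => y) (fun y => CpowZ y n)); [|exact IH].
      apply (deriv_id (fun z : C => z)).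
  - intros n IH. apply (deriv_ext_near (fun y => / y * CpowZ y n)%C _ _ _ z Hz).
    { intros y Hy. rewrite CpowZ_pred; [reflexivity | now apply Hnear]. }
    apply (deriv_ext _ (fun y => / y * CpowZ y n)%C _ _
      (- / (z * z) * CpowZ z n + / z * (RtoC (IZR n) * CpowZ z (n - 1)))%C); [reflexivity| |].
    + rewrite !CpowZ_pred by exact Hz. rewrite minus_IZR, RtoC_minus. field. exact Hz.
    + apply (deriv_mult _ Cinv (fun y => CpowZ y n)); [|exact IH]. now apply cderiv_inv.
Qed.

Notation closed_path g := (fun s => g (clamp 0 1 s)).

Lemma loop_int_CInt (G : R -> C) (f : C -> C) :
  loop_int G f = CInt (fun s => f (G s) * velocity G s)%C 0 1.
Proof. reflexivity. Qed.

Lemma loop_int_clamp (G : R -> C) (f : C -> C) :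
  loop_int G f = CInt (fun s => f (closed_path G s) * velocity G s)%C 0 1.
Proof.
  rewrite loop_int_CInt. apply CInt_ext; [lra|]. intros s Hs. now rewrite clamp_id by lra.
Qed.

Lemma loop_arc_int (G k : R -> C) (f h : C -> C) :
  (forall s, 0 <= s <= 1 -> h (G s) = f (G s) * k s)%C ->
  loop_int G h = arc_int (closed_path G) k (velocity G) f.
Proof.
  intros H. rewrite loop_int_CInt. apply CInt_ext; [lra|]. intros s Hs. rewrite clamp_id by lra.
  now rewrite H by lra.
Qed.

Lemma loop_arc_ok (G k : R -> C) :
  encircles_origin G -> (forall s, continuous k s) ->
  arc_ok (closed_path G) k (velocity G).
Proof.
  intros HG Hk. split.
  - intros s. now apply continuous_path_clamp, HG.
  - exact Hk.
  - now apply pw_cont_velocity, HG.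
  - intros s. apply HG, clamp_in. lra.
Qed.

Lemma two_pi_i_neq_0 : two_pi_i <> RtoC 0.
Proof.
  apply Cmult_neq_0; [|apply Ci_nz]. apply RtoC_neq_0.
  assert (H := PI_RGT_0). lra.
Qed.

Lemma winding_loop_int (G : R -> C) (u : C) :
  loop_int G (fun w => / (w - u))%C = (winding G u * two_pi_i)%C.
Proof. unfold winding. field. apply two_pi_i_neq_0. Qed.

Lemma loop_int_ext (G : R -> C) (f h : C -> C) :
  (forall s, 0 <= s <= 1 -> f (G s) = h (G s)) -> loop_int G f = loop_int G h.
Proof. intros H. rewrite !loop_int_CInt. apply CInt_ext; [lra|]. intros s Hs. now rewrite H by lra. Qed.

Definition moment (n : Z) : C := if Z.eq_dec n (-1) then two_pi_i else RtoC 0.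

Lemma loop_moment (G : R -> C) (n : Z) :
  encircles_origin G -> loop_int G (fun w => CpowZ w n) = moment n.
Proof.
  intros HG. unfold moment. destruct (Z.eq_dec n (-1)) as [->|Hn].
  - rewrite (loop_int_ext _ _ (fun w => / (w - RtoC 0))%C).
    + rewrite winding_loop_int, (loop_winding_origin _ HG). ring.
    + intros s Hs. simpl. f_equal. ring.
  - rewrite loop_int_CInt. assert (Hn1 : RtoC (IZR (n + 1)) <> RtoC 0).
    { apply RtoC_neq_0, not_0_IZR. lia. }
    rewrite (is_CInt_unique (fun t => CpowZ (G t) n * velocity G t)%C 0 1 
      (/ RtoC (IZR (n + 1)) * CpowZ (G 1) (n + 1) - / RtoC (IZR (n + 1)) * CpowZ (G 0) (n + 1)))%C.
    + rewrite (loop_closed _ HG). ring.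
    + apply (path_ftc G (fun w => / RtoC (IZR (n + 1)) * CpowZ w (n + 1))%C
        (fun w => CpowZ w n)); [apply HG|].
      intros t Ht. assert (H0 := loop_avoids_origin _ HG t Ht). split.
      * apply (deriv_ext _ (fun w => / RtoC (IZR (n + 1)) * CpowZ w (n + 1))%C _ _
          (/ RtoC (IZR (n + 1)) * (RtoC (IZR (n + 1)) * CpowZ (G t) (n + 1 - 1)))%C);
          [reflexivity | | now apply deriv_scal, cderiv_CpowZ].
        replace (n + 1 - 1)%Z with n by lia. field. exact Hn1.
      * now apply cont_off_0_CpowZ.
Qed.

Lemma is_loop_int (G : R -> C) (f : C -> C) :
  encircles_origin G -> (forall s, 0 <= s <= 1 -> continuous f (G s)) ->
  is_CInt (fun s => f (G s) * velocity G s)%C 0 1 (loop_int G f).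
Proof.
  intros HG Hf. apply (is_CInt_ext (fun s => f (closed_path G s) * velocity G s)%C); [lra| |].
  { intros s Hs. now rewrite clamp_id by lra. }
  rewrite loop_int_clamp. apply CInt_correct, pw_cont_ex_CInt.
  - now apply pw_cont_velocity, HG.
  - intros s. apply (continuous_comp (closed_path G) f).
    + now apply continuous_path_clamp, HG.
    + apply Hf, clamp_in. lra.
Qed.

Lemma loop_int_comb (G : R -> C) (c : C) (f h : C -> C) :
  encircles_origin G -> (forall s, 0 <= s <= 1 -> continuous f (G s)) ->
  (forall s, 0 <= s <= 1 -> continuous h (G s)) ->
  loop_int G (fun w => c * f w + h w)%C = (c * loop_int G f + loop_int G h)%C.
Proof.
  intros HG Hf Hh. rewrite ?loop_int_CInt. apply is_CInt_unique.
  apply (is_CInt_ext (fun s => c * (f (G s) * velocity G s) + h (G s) * velocity G s)%C);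
    [lra | intros; ring|].
  apply is_CInt_plus; [apply is_CInt_Cmult|]; now apply is_loop_int.
Qed.

(** Since w^(n+1) = u w^n + (w - u) w^n. The recurrence determines the integrals of
    w^n / (w - u) for all n from the one with n = 0, the winding number of u. *)
Lemma cauchy_moment_succ (G : R -> C) (u : C) (n : Z) :
  encircles_origin G -> (forall s, 0 <= s <= 1 -> G s <> u) ->
  loop_int G (fun w => CpowZ w (n + 1) / (w - u))%C
  = (u * loop_int G (fun w => CpowZ w n / (w - u)) + moment n)%C.
Proof.
  intros HG Hu. rewrite <- (loop_moment G n HG), <- loop_int_comb; [|exact HG| |].
  - apply loop_int_ext. intros s Hs.
    rewrite CpowZ_succ by now apply (loop_avoids_origin _ HG).
    field. now apply Cminus_eq_contra, Hu.
  - intros s Hs. apply continuous_Cdiv.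
    + now apply cont_off_0_CpowZ, (loop_avoids_origin _ HG).
    + apply continuous_Cminus; [apply continuous_id | apply continuous_const].
    + now apply Cminus_eq_contra, Hu.
  - intros s Hs. now apply cont_off_0_CpowZ, (loop_avoids_origin _ HG).
Qed.

Lemma cauchy_moment_0 (G : R -> C) (u : C) :
  loop_int G (fun w => CpowZ w 0 / (w - u))%C = (winding G u * two_pi_i)%C.
Proof.
  rewrite <- winding_loop_int. apply loop_int_ext. intros s _. unfold Cdiv. simpl. ring.
Qed.

Lemma cauchy_moment_agree (G1 G2 : R -> C) (u : C) (n : Z) :
  encircles_origin G1 -> encircles_origin G2 -> u <> RtoC 0 ->
  (forall s, 0 <= s <= 1 -> G1 s <> u) -> (forall s, 0 <= s <= 1 -> G2 s <> u) ->
  winding G1 u = winding G2 u ->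
  loop_int G1 (fun w => CpowZ w n / (w - u))%C = loop_int G2 (fun w => CpowZ w n / (w - u))%C.
Proof.
  intros H1 H2 Hu D1 D2 Hw. revert n. apply Z_step_ind.
  - now rewrite !cauchy_moment_0, Hw.
  - intros n IH. rewrite !cauchy_moment_succ by assumption. now rewrite IH.
  - intros n IH. replace n with (n - 1 + 1)%Z in IH by lia.
    rewrite !cauchy_moment_succ in IH by assumption.
    set (x := loop_int G1 _) in *. set (y := loop_int G2 _) in *.
    transitivity (/ u * ((u * x + moment (n - 1)) - moment (n - 1)))%C; [now field|].
    rewrite IH. now field.
Qed.

Lemma CpowZ_inv_jacobian (v : C) (m : Z) :
  v <> RtoC 0 -> CpowZ v (- m - 2) = (CpowZ (/ v) m * / (v * v))%C.
Proof.
  intros Hv. rewrite CpowZ_inv by exact Hv. replace (- m - 2)%Z with (- m - 1 - 1)%Z by lia.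
  rewrite !CpowZ_pred by exact Hv. field. exact Hv.
Qed.

Section TwoLoops.
Context (c0 a1 a2 b1 b2 : C).
Let q := laurent c0 a1 a2 b1 b2.

(** The comparison of two arc functionals, for loops, with a substitution h
    (below the identity or the inversion) on the second one. *)
Lemma loop_exp_agree (G1 G2 : R -> C) (h k1 k2 : C -> C) (n : Z) :
  encircles_origin G1 -> encircles_origin G2 ->
  cont_off_0 h -> (forall v, v <> RtoC 0 -> h v <> RtoC 0) ->
  (forall s, 0 <= s <= 1 -> continuous k1 (G1 s)) ->
  (forall s, 0 <= s <= 1 -> continuous k2 (G2 s)) ->
  (forall m, loop_int G1 (fun w => CpowZ w m * k1 w)%C
             = loop_int G2 (fun v => CpowZ (h v) m * k2 v)%C) ->
  loop_int G1 (fun w => CpowZ w n * Cexp (q w) * k1 w)%C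
  = loop_int G2 (fun v => CpowZ (h v) n * Cexp (q (h v)) * k2 v)%C.
Proof.
  intros H1 H2 Hh Hh0 Hk1 Hk2 Hm.
  assert (Hc : forall (G : R -> C) (k : C -> C), encircles_origin G -> (forall s, 0 <= s <= 1 -> continuous k (G s)) ->
    forall s, continuous (fun s => k (closed_path G s)) s).
  { intros G k HG Hk s. apply (continuous_comp (closed_path G) k).
    - now apply continuous_path_clamp, HG.
    - apply Hk, clamp_in. lra. }
  assert (H0 : forall s, closed_path G2 s <> RtoC 0) by (intros s; apply H2, clamp_in; lra).
  assert (Hm' : forall m, arc_int (closed_path G1) (fun s => k1 (closed_path G1 s)) (velocity G1)
      (fun z => CpowZ z m)
    = arc_int (fun s => h (closed_path G2 s)) (fun s => k2 (closed_path G2 s)) (velocity G2)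
      (fun z => CpowZ z m)).
  { intros m. generalize (Hm m). now rewrite !loop_int_clamp. }
  rewrite !loop_int_clamp.
  apply (arc_int_agree _ _ _ _ _ _ c0 a1 a2 b1 b2 n
    (loop_arc_ok G1 _ H1 (Hc G1 k1 H1 Hk1))); [|exact Hm'].
  split.
  - apply (Hc G2 h H2). intros s Hs. now apply Hh, (loop_avoids_origin _ H2).
  - now apply Hc.
  - now apply pw_cont_velocity, H2.
  - intros s. now apply Hh0.
Qed.

Lemma continuous_pole (u w : C) : w <> u -> continuous (fun w => / (w - u))%C w.
Proof.
  intros Hw. apply continuous_Cinv; [|now apply Cminus_eq_contra].
  apply continuous_Cminus; [apply continuous_id | apply continuous_const].
Qed.

Lemma cont_off_0_id : cont_off_0 (fun z => z).
Proof. intros z _. apply continuous_id. Qed.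

Lemma cont_off_0_inv : cont_off_0 Cinv.
Proof. intros z Hz. apply (continuous_Cinv (fun z => z)); [apply continuous_id | exact Hz]. Qed.

Lemma continuous_inv_sqr (v : C) : v <> RtoC 0 -> continuous (fun v => / (v * v))%C v.
Proof.
  intros Hv. apply continuous_Cinv; [|now apply Cmult_neq_0].
  apply continuous_Cmult; apply continuous_id.
Qed.

(** The origin and the pole u being the only singularities, a loop may be replaced
    by any other one with the same winding numbers around them. *)
Lemma loop_cauchy_agree (G1 G2 : R -> C) (u : C) (n : Z) :
  encircles_origin G1 -> encircles_origin G2 -> u <> RtoC 0 ->
  (forall s, 0 <= s <= 1 -> G1 s <> u) -> (forall s, 0 <= s <= 1 -> G2 s <> u) ->
  winding G1 u = winding G2 u ->
  loop_int G1 (fun w => CpowZ w n * Cexp (q w) / (w - u))%C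
  = loop_int G2 (fun w => CpowZ w n * Cexp (q w) / (w - u))%C.
Proof.
  intros H1 H2 Hu D1 D2 Hw.
  apply (loop_exp_agree G1 G2 (fun z => z) (fun w => / (w - u))%C (fun w => / (w - u))%C n H1 H2
    cont_off_0_id).
  - auto.
  - intros s Hs. now apply continuous_pole, D1.
  - intros s Hs. now apply continuous_pole, D2.
  - intros m. now apply cauchy_moment_agree.
Qed.

(** The substitution w = 1/v turns the pole 1/u inside the first loop into the
    pole u outside the second one. *)
Lemma loop_cauchy_agree_inv (G1 G2 : R -> C) (u : C) (n : Z) :
  encircles_origin G1 -> encircles_origin G2 -> u <> RtoC 0 ->
  (forall s, 0 <= s <= 1 -> G1 s <> / u)%C -> (forall s, 0 <= s <= 1 -> G2 s <> u) ->
  winding G1 (/ u) = RtoC 1 -> winding G2 u = RtoC 0 ->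
  loop_int G1 (fun w => CpowZ w n * Cexp (q w) / (/ w - u))%C
  = loop_int G2 (fun v => CpowZ v (- n - 2) * Cexp (q (/ v)) / (v - u))%C.
Proof.
  intros H1 H2 Hu D1 D2 W1 W2.
  assert (D1' : forall w, w <> RtoC 0 -> w <> (/ u)%C -> (/ w - u)%C <> RtoC 0).
  { intros w Hw Hwu E. apply Hwu. assert (E' : (/ w)%C = u) by now apply Ceq_minus.
    rewrite <- E'. now field. }
  assert (Epow := fun s m Hs => CpowZ_inv_jacobian (G2 s) m (loop_avoids_origin _ H2 s Hs)).
  transitivity (loop_int G2 (fun v => CpowZ (/ v) n * Cexp (q (/ v))
                               * (/ (v * v) * / (v - u)))%C).
  2:{ apply loop_int_ext. intros s Hs. rewrite Epow by exact Hs. unfold Cdiv. ring. }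
  apply (loop_exp_agree G1 G2 Cinv (fun w => / (/ w - u))%C
    (fun v => / (v * v) * / (v - u))%C n H1 H2 cont_off_0_inv Cinv_neq_0).
  - intros s Hs. assert (H0 := loop_avoids_origin _ H1 s Hs).
    apply continuous_Cinv; [|now apply D1', D1].
    apply continuous_Cminus; [now apply cont_off_0_inv | apply continuous_const].
  - intros s Hs. assert (H0 := loop_avoids_origin _ H2 s Hs).
    apply continuous_Cmult; [now apply continuous_inv_sqr | now apply continuous_pole, D2].
  - (* Both families of moments satisfy X(m-1) = u X(m) + moment m, with the same
       value at m = -1. *)
    assert (J1 : forall m, loop_int G1 (fun w => CpowZ w m * / (/ w - u))%C
      = (- / u * loop_int G1 (fun w => CpowZ w (m + 1) / (w - / u)))%C).
    { intros m. rewrite (loop_int_CInt G1 (fun w => CpowZ w m * / (/ w - u))%C).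
      apply is_CInt_unique.
      apply (is_CInt_ext (fun s => - / u * (CpowZ (G1 s) (m + 1) / (G1 s - / u) * velocity G1 s))%C); [lra| |].
      - intros s Hs. assert (Hs' : 0 <= s <= 1) by lra.
        assert (H0 := loop_avoids_origin _ H1 s Hs').
        rewrite CpowZ_succ by exact H0.
        assert (K1 := D1' _ H0 (D1 s Hs')).
        assert (K2 := Cminus_eq_contra _ _ (D1 s Hs')).
        assert (K3 : (RtoC 1 - u * G1 s)%C <> RtoC 0).
        { intros E. apply K1. transitivity (/ G1 s * (RtoC 1 - u * G1 s))%C; [now field|].
          rewrite E. ring. }
        assert (K4 : (G1 s * u - RtoC 1)%C <> RtoC 0).
        { intros E. apply K3. transitivity (- (G1 s * u - RtoC 1))%C; [ring|]. rewrite E. ring. }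
        field. tauto.
      - apply is_CInt_Cmult. apply (is_loop_int G1 (fun w => CpowZ w (m + 1) / (w - / u))%C); [exact H1|].
        intros s Hs. apply continuous_Cmult; [|now apply continuous_pole, D1].
        now apply cont_off_0_CpowZ, (loop_avoids_origin _ H1). }
    assert (J2 : forall m, loop_int G2 (fun v => CpowZ (/ v) m * (/ (v * v) * / (v - u)))%C
      = loop_int G2 (fun v => CpowZ v (- m - 2) / (v - u))%C).
    { intros m. apply loop_int_ext. intros s Hs. rewrite Epow by exact Hs. unfold Cdiv. ring. }
    assert (Hmom : forall m, moment (- m - 2) = moment m).
    { intros m. unfold moment. destruct (Z.eq_dec (- m - 2) (-1)), (Z.eq_dec m (-1));
      try lia; reflexivity. }
    intros m. rewrite J1, J2. replace m with (m + 1 - 1)%Z by lia. generalize (m + 1)%Z.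
    clear m. apply Z_step_ind.
    + replace (0 - 1 + 1)%Z with 0%Z by lia. replace (- (0 - 1) - 2)%Z with (-1)%Z by lia.
      rewrite cauchy_moment_0, W1.
      assert (E := cauchy_moment_succ G2 u (-1) H2 D2).
      replace (-1 + 1)%Z with 0%Z in E by lia. rewrite cauchy_moment_0, W2 in E.
      unfold moment in E. destruct (Z.eq_dec (-1) (-1)) as [_|]; [|lia].
      set (x := loop_int G2 _) in *.
      transitivity (/ u * (- (u * x + two_pi_i) + u * x))%C; [|rewrite <- E; field; exact Hu].
      field. exact Hu.
    + intros m IH. replace (m + 1 - 1 + 1)%Z with (m - 1 + 1 + 1)%Z by lia.
      rewrite cauchy_moment_succ by assumption.
      replace (- (m - 1) - 2)%Z with (- (m + 1 - 1) - 2 + 1)%Z in IH by lia.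
      rewrite (cauchy_moment_succ G2) in IH by assumption.
      replace (- (m + 1 - 1) - 2)%Z with (- m - 2)%Z in * by lia. rewrite Hmom in IH.
      replace (m - 1 + 1)%Z with m in * by lia.
      set (x := loop_int G1 _) in *. set (y := loop_int G2 _) in *.
      transitivity (/ u * ((- / u * x) - moment m))%C; [now field|]. rewrite IH. now field.
    + intros m IH. replace (- (m - 1 - 1) - 2)%Z with (- (m - 1) - 2 + 1)%Z by lia.
      rewrite (cauchy_moment_succ G2) by assumption. rewrite <- IH.
      replace (m - 1 + 1)%Z with (m - 1 - 1 + 1 + 1)%Z by lia.
      rewrite (cauchy_moment_succ G1 _ (m - 1 - 1 + 1)) by assumption. rewrite Hmom.
      replace (m - 1 - 1 + 1)%Z with (m - 1)%Z by lia. now field.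
Qed.

Lemma loop_agree (G1 G2 : R -> C) (n : Z) :
  encircles_origin G1 -> encircles_origin G2 ->
  loop_int G1 (fun w => CpowZ w n * Cexp (q w))%C
  = loop_int G2 (fun w => CpowZ w n * Cexp (q w))%C.
Proof.
  intros H1 H2.
  assert (E : forall G f, loop_int G (fun w => f w * RtoC 1)%C = loop_int G f).
  { intros G f. apply loop_int_ext. intros; ring. }
  rewrite <- (E G1), <- (E G2).
  apply (loop_exp_agree G1 G2 (fun z => z) (fun _ => RtoC 1) (fun _ => RtoC 1) n H1 H2 cont_off_0_id).
  - auto.
  - intros; apply continuous_const.
  - intros; apply continuous_const.
  - intros m. now rewrite !E, !loop_moment.
Qed.

Lemma loop_agree_inv (G1 G2 : R -> C) (n : Z) :
  encircles_origin G1 -> encircles_origin G2 ->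
  loop_int G1 (fun w => CpowZ w n * Cexp (q w))%C
  = loop_int G2 (fun v => CpowZ v (- n - 2) * Cexp (q (/ v)))%C.
Proof.
  intros H1 H2.
  assert (Epow := fun s m Hs => CpowZ_inv_jacobian (G2 s) m (loop_avoids_origin _ H2 s Hs)).
  assert (E : forall f, loop_int G1 (fun w => f w * RtoC 1)%C = loop_int G1 f).
  { intros f. apply loop_int_ext. intros; ring. }
  transitivity (loop_int G2 (fun v => CpowZ (/ v) n * Cexp (q (/ v)) * / (v * v))%C).
  2:{ apply loop_int_ext. intros s Hs. rewrite Epow by exact Hs. ring. }
  rewrite <- E.
  apply (loop_exp_agree G1 G2 Cinv (fun _ => RtoC 1) (fun v => / (v * v))%C n H1 H2
    cont_off_0_inv Cinv_neq_0).
  - intros; apply continuous_const.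
  - intros s Hs. now apply continuous_inv_sqr, (loop_avoids_origin _ H2).
  - intros m. rewrite E, loop_moment by exact H1.
    transitivity (loop_int G2 (fun v => CpowZ v (- m - 2))).
    + rewrite loop_moment by exact H2. unfold moment.
      destruct (Z.eq_dec m (-1)), (Z.eq_dec (- m - 2) (-1)); try lia; reflexivity.
    + apply loop_int_ext. intros s Hs. now apply Epow.
Qed.

End TwoLoops.

(** ** The residue of w^(n-1) exp(d w) *)

Lemma loop_texp (G : R -> C) (d : R) (n : Z) (N : nat) :
  encircles_origin G ->
  loop_int G (fun w => CpowZ w (n - 1) * texp N (RtoC d * w))%C
  = (two_pi_i * RtoC (if Z_le_dec n 0 then if Z_le_dec (- n) (Z.of_nat N)
      then divided_power d (- n) else 0 else 0))%C.
Proof.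
  intros HG.
  assert (Hcp : forall m s, 0 <= s <= 1 -> continuous (fun w => CpowZ w m) (G s)).
  { intros m s Hs. now apply cont_off_0_CpowZ, (loop_avoids_origin _ HG). }
  assert (Hdp : forall k, divided_power d (Z.of_nat k) = d ^ k / INR (fact k)).
  { intros k. unfold divided_power. now rewrite <- pow_powerRZ, Nat2Z.id. }
  induction N as [|N IH].
  - rewrite (loop_int_ext _ _ (fun w => CpowZ w (n - 1))) by (intros; simpl; ring).
    rewrite loop_moment by exact HG. unfold moment.
    destruct (Z_le_dec n 0) as [H0|H0].
    + destruct (Z_le_dec (- n) (Z.of_nat 0)) as [H1|H1]; destruct (Z.eq_dec (n - 1) (-1)); try lia.
      * replace (- n)%Z with (Z.of_nat 0) by lia. rewrite Hdp. simpl.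
        replace (1 / 1) with 1 by field. ring.
      * ring.
    + destruct (Z.eq_dec (n - 1) (-1)); [lia | ring].
  - rewrite (loop_int_ext _ _ (fun w => RtoC (/ INR (fact (S N)) * d ^ S N)
        * CpowZ w (n - 1 + Z.of_nat (S N)) + CpowZ w (n - 1) * texp N (RtoC d * w))%C).
    2:{ intros s Hs. cbn [texp].
        rewrite CpowZ_add by now apply (loop_avoids_origin _ HG).
        rewrite CpowZ_of_nat, RtoC_mult, RtoC_pow, Cpow_mult_l. ring. }
    rewrite loop_int_comb; [|exact HG | now apply Hcp|].
    2:{ intros s Hs. apply continuous_Cmult; [now apply Hcp|].
        apply (continuous_comp (fun w => RtoC d * w)%C (texp N)).
        - apply continuous_Cmult; [apply continuous_const | apply continuous_id].
        - destruct N as [|N]; [apply continuous_const|].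
          apply (deriv_continuous (X := C_UniformSpace) _ _ _ (cderiv_texp N _)). }
    rewrite IH, loop_moment by exact HG. unfold moment.
    destruct (Z_le_dec n 0) as [H0|H0].
    + destruct (Z_le_dec (- n) (Z.of_nat N)) as [H1|H1];
      destruct (Z_le_dec (- n) (Z.of_nat (S N))) as [H2|H2];
      destruct (Z.eq_dec (n - 1 + Z.of_nat (S N)) (-1)); try lia; try ring.
      replace (- n)%Z with (Z.of_nat (S N)) by lia. rewrite Hdp.
      unfold Rdiv. rewrite (Rmult_comm (d ^ S N)). ring.
    + destruct (Z.eq_dec (n - 1 + Z.of_nat (S N)) (-1)); [lia | ring].
Qed.

Lemma loop_exp_residue (G : R -> C) (d : R) (n : Z) :
  encircles_origin G ->
  loop_int G (fun w => CpowZ w (n - 1) * Cexp (RtoC d * w))%C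
  = (two_pi_i * RtoC (chi (Z_le_dec n 0) * divided_power d (- n)))%C.
Proof.
  intros HG.
  assert (A : arc_ok (closed_path G) (fun _ => RtoC 1) (velocity G)).
  { apply loop_arc_ok; [exact HG | intros; apply continuous_const]. }
  assert (Hlin : forall w, continuous (fun w => RtoC d * w)%C w).
  { intros w. apply continuous_Cmult; [apply continuous_const | apply continuous_id]. }
  apply C_eq_of_close. intros e He.
  destruct (arc_int_limit (closed_path G) (fun _ => RtoC 1) (velocity G)
    (fun w => CpowZ w (n - 1) * Cexp (RtoC d * w))%C
    (fun N w => CpowZ w (n - 1) * texp (S N) (RtoC d * w))%C A) with (e := e) as [N HN]; auto.
  - intros w Hw. apply continuous_Cmult; [now apply cont_off_0_CpowZ | apply continuous_Cexp, Hlin].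
  - intros N w Hw. apply continuous_Cmult; [now apply cont_off_0_CpowZ|].
    apply (continuous_comp (fun w => RtoC d * w)%C (texp (S N))); [apply Hlin|].
    apply (deriv_continuous (X := C_UniformSpace) _ _ _ (cderiv_texp N _)).
  - intros e' He'.
    destruct (continuous_bounded (fun s => RtoC d * closed_path G s)%C 0 1 Rle_0_1) as [B [HB HBq]].
    { intros s. apply continuous_Cmult; [apply continuous_const | apply (arc_g A)]. }
    destruct (continuous_bounded (fun s => CpowZ (closed_path G s) (n - 1)) 0 1 Rle_0_1) as [D [HD HDp]].
    { intros s. apply continuous_CpowZ; [apply (arc_g A) | apply (arc_neq_0 A)]. }
    assert (He'' : 0 < e' / (D + 1)) by (apply Rdiv_lt_0_compat; lra).
    destruct (texp_uniform B _ HB He'') as [N HN]. exists N. intros j Hj s Hs.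
    match goal with |- Cmod (?x * ?y - ?x * ?z) <= _ =>
      replace (x * y - x * z)%C with (x * (y - z))%C by ring end.
    rewrite Cmod_mult. apply Rle_trans with ((D + 1) * (e' / (D + 1))).
    + apply Rmult_le_compat; try apply Cmod_ge_0.
      * eapply Rle_trans; [now apply HDp | lra].
      * apply HN; [exact Hj | now apply HBq].
    + right. field. lra.
  - specialize (HN (Nat.max N (Z.to_nat (- n))) (Nat.le_max_l _ _)).
    rewrite <- (loop_arc_int G _ (fun w => CpowZ w (n - 1) * Cexp (RtoC d * w))
      (fun w => CpowZ w (n - 1) * Cexp (RtoC d * w)))%C in HN by (intros; ring).
    rewrite <- (loop_arc_int G _ (fun w => CpowZ w (n - 1)
       * texp (S (Nat.max N (Z.to_nat (- n)))) (RtoC d * w))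
       (fun w => CpowZ w (n - 1)
       * texp (S (Nat.max N (Z.to_nat (- n)))) (RtoC d * w)))%C in HN by (intros; ring).
    rewrite loop_texp in HN by exact HG.
    replace (two_pi_i * RtoC (chi (Z_le_dec n 0) * divided_power d (- n)))%C
      with (two_pi_i * RtoC (if Z_le_dec n 0 then
        if Z_le_dec (- n) (Z.of_nat (S (Nat.max N (Z.to_nat (- n)))))
        then divided_power d (- n) else 0 else 0))%C.
    + match goal with |- Cmod (?x - ?y) <= _ => replace (x - y)%C with (- (y - x))%C by ring end.
      now rewrite Cmod_opp.
    + f_equal. f_equal. unfold chi. destruct (Z_le_dec n 0) as [H0|H0]; [|ring].
      destruct (Z_le_dec _ _) as [H1|H1]; [ring | lia].
Qed.

(** ** Circles *)

Definition circle (r : R) (s : R) : C := (RtoC r * Cexp (RtoC s * two_pi_i))%C.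

Lemma rderiv_circle (r s : R) : rderiv (circle r) s (two_pi_i * circle r s)%C.
Proof.
  apply (deriv_ext _ (fun s => RtoC r * Cexp (RtoC s * two_pi_i))%C _ _
    (RtoC r * (two_pi_i * Cexp (RtoC s * two_pi_i)))%C).
  - reflexivity.
  - unfold circle. ring.
  - apply deriv_scal, rderiv_Cexp_ray.
Qed.

Lemma velocity_circle (r s : R) : velocity (circle r) s = (two_pi_i * circle r s)%C.
Proof. apply velocity_rderiv, rderiv_circle. Qed.

Lemma continuous_circle (r s : R) : continuous (circle r) s.
Proof. apply (rderiv_continuous _ _ _ (rderiv_circle r s)). Qed.

Lemma Cmod_circle (r s : R) : 0 <= r -> Cmod (circle r s) = r.
Proof.
  intros Hr. unfold circle. rewrite Cmod_mult, Cmod_R, Rabs_pos_eq, Cmod_Cexp by exact Hr.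
  replace (Re (RtoC s * two_pi_i)) with 0; [rewrite exp_0; ring|].
  unfold two_pi_i. simpl. ring.
Qed.

Lemma piecewise_C1_circle (r a b : R) : a <= b -> piecewise_C1 (circle r) a b.
Proof.
  intros Hab. apply piecewise_C1_one with (circle r); auto.
  intros t. assert (H := rderiv_circle r t). repeat split.
  - eexists. now apply rderiv_Re with (l := (two_pi_i * circle r t)%C).
  - eexists. now apply rderiv_Im with (l := (two_pi_i * circle r t)%C).
  - apply (continuous_ext (fun s => two_pi_i * circle r s)%C).
    + intros s. symmetry. apply velocity_circle.
    + apply continuous_Cmult; [apply continuous_const | apply continuous_circle].
Qed.

Lemma circle_closed (r : R) : circle r 0 = circle r 1.
Proof.
  unfold circle. f_equal. unfold two_pi_i, Cexp, RtoC, Cmult, Ci; simpl.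
  replace (0 * (2 * PI * 0 - 0 * 1) - 0 * (2 * PI * 1 + 0 * 0)) with 0 by ring.
  replace (1 * (2 * PI * 0 - 0 * 1) - 0 * (2 * PI * 1 + 0 * 0)) with 0 by ring.
  replace (0 * (2 * PI * 1 + 0 * 0) + 0 * (2 * PI * 0 - 0 * 1)) with 0 by ring.
  replace (1 * (2 * PI * 1 + 0 * 0) + 0 * (2 * PI * 0 - 0 * 1)) with (2 * PI) by ring.
  now rewrite cos_0, sin_0, cos_2PI, sin_2PI.
Qed.

Lemma circle_neq_0 (r s : R) : 0 < r -> circle r s <> RtoC 0.
Proof. intros Hr. apply Cmod_gt_0. rewrite Cmod_circle; lra. Qed.

Lemma encircles_origin_circle (r : R) : 0 < r -> encircles_origin (circle r).
Proof.
  intros Hr. split.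
  - apply piecewise_C1_circle. lra.
  - apply circle_closed.
  - intros s _. now apply circle_neq_0.
  - assert (E : loop_int (circle r) (fun w => / (w - RtoC 0))%C = two_pi_i).
    { rewrite ?loop_int_CInt. apply is_CInt_unique. apply (is_CInt_ext (fun _ => two_pi_i)); [lra| |].
      - intros s _. rewrite velocity_circle. field. 
        assert (H := circle_neq_0 r s Hr). 
        intros E. apply H. rewrite <- E. ring.
      - assert (H := is_RInt_const (V := C_R_NormedModule) 0 1 two_pi_i).
        rewrite scal_R_Cmult, Rminus_0_r, Cmult_1_l in H. exact H. }
    unfold winding. rewrite E. field. apply two_pi_i_neq_0.
Qed.

(** By dilation to the centre of the circle. *)
Lemma winding_circle_outside (r : R) (u : C) :
  0 < r -> r < Cmod u -> winding (circle r) u = RtoC 0.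
Proof.
  intros Hr Hu.
  pose (f := fun z => (RtoC (-1) / (u - z))%C).
  pose (df := fun z => (RtoC 0 / (u - z) + RtoC (-1) / ((u - z) * (u - z)))%C).
  assert (Hne : forall s t, 0 <= s <= 1 -> u <> (RtoC 0 + RtoC s * (circle r t - RtoC 0))%C).
  { intros s t Hs E. apply (f_equal Cmod) in E. revert E.
    replace (RtoC 0 + RtoC s * (circle r t - RtoC 0))%C with (RtoC s * circle r t)%C by ring.
    rewrite Cmod_mult, Cmod_R, Cmod_circle, Rabs_pos_eq by lra. nra. }
  assert (Hd := dilation (circle r) f df 0 1 (RtoC 0) 0 1 (piecewise_C1_circle r 0 1 Rle_0_1) Rle_0_1).
  assert (E0 : loop_int (circle r) (fun w => / (w - u))%C = RtoC 0).
  { transitivity (CInt (fun t => f (RtoC 0 + RtoC 1 * (circle r t - RtoC 0)) * RtoC 1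
        * velocity (circle r) t)%C 0 1 - CInt (fun t => f (RtoC 0 + RtoC 0 * (circle r t - RtoC 0)) * RtoC 0
        * velocity (circle r) t)%C 0 1)%C.
    - replace (CInt (fun t => f (RtoC 0 + RtoC 0 * (circle r t - RtoC 0)) * RtoC 0
        * velocity (circle r) t)%C 0 1) with (RtoC 0).
      + match goal with |- _ = (?x - _)%C => transitivity x; [|ring] end.
        apply CInt_ext; [lra|]. intros t _. unfold f.
        replace (RtoC 0 + RtoC 1 * (circle r t - RtoC 0))%C with (circle r t) by ring.
        rewrite RtoC_m1. assert (H := Hne 1 t (conj Rle_0_1 (Rle_refl 1))).
        assert (H1 : u <> circle r t).
        { intros E. apply H. rewrite E at 1. ring. }
        field. split; apply Cminus_eq_contra; [exact H1 | now apply not_eq_sym].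
      + symmetry. rewrite ?loop_int_CInt. apply is_CInt_unique.
        apply (is_CInt_ext (fun _ => RtoC 0)); [lra | intros; ring|].
        assert (H := is_RInt_const (V := C_R_NormedModule) 0 1 (RtoC 0)).
        rewrite scal_R_Cmult, Cmult_0_r in H. exact H.
    - rewrite Hd.
      + rewrite ?loop_int_CInt. apply is_CInt_unique. apply (is_CInt_ext (fun _ => RtoC 0)); [lra| |].
        * intros s _. rewrite (circle_closed r). ring.
        * assert (H := is_RInt_const (V := C_R_NormedModule) 0 1 (RtoC 0)).
          rewrite scal_R_Cmult, Cmult_0_r in H. exact H.
      + intros s t Hs _. split.
        * apply (cderiv_cauchy_kernel (fun _ => RtoC (-1))); [apply deriv_const | now apply Hne].
        * apply (continuous_cauchy_kernel_deriv (fun _ => RtoC (-1)) (fun _ => RtoC 0));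
            [apply continuous_const | apply continuous_const | now apply Hne]. }
  unfold winding. rewrite E0. field. apply two_pi_i_neq_0.
Qed.

Lemma circle_neq_outside (r s : R) (u : C) : 0 <= r -> r < Cmod u -> circle r s <> u.
Proof. intros Hr Hu E. rewrite <- E, Cmod_circle in Hu by exact Hr. lra. Qed.

(** * The interpolating weight *)

(** For e = eps^2 this is the kernel weight at z/eps, for e = 0 the Gaussian
    weight of the limit; it is invariant under z |-> e/z. *)
Definition wexp (e mu : R) (z : C) : C :=
  (RtoC mu * (z + RtoC e / z) + RtoC (1 / 2) * (z + RtoC e / z) ^ 2)%C.

Definition weight (e mu : R) (m : Z) (z : C) : C := (Cexp (wexp e mu z) * CpowZ z m)%C.

Definition dweight (e mu : R) (m : Z) (z : C) : C :=
  (Cexp (wexp e mu z)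
   * ((RtoC mu + (z + RtoC e / z)) * (RtoC 1 - RtoC e / (z * z)) * CpowZ z m
      + RtoC (IZR m) * CpowZ z (m - 1)))%C.

Lemma RtoC_half_sum : (RtoC (1 / 2) + RtoC (1 / 2))%C = RtoC 1.
Proof. rewrite <- RtoC_plus. f_equal. field. Qed.

Lemma cderiv_wexp (e mu : R) (z : C) :
  z <> RtoC 0 ->
  cderiv (wexp e mu) z
    ((RtoC mu + (z + RtoC e / z)) * (RtoC 1 - RtoC e / (z * z)))%C.
Proof.
  intros Hz.
  pose (l := (RtoC 1 + RtoC e * - / (z * z))%C).
  assert (Hj : cderiv (fun y => y + RtoC e / y)%C z l).
  { apply (deriv_plus _ (fun y => y) (fun y => RtoC e / y)%C).
    - apply (deriv_id (fun z : C => z)).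
    - apply deriv_scal. now apply cderiv_inv. }
  assert (Hq := deriv_comp _ _ (fun y => y + RtoC e / y)%C z _ _ (cderiv_sqr (z + RtoC e / z)) Hj).
  assert (H := deriv_plus _ _ _ _ _ _ (deriv_scal _ _ _ (RtoC mu) _ Hj)
                 (deriv_scal _ _ _ (RtoC (1 / 2)) _ Hq)).
  revert H. apply deriv_ext.
  - intros y. unfold wexp. simpl. ring.
  - assert (E2 : (RtoC (1 / 2) * RtoC 2)%C = RtoC 1).
    { rewrite <- RtoC_mult. f_equal. field. }
    unfold l.
    transitivity (RtoC mu * (RtoC 1 + RtoC e * - / (z * z))
      + (RtoC (1 / 2) * RtoC 2) * ((z + RtoC e / z) * (RtoC 1 + RtoC e * - / (z * z))))%C; [ring|].
    rewrite E2. field. exact Hz.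
Qed.

Lemma cderiv_weight (e mu : R) (m : Z) (z : C) :
  z <> RtoC 0 -> cderiv (weight e mu m) z (dweight e mu m z).
Proof.
  intros Hz.
  assert (H1 := deriv_comp _ Cexp (wexp e mu) z _ _ (cderiv_Cexp _) (cderiv_wexp e mu z Hz)).
  assert (H := deriv_mult _ _ _ _ _ _ H1 (cderiv_CpowZ z m Hz)).
  revert H. apply deriv_ext; [reflexivity|]. unfold dweight. ring.
Qed.

Section Continuity.
Context {X : UniformSpace} (e : X -> R) (z : X -> C) (x : X).
Context (He : continuous e x) (Hzc : continuous z x) (Hz : z x <> RtoC 0).

Lemma continuous_wexp (mu : R) : continuous (fun y => wexp (e y) mu (z y)) x.
Proof using He Hzc Hz.
  assert (Hj : continuous (fun y => z y + RtoC (e y) / z y)%C x).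
  { apply continuous_Cplus; [exact Hzc|]. apply continuous_Cdiv; [now apply continuous_RtoC | exact Hzc | exact Hz]. }
  unfold wexp. apply continuous_Cplus; (apply continuous_Cmult; [apply continuous_const|]).
  - exact Hj.
  - apply continuous_Cpow. exact Hj.
Qed.

Lemma continuous_weight (mu : R) (m : Z) : continuous (fun y => weight (e y) mu m (z y)) x.
Proof using He Hzc Hz.
  unfold weight. apply continuous_Cmult.
  - apply continuous_Cexp, continuous_wexp.
  - now apply continuous_CpowZ.
Qed.

End Continuity.

Lemma continuous_dweight (e mu : R) (m : Z) (z : C) :
  z <> RtoC 0 -> continuous (dweight e mu m) z.
Proof.
  intros Hz. unfold dweight.
  assert (Hid : continuous (fun z : C => z) z) by apply continuous_id.
  apply continuous_Cmult.
  - apply continuous_Cexp.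
    apply (continuous_wexp (fun _ => e) (fun z => z)); [apply continuous_const | exact Hid | exact Hz].
  - apply continuous_Cplus; apply continuous_Cmult.
    + apply continuous_Cmult.
      * apply continuous_Cplus; [apply continuous_const|].
        apply continuous_Cplus; [exact Hid|].
        apply continuous_Cdiv; [apply continuous_const | exact Hid | exact Hz].
      * apply continuous_Cminus; [apply continuous_const|].
        apply continuous_Cdiv; [apply continuous_const | | now apply Cmult_neq_0].
        now apply continuous_Cmult.
    + now apply cont_off_0_CpowZ.
    + apply continuous_const.
    + now apply cont_off_0_CpowZ.
Qed.

(** ** Gaussian decay, uniformly in e in [0, 1] *)

Lemma pow_le_fact_exp (n : nat) (x : R) : 0 <= x -> x ^ n <= INR (fact n) * exp x.
Proof.
  intros Hx. assert (H := exp_ge_taylor x n Hx).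
  assert (Hf := INR_fact_pos n).
  assert (Hn : x ^ n / INR (fact n) <= exp x).
  { eapply Rle_trans; [|exact H]. destruct n as [|n]; [simpl; lra|].
    rewrite tech5. assert (H0 : 0 <= sum_f_R0 (fun k => x ^ k / INR (fact k)) n).
    { apply cond_pos_sum. intros k. apply Rmult_le_pos; [now apply pow_le|].
      left. apply Rinv_0_lt_compat, INR_fact_pos. }
    lra. }
  apply Rmult_le_reg_r with (/ INR (fact n)); [now apply Rinv_0_lt_compat|].
  replace (INR (fact n) * exp x * / INR (fact n)) with (exp x) by (field; lra). exact Hn.
Qed.

Lemma exp_le (x y : R) : x <= y -> exp x <= exp y.
Proof. intros [H|H]; [left; now apply exp_increasing | rewrite H; lra]. Qed.

Lemma Cmod_CpowZ_le (z : C) (m : Z) :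
  1 <= Cmod z -> Cmod (CpowZ z m) <= Cmod z ^ Z.abs_nat m.
Proof.
  intros Hz. assert (Hz0 : z <> RtoC 0) by (apply Cmod_gt_0; lra).
  assert (H1 : 1 <= Cmod z ^ Z.abs_nat m) by now apply pow_R1_Rle.
  destruct (Z_lt_le_dec m 0) as [Hm|Hm].
  - replace m with (- Z.of_nat (Z.abs_nat m))%Z at 1 by lia.
    rewrite CpowZ_opp_of_nat, Cmod_inv, Cmod_pow by now apply Cpow_nz.
    eapply Rle_trans; [|exact H1]. rewrite <- Rinv_1. apply Rinv_le_contravar; lra.
  - replace m with (Z.of_nat (Z.abs_nat m)) at 1 by lia.
    rewrite CpowZ_of_nat, Cmod_pow. lra.
Qed.

(** In the sector -(Im z)^2 dominates (Re z)^2, and 4 <= |Im z| makes the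
    perturbation e/z harmless, since then e/|z|^2 <= 1/16. *)
Lemma Re_wexp_le (e mu : R) (z : C) :
  0 <= e <= 1 -> 4 <= Rabs (Im z) -> 2 * Rabs (Re z) <= Rabs (Im z) ->
  Re (wexp e mu z) <= - (Rabs (Im z) ^ 2 / 4) + Rabs mu * Rabs (Im z).
Proof.
  destruct z as [x y]. change (Re (x, y)) with x. change (Im (x, y)) with y.
  intros He Hy Hx.
  assert (Y2 : y * y = Rabs y * Rabs y) by (rewrite <- Rabs_mult, Rabs_pos_eq; nra).
  assert (X2 : x * x = Rabs x * Rabs x) by (rewrite <- Rabs_mult, Rabs_pos_eq; nra).
  assert (HX := Rabs_pos x). set (d := e / (x * x + y * y)).
  assert (Hn : 16 <= x * x + y * y) by nra.
  assert (Hd : 0 <= d <= / 16).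
  { unfold d, Rdiv. assert (Hi : / (x * x + y * y) <= / 16) by (apply Rinv_le_contravar; lra).
    assert (Hi0 : 0 < / (x * x + y * y)) by (apply Rinv_0_lt_compat; lra). nra. }
  assert (E : wexp e mu (x, y) = 
    (RtoC mu * ((x * (1 + d))%R, (y * (1 - d))%R)
     + RtoC (1 / 2) * ((x * (1 + d))%R, (y * (1 - d))%R) ^ 2)%C).
  { unfold wexp. replace ((x, y) + RtoC e / (x, y))%C with (x * (1 + d), y * (1 - d)); [reflexivity|].
    unfold Cdiv, Cinv, Cmult, Cplus, RtoC, d; simpl. f_equal; field; nra. }
  rewrite E. simpl.
  match goal with |- ?l <= _ => replace l with
    (mu * (x * (1 + d)) + / 2 * ((x * x) * ((1 + d) * (1 + d)) - (y * y) * ((1 - d) * (1 - d)))) by field end.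
  rewrite X2, Y2.
  assert (M1 : mu * (x * (1 + d)) <= Rabs mu * Rabs y).
  { eapply Rle_trans; [apply Rle_abs|]. rewrite Rabs_mult.
    apply Rmult_le_compat_l; [apply Rabs_pos|].
    rewrite Rabs_mult, (Rabs_pos_eq (1 + d)) by lra. nra. }
  assert (D1 : (1 + d) * (1 + d) <= 17 / 16 * (17 / 16)) by nra.
  assert (D2 : 15 / 16 * (15 / 16) <= (1 - d) * (1 - d)) by nra.
  assert (X3 : Rabs x * Rabs x <= Rabs y * Rabs y / 4) by nra.
  set (X := Rabs x * Rabs x) in *. set (Y := Rabs y * Rabs y) in *.
  assert (P1 : X * ((1 + d) * (1 + d)) <= Y / 4 * (17 / 16 * (17 / 16))).
  { apply Rmult_le_compat; try nra. }
  assert (P2 : Y * (15 / 16 * (15 / 16)) <= Y * ((1 - d) * (1 - d))).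
  { apply Rmult_le_compat_l; [nra | exact D2]. }
  assert (HY0 : 0 <= Y) by nra. rewrite Rmult_1_r. fold Y. lra.
Qed.

Lemma tail_ok_weight (mu : R) (m : Z) :
  exists M, 0 <= M /\ forall e, 0 <= e <= 1 -> tail_ok (weight e mu m) M 4.
Proof.
  pose (N := (Z.abs_nat m + 4)%nat). pose (a := Rabs mu).
  exists (INR (fact N) * exp ((a + 2) * (a + 2))). split.
  { apply Rmult_le_pos; [apply pos_INR | left; apply exp_pos]. }
  intros e He. exists (dweight e mu m). intros z Hz1 Hz2.
  assert (Hm := im_le_Cmod z).
  assert (Hz0 : z <> RtoC 0) by (apply Cmod_gt_0; lra).
  split; [now apply cderiv_weight|]. split; [now apply continuous_dweight|].
  set (t := Rabs (Im z)) in *.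
  assert (Hzt : Cmod z <= 2 * t).
  { assert (H := Cmod_le_Re_Im z). fold t in H. assert (H' := Rabs_pos (Re z)). lra. }
  unfold weight. rewrite Cmod_mult, Cmod_Cexp.
  assert (H1 : Cmod (CpowZ z m) * t ^ 4 <= INR (fact N) * exp (2 * t)).
  { apply Rle_trans with ((2 * t) ^ N); [|apply pow_le_fact_exp; lra].
    unfold N. rewrite pow_add. apply Rmult_le_compat.
    - apply Cmod_ge_0.
    - apply pow_le. lra.
    - eapply Rle_trans; [apply Cmod_CpowZ_le; lra|]. apply pow_incr.
      split; [apply Cmod_ge_0 | exact Hzt].
    - apply pow_incr. lra. }
  assert (H2 : exp (Re (wexp e mu z)) <= exp (- (t ^ 2 / 4) + a * t)).
  { apply exp_le. now apply Re_wexp_le. }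
  rewrite Rmult_assoc.
  apply Rle_trans with (exp (- (t ^ 2 / 4) + a * t) * (INR (fact N) * exp (2 * t))).
  - apply Rmult_le_compat; [left; apply exp_pos | | exact H2 | exact H1].
    apply Rmult_le_pos; [apply Cmod_ge_0 | apply pow_le; lra].
  - replace (exp (- (t ^ 2 / 4) + a * t) * (INR (fact N) * exp (2 * t)))
      with (INR (fact N) * (exp (- (t ^ 2 / 4) + a * t) * exp (2 * t))) by ring.
    rewrite <- exp_plus. apply Rmult_le_compat_l; [apply pos_INR|]. apply exp_le.
    (* completing the square *)
    assert (0 <= (t / 2 - (a + 2)) ^ 2) by apply pow2_ge_0. nra.
Qed.

Lemma tail_ok_scal (f : C -> C) (M Y : R) (c : C) :
  tail_ok f M Y -> tail_ok (fun z => c * f z)%C (Cmod c * M) Y.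
Proof.
  intros Ht. assert (H := tail_ok_scale f M Y 1 c Rlt_0_1 Ht).
  replace (fun z => c * f z)%C with (fun z => c * f (RtoC 1 * z))%C.
  - now rewrite pow1, !Rdiv_1_r in H.
  - apply functional_extensionality. intros z. now rewrite Cmult_1_l.
Qed.

Lemma line_int_scal (Sg : R -> C) (f : C -> C) (c : C) (M Y : R) :
  from_pioo_to_mioo Sg -> 0 <= M -> tail_ok f M Y ->
  (forall t, continuous (fun s => f (Sg s)) t) ->
  line_int Sg (fun z => c * f z)%C = (c * line_int Sg f)%C.
Proof.
  intros HS HM Ht Hc. apply is_line_int_unique. apply is_line_int_of_limit.
  - intros a b. apply (ex_CInt_line Sg (fun z => c * f z)%C); [exact HS|].
    intros t. apply continuous_Cmult; [apply continuous_const | apply Hc].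
  - intros e He. assert (Hp := Cmod_ge_0 c).
    assert (He' : 0 < e / (Cmod c + 1)) by (apply Rdiv_lt_0_compat; lra).
    destruct (line_int_close Sg M Y _ HS HM He') as [T [HT K]].
    exists T. split; [exact HT|]. intros a b Ha Hb.
    rewrite (is_CInt_unique _ a b (c * CInt (line_integrand Sg f) a b)%C).
    + match goal with |- Cmod (?x * ?y - ?x * ?w) <= _ =>
        replace (x * y - x * w)%C with (x * (y - w))%C by ring end.
      rewrite Cmod_mult. specialize (K f Ht Hc a b Ha Hb).
      apply Rle_trans with ((Cmod c + 1) * (e / (Cmod c + 1))).
      * apply Rmult_le_compat; try apply Cmod_ge_0; lra.
      * right. field. lra.
    + apply (is_CInt_ext (fun t => c * (f (Sg t) * velocity Sg t))%C); [lra | intros; ring|].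
      apply is_CInt_Cmult, CInt_correct, ex_CInt_line; assumption.
Qed.

(** The substitution z = 1/u, which exchanges the two infinite contours. *)
Lemma line_int_inv_path (Sg : R -> C) (f h : C -> C) (M Y : R) :
  from_pioo_to_mioo Sg -> 0 <= M -> tail_ok h M Y ->
  (forall t, continuous (fun s => h (Sg s)) t) ->
  (forall t, h (Sg t) = f (/ Sg t) * - / (Sg t * Sg t))%C ->
  line_int (inv_path Sg) f = line_int Sg h.
Proof.
  intros HS HM Ht Hc Hh.
  assert (H0 : forall t, Sg t <> RtoC 0) by (intros; now apply line_neq_0).
  assert (HSc : forall t, continuous Sg t) by (intros; now apply line_continuous).
  assert (HF : forall t, continuous (fun s => f (inv_path Sg s)) t).
  { intros t. apply (continuous_ext (fun s => h (Sg s) * (- (Sg s * Sg s)))%C).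
    - intros s. unfold inv_path. rewrite Hh. specialize (H0 s). Cfield. exact H0.
    - apply continuous_Cmult; [apply Hc|]. apply continuous_Copp.
      now apply continuous_Cmult. }
  assert (Hle : forall a b, a <= b -> is_CInt (fun t => f (inv_path Sg t) * velocity (inv_path Sg) t)%C a b
            (CInt (line_integrand Sg h) a b)).
  { intros a b Hab.
    rewrite (CInt_ext _ (fun t => f (inv_path Sg t) * (- / (Sg t * Sg t)) * velocity Sg t)%C).
    - apply (is_CInt_inv_path Sg (fun t => f (inv_path Sg t))); auto. now apply HS.
    - exact Hab.
    - intros t _. now rewrite Hh. }
  apply is_line_int_unique. apply is_line_int_of_limit.
  - intros a b. destruct (Rle_dec a b) as [Hab|Hab].
    + eexists. now apply Hle.
    + apply (ex_RInt_swap (V := C_R_NormedModule)). eexists. apply Hle. lra.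
  - intros e He. destruct (line_int_close Sg M Y e HS HM He) as [T [HT K]].
    exists T. split; [exact HT|]. intros a b Ha Hb.
    rewrite (is_CInt_unique _ a b _ (Hle a b ltac:(lra))). now apply K.
Qed.

(** * Reduction of the kernel to circles *)

Lemma line_away_from_0 (Sg : R -> C) :
  from_pioo_to_mioo Sg -> exists r, 0 < r /\ forall t, r < Cmod (Sg t).
Proof.
  intros HS. destruct (line_ends Sg 1 HS) as [T [HT [Hl Hr]]].
  destruct (continuity_ab_min (fun t => Cmod (Sg t)) (- T) T) as [t0 [H0 _]]; [lra| |].
  { intros t _. apply continuity_pt_filterlim. now apply continuous_Cmod, line_continuous. }
  assert (Hp : 0 < Cmod (Sg t0)) by now apply Cmod_gt_0, line_neq_0.
  exists (Rmin (Cmod (Sg t0)) 1 / 2).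
  assert (H1 := Rmin_l (Cmod (Sg t0)) 1). assert (H2 := Rmin_r (Cmod (Sg t0)) 1).
  assert (H3 : 0 < Rmin (Cmod (Sg t0)) 1) by (apply Rmin_glb_lt; lra).
  split; [lra|]. intros t.
  destruct (Rle_dec t (- T)) as [Ha|Ha].
  - destruct (Hl t Ha) as [K1 [K2 _]]. assert (K := im_le_Cmod (Sg t)).
    rewrite Rabs_pos_eq in K by lra. lra.
  - destruct (Rle_dec T t) as [Hb|Hb].
    + destruct (Hr t Hb) as [K1 [K2 _]]. assert (K := im_le_Cmod (Sg t)).
      rewrite Rabs_left in K by lra. lra.
    + assert (Ht : - T <= t <= T) by lra. specialize (H0 t Ht). lra.
Qed.

Lemma cauchy_int_of_loop (Sg G : R -> C) (A b : C -> C) (f : C -> C -> C) (P M Y : R) :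
  from_pioo_to_mioo Sg -> 0 <= M -> tail_ok A M Y ->
  (forall t, continuous (fun s => A (Sg s)) t) ->
  loop_ok Sg (closed_path G) (fun s => b (closed_path G s)) (velocity G) P ->
  (forall s t, 0 <= s <= 1 -> f (G s) (Sg t) = (b (G s) * (A (Sg t) / (G s - Sg t)))%C) ->
  is_CInt (fun s => line_int Sg (f (G s)) * velocity G s)%C 0 1
    (cauchy_int Sg A (closed_path G) (fun s => b (closed_path G s)) (velocity G)).
Proof.
  intros HS HM Ht HA Hl Hf.
  refine (is_CInt_ext _ _ 0 1 _ Rle_0_1 _ (CInt_correct _ _ _
    (ex_cauchy_int Sg A _ _ _ P M Y HS HM Ht HA Hl))).
  intros s Hs. f_equal. rewrite clamp_id by lra. symmetry.
  rewrite (line_int_ext Sg (f (G s)) (fun z => b (G s) * (A z / (G s - z)))%C)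
    by (intros t; apply Hf; lra).
  assert (Hb := loop_ok_bound Hl s). cbv beta in Hb. rewrite clamp_id in Hb by lra.
  apply (line_int_scal Sg (fun z => A z / (G s - z))%C (b (G s)) M (Rmax Y (P + 1)) HS HM).
  - apply tail_ok_cauchy_kernel; auto. now apply (loop_ok_bound_pos _ _ _ _ _ Hl).
  - intros t. apply (continuous_ext (fun t => A (Sg t) / (closed_path G s - Sg t))%C).
    { intros u. now rewrite clamp_id by lra. }
    apply (continuous_slice (fun s t => A (Sg t) / (closed_path G s - Sg t))%C).
    now apply (loop_ok_kernel_continuous Sg A (closed_path G) (fun s => b (closed_path G s))
                 (velocity G) P).
Qed.

Lemma cauchy_int_const (Sg : R -> C) (A : C -> C) (p b om p' b' om' : R -> C) (c : C) (P M Y : R) :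
  from_pioo_to_mioo Sg -> 0 <= M -> tail_ok A M Y ->
  (forall t, continuous (fun s => A (Sg s)) t) -> loop_ok Sg p' b' om' P ->
  (forall s, p s = p' s) -> (forall s, b s * om s = c * (b' s * om' s))%C ->
  cauchy_int Sg A p b om = (c * cauchy_int Sg A p' b' om')%C.
Proof.
  intros HS HM Ht HA Hl Hp Hb. apply is_CInt_unique.
  apply (is_CInt_ext (fun s => c * (b' s * line_int Sg (fun z => A z / (p' s - z)) * om' s))%C); [lra| |].
  - intros s _. rewrite Hp.
    transitivity (c * (b' s * om' s) * line_int Sg (fun z => A z / (p' s - z)))%C; [ring|].
    rewrite <- Hb. ring.
  - apply is_CInt_Cmult, CInt_correct. now apply (ex_cauchy_int Sg A p' b' om' P M Y).
Qed.

Lemma continuous_weight_line (Sg : R -> C) (e mu : R) (m : Z) (t : R) :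
  from_pioo_to_mioo Sg -> continuous (fun s => weight e mu m (Sg s)) t.
Proof.
  intros HS. apply (continuous_weight (fun _ => e) Sg).
  - apply continuous_const.
  - now apply line_continuous.
  - now apply line_neq_0.
Qed.

Lemma laurent_wexp (e mu : R) (z : C) :
  z <> RtoC 0 ->
  (- wexp e mu z)%C = laurent (- RtoC e) (- RtoC mu) (- RtoC (1 / 2))
    (- (RtoC mu * RtoC e)) (- (RtoC (1 / 2) * (RtoC e * RtoC e))) z.
Proof.
  intros Hz. unfold wexp, laurent. simpl.
  transitivity (- (RtoC mu * (z + RtoC e / z))
    - (RtoC (1 / 2) * (z * z) + (RtoC (1 / 2) + RtoC (1 / 2)) * RtoC e
       + RtoC (1 / 2) * (RtoC e * RtoC e) / (z * z)))%C.
  - field. exact Hz.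
  - rewrite RtoC_half_sum. field. exact Hz.
Qed.

(** ** The two representations of the double integral *)

(** The double integral with w = v / eps and z = u / eps, up to a power of eps. *)
Definition outer_int (Sg : R -> C) (r e mu1 mu2 : R) (x1 x2 : Z) : C :=
  cauchy_int Sg (weight e mu2 (- x2 - 1)) (circle r)
    (fun s => CpowZ (circle r s) x1 * Cexp (- wexp e mu1 (circle r s)))%C (velocity (circle r)).

(** The same with w = eps v: the symmetry of the weight replaces v by 1/v in its
    exponent, and the loop shrinks to the origin with e = eps^2. *)
Definition inner_int (Sg : R -> C) (r e mu1 mu2 : R) (x1 x2 : Z) : C :=
  cauchy_int Sg (weight e mu2 (- x2 - 1)) (fun s => RtoC e * circle r s)%C
    (fun s => CpowZ (circle r s) x1 * Cexp (- wexp e mu1 (/ circle r s)))%C (velocity (circle r)).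

Lemma pw_cont_velocity_circle (r : R) : pw_cont (velocity (circle r)) 0 1.
Proof. apply pw_cont_velocity, piecewise_C1_circle. lra. Qed.

Lemma continuous_outer_int (Sg : R -> C) (r mu1 mu2 : R) (x1 x2 : Z) :
  from_pioo_to_mioo Sg -> 0 < r -> (forall t, r < Cmod (Sg t)) ->
  continuous (fun x => outer_int Sg r (clamp 0 1 x) mu1 mu2 x1 x2) 0.
Proof.
  intros HS Hr HSr. destruct (tail_ok_weight mu2 (- x2 - 1)) as [M [HM Ht]].
  assert (Hcl : forall q : R * R, continuous (fun q : R * R => clamp 0 1 (fst q)) q).
  { intros q. apply (continuous_clamp 0 1 fst), continuous_fst. }
  assert (Hci : forall q : R * R, continuous (fun q : R * R => circle r (snd q)) q).
  { intros q. apply (continuous_comp snd (circle r)); [apply continuous_snd | apply continuous_circle]. }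
  unfold outer_int.
  apply (continuous_cauchy_int Sg (fun x => weight (clamp 0 1 x) mu2 (- x2 - 1))
    (fun _ => circle r)
    (fun x s => CpowZ (circle r s) x1 * Cexp (- wexp (clamp 0 1 x) mu1 (circle r s)))%C
    (velocity (circle r)) r M 4); auto.
  - intros x. apply Ht, clamp_in. lra.
  - intros x t. apply (continuous_weight (fun q : R * R => clamp 0 1 (fst q)) (fun q : R * R => Sg (snd q))).
    + apply Hcl.
    + apply (continuous_comp snd Sg); [apply continuous_snd | now apply line_continuous].
    + now apply line_neq_0.
  - apply pw_cont_velocity_circle.
  - intros x s. apply continuous_Cmult.
    + apply continuous_CpowZ; [apply Hci | now apply circle_neq_0].
    + apply continuous_Cexp, continuous_Copp.
      apply (continuous_wexp (fun q : R * R => clamp 0 1 (fst q)) (fun q : R * R => circle r (snd q)));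
        [apply Hcl | apply Hci | now apply circle_neq_0].
  - intros x s t. apply circle_neq_outside; [lra | apply HSr].
  - intros x s. rewrite Cmod_circle; lra.
Qed.

Lemma continuous_inner_int (Sg : R -> C) (r mu1 mu2 : R) (x1 x2 : Z) :
  from_pioo_to_mioo Sg -> 0 < r -> (forall t, r < Cmod (Sg t)) ->
  continuous (fun x => inner_int Sg r (clamp 0 1 x) mu1 mu2 x1 x2) 0.
Proof.
  intros HS Hr HSr. destruct (tail_ok_weight mu2 (- x2 - 1)) as [M [HM Ht]].
  assert (Hcl : forall q : R * R, continuous (fun q : R * R => clamp 0 1 (fst q)) q).
  { intros q. apply (continuous_clamp 0 1 fst), continuous_fst. }
  assert (Hci : forall q : R * R, continuous (fun q : R * R => circle r (snd q)) q).
  { intros q. apply (continuous_comp snd (circle r)); [apply continuous_snd | apply continuous_circle]. }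
  assert (Hmod : forall x s, Cmod (RtoC (clamp 0 1 x) * circle r s) <= r).
  { intros x s. rewrite Cmod_mult, Cmod_R, Cmod_circle by lra.
    assert (H := clamp_in 0 1 x Rle_0_1). rewrite Rabs_pos_eq by lra. nra. }
  unfold inner_int.
  apply (continuous_cauchy_int Sg (fun x => weight (clamp 0 1 x) mu2 (- x2 - 1))
    (fun x s => RtoC (clamp 0 1 x) * circle r s)%C
    (fun x s => CpowZ (circle r s) x1 * Cexp (- wexp (clamp 0 1 x) mu1 (/ circle r s)))%C
    (velocity (circle r)) r M 4); auto.
  - intros x. apply Ht, clamp_in. lra.
  - intros x t. apply (continuous_weight (fun q : R * R => clamp 0 1 (fst q)) (fun q : R * R => Sg (snd q))).
    + apply Hcl.
    + apply (continuous_comp snd Sg); [apply continuous_snd | now apply line_continuous].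
    + now apply line_neq_0.
  - apply pw_cont_velocity_circle.
  - intros x s. apply continuous_Cmult; [|apply Hci]. apply continuous_RtoC, Hcl.
  - intros x s. apply continuous_Cmult.
    + apply continuous_CpowZ; [apply Hci | now apply circle_neq_0].
    + apply continuous_Cexp, continuous_Copp.
      apply (continuous_wexp (fun q : R * R => clamp 0 1 (fst q)) (fun q : R * R => / circle r (snd q))%C);
        [apply Hcl | | now apply Cinv_neq_0, circle_neq_0].
      apply continuous_Cinv; [apply Hci | now apply circle_neq_0].
  - intros x s t E. assert (K := Hmod x s). rewrite E in K. specialize (HSr t). lra.
Qed.

(** This is kernel_weight eps mu z * z^m off the origin, in a form that inherits
    decay and derivative from [weight]. *)
Definition scaled_weight (eps mu : R) (m : Z) (z : C) : C :=
  (RtoC (powerRZ eps (- m)) * weight (eps ^ 2) mu m (RtoC eps * z))%C.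

Lemma kernel_weight_wexp (eps mu : R) (z : C) :
  0 < eps -> z <> RtoC 0 -> kernel_weight eps mu z = Cexp (wexp (eps ^ 2) mu (RtoC eps * z)).
Proof.
  intros He Hz. unfold kernel_weight, wexp. f_equal.
  assert (He0 : RtoC eps <> RtoC 0) by (apply RtoC_neq_0; lra).
  assert (E2 : RtoC (eps ^ 2) = (RtoC eps * RtoC eps)%C) by (rewrite <- RtoC_mult; f_equal; ring).
  assert (E3 : RtoC (eps ^ 2 / 2) = (RtoC (1 / 2) * (RtoC eps * RtoC eps))%C)
    by (rewrite <- !RtoC_mult; f_equal; field).
  rewrite E2, E3, RtoC_mult. simpl. field. split; assumption.
Qed.

Lemma kernel_weight_inv (eps mu : R) (z : C) :
  z <> RtoC 0 -> kernel_weight eps mu (/ z) = kernel_weight eps mu z.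
Proof.
  intros Hz. unfold kernel_weight. replace (/ z + / / z)%C with (z + / z)%C; [reflexivity|].
  field. exact Hz.
Qed.

Lemma scaled_weight_eq (eps mu : R) (m : Z) (z : C) :
  0 < eps -> z <> RtoC 0 ->
  scaled_weight eps mu m z = (kernel_weight eps mu z * CpowZ z m)%C.
Proof.
  intros He Hz. assert (He0 : RtoC eps <> RtoC 0) by (apply RtoC_neq_0; lra).
  unfold scaled_weight, weight. rewrite kernel_weight_wexp by assumption.
  rewrite CpowZ_mult by assumption.
  rewrite <- CpowZ_RtoC by lra. rewrite CpowZ_opp by assumption.
  field. now apply CpowZ_neq_0.
Qed.

Lemma tail_ok_scaled_weight (eps mu : R) (m : Z) :
  0 < eps < 1 -> exists M Y, 0 <= M /\ tail_ok (scaled_weight eps mu m) M Y.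
Proof.
  intros He. destruct (tail_ok_weight mu m) as [M [HM Ht]].
  assert (He2 : 0 <= eps ^ 2 <= 1) by nra.
  eexists. eexists. split; [|apply tail_ok_scale; [apply He | apply (Ht _ He2)]].
  apply Rmult_le_pos; [apply Rmult_le_pos; [apply Cmod_ge_0 | exact HM]|].
  left. apply Rinv_0_lt_compat, pow_lt. lra.
Qed.

Lemma cderiv_scaled_weight (eps mu : R) (m : Z) (z : C) :
  0 < eps -> z <> RtoC 0 ->
  cderiv (scaled_weight eps mu m) z
    (RtoC (powerRZ eps (- m)) * (dweight (eps ^ 2) mu m (RtoC eps * z) * RtoC eps))%C.
Proof.
  intros He Hz. apply deriv_scal.
  apply (deriv_comp _ (weight (eps ^ 2) mu m) (fun z => RtoC eps * z)%C).
  - apply cderiv_weight, Cmult_neq_0; [apply RtoC_neq_0; lra | exact Hz].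
  - apply (deriv_ext _ (fun z => RtoC eps * z)%C _ _ (RtoC eps * RtoC 1)%C); [reflexivity | ring|].
    apply deriv_scal, (deriv_id (fun z : C => z)).
Qed.

Lemma continuous_scaled_weight_deriv (eps mu : R) (m : Z) (z : C) :
  0 < eps -> z <> RtoC 0 ->
  continuous (fun z => RtoC (powerRZ eps (- m)) * (dweight (eps ^ 2) mu m (RtoC eps * z) * RtoC eps))%C z.
Proof.
  intros He Hz. apply continuous_Cmult; [apply continuous_const|].
  apply continuous_Cmult; [|apply continuous_const].
  apply (continuous_comp (fun z => RtoC eps * z)%C (dweight (eps ^ 2) mu m)).
  - apply continuous_Cmult; [apply continuous_const | apply continuous_id].
  - apply continuous_dweight, Cmult_neq_0; [apply RtoC_neq_0; lra | exact Hz].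
Qed.

Lemma continuous_scaled_weight_line (Sg : R -> C) (eps mu : R) (m : Z) (t : R) :
  from_pioo_to_mioo Sg -> 0 < eps -> continuous (fun s => scaled_weight eps mu m (Sg s)) t.
Proof.
  intros HS He. assert (H0 := line_neq_0 Sg t HS).
  apply (continuous_comp Sg (scaled_weight eps mu m)); [now apply line_continuous|].
  apply (deriv_continuous (X := C_UniformSpace) _ _ _ (cderiv_scaled_weight eps mu m (Sg t) He H0)).
Qed.

(** This is w^n / kernel_weight eps mu w off the origin, without the division, so
    that the exponent is a Laurent polynomial. *)
Definition loop_factor (eps mu : R) (n : Z) (w : C) : C :=
  (CpowZ w n * Cexp (- wexp (eps ^ 2) mu (RtoC eps * w)))%C.

Lemma laurent_loop_factor (eps mu : R) :
  0 < eps -> exists c0 a1 a2,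
    (forall n w, w <> RtoC 0 ->
       loop_factor eps mu n w = CpowZ w n * Cexp (laurent c0 a1 a2 a1 a2 w))%C.
Proof.
  intros He. assert (He0 : RtoC eps <> RtoC 0) by (apply RtoC_neq_0; lra).
  assert (E2 : RtoC (eps ^ 2) = (RtoC eps * RtoC eps)%C) by (rewrite <- RtoC_mult; f_equal; ring).
  exists (- (RtoC eps * RtoC eps))%C, (- (RtoC mu * RtoC eps))%C,
    (- (RtoC (1 / 2) * (RtoC eps * RtoC eps)))%C.
  intros n w Hw. unfold loop_factor. f_equal. f_equal.
  rewrite laurent_wexp by now apply Cmult_neq_0.
  unfold laurent. rewrite E2. simpl. field. split; assumption.
Qed.

Lemma continuous_loop_factor (eps mu : R) (n : Z) (w : C) :
  0 < eps -> w <> RtoC 0 -> continuous (loop_factor eps mu n) w.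
Proof.
  intros He Hw. unfold loop_factor. apply continuous_Cmult; [now apply cont_off_0_CpowZ|].
  apply continuous_Cexp, continuous_Copp.
  apply (continuous_wexp (fun _ => eps ^ 2) (fun w => RtoC eps * w)%C).
  - apply continuous_const.
  - apply continuous_Cmult; [apply continuous_const | apply continuous_id].
  - apply Cmult_neq_0; [apply RtoC_neq_0; lra | exact Hw].
Qed.

Lemma loop_factor_weight (eps mu : R) (n : Z) (w : C) :
  0 < eps -> w <> RtoC 0 -> (CpowZ w n / kernel_weight eps mu w)%C = loop_factor eps mu n w.
Proof.
  intros He Hw. unfold loop_factor. rewrite Cexp_opp, kernel_weight_wexp by assumption.
  reflexivity.
Qed.

Definition circle_int (Sg : R -> C) (r eps mu1 mu2 : R) (x1 x2 : Z) : C :=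
  cauchy_int Sg (scaled_weight eps mu2 (- x2 - 1)) (circle r)
    (fun s => loop_factor eps mu1 x1 (circle r s)) (velocity (circle r)).

Lemma loop_ok_circle (Sg : R -> C) (r : R) (b : C -> C) :
  0 < r -> (forall t, r < Cmod (Sg t)) -> cont_off_0 b ->
  loop_ok Sg (circle r) (fun s => b (circle r s)) (velocity (circle r)) r.
Proof.
  intros Hr HSr Hb. split.
  - intros s. apply continuous_circle.
  - intros s. apply (continuous_comp (circle r) b); [apply continuous_circle|].
    now apply Hb, circle_neq_0.
  - apply pw_cont_velocity_circle.
  - intros s t. apply circle_neq_outside; [lra | apply HSr].
  - intros s. rewrite Cmod_circle; lra.
Qed.

Lemma closed_path_bounded (G : R -> C) (f : C -> C) :
  encircles_origin G -> cont_off_0 f -> exists P, forall s, Cmod (f (closed_path G s)) <= P.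
Proof.
  intros HG Hf.
  destruct (continuous_bounded (fun s => f (closed_path G s)) 0 1 Rle_0_1) as [P [_ HP]].
  { intros s. apply (continuous_comp (closed_path G) f).
    - now apply continuous_path_clamp, HG.
    - apply Hf, HG, clamp_in. lra. }
  exists P. intros s. assert (Hc := clamp_in 0 1 s Rle_0_1). specialize (HP _ Hc).
  cbv beta in HP. now rewrite (clamp_id 0 1 (clamp 0 1 s)) in HP.
Qed.

Lemma loop_ok_closed_path (Sg G : R -> C) (b : C -> C) :
  encircles_origin G -> (forall s t, 0 <= s <= 1 -> G s <> Sg t) -> cont_off_0 b ->
  exists P, loop_ok Sg (closed_path G) (fun s => b (closed_path G s)) (velocity G) P.
Proof.
  intros HG Hd Hb.
  destruct (closed_path_bounded G (fun z => z) HG) as [P HP]; [intros z _; apply continuous_id|].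
  exists P. split.
  - intros s. now apply continuous_path_clamp, HG.
  - intros s. apply (continuous_comp (closed_path G) b).
    + now apply continuous_path_clamp, HG.
    + apply Hb, HG, clamp_in. lra.
  - now apply pw_cont_velocity, HG.
  - intros s t. apply Hd, clamp_in. lra.
  - exact HP.
Qed.

(** On the Sigma side the loop may be any circle that leaves the contour outside. *)
Lemma double_int_circle (Gamma Sigma : R -> C) (A b : C -> C) (f : C -> C -> C)
    (r M Y : R) (c0 a1 a2 b1 b2 : C) (n : Z) :
  admissible Gamma Sigma -> 0 < r -> (forall t, r < Cmod (Sigma t)) ->
  0 <= M -> tail_ok A M Y -> (forall t, continuous (fun s => A (Sigma s)) t) -> cont_off_0 b ->
  (forall w, w <> RtoC 0 -> b w = (CpowZ w n * Cexp (laurent c0 a1 a2 b1 b2 w))%C) ->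
  (forall w z, w <> RtoC 0 -> z <> RtoC 0 -> w <> z -> f w z = (b w * (A z / (w - z)))%C) ->
  is_CInt (fun s => line_int Sigma (f (Gamma s)) * velocity Gamma s)%C 0 1
    (cauchy_int Sigma A (circle r) (fun s => b (circle r s)) (velocity (circle r))).
Proof.
  intros [HG HS Hd Hw _ _] Hr HSr HM Ht HAc Hbc E Hf.
  destruct (loop_ok_closed_path Sigma Gamma _ HG Hd Hbc) as [P Hl].
  rewrite <- (cauchy_int_loop_change Sigma A M Y (closed_path Gamma)
    (fun s => b (closed_path Gamma s)) (velocity Gamma) _ _ _ P r HS HM Ht HAc Hl).
  - apply (cauchy_int_of_loop Sigma Gamma A b f P M Y HS HM Ht HAc Hl).
    intros s t Hs. apply Hf.
    + now apply (loop_avoids_origin _ HG).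
    + now apply line_neq_0.
    + now apply Hd.
  - now apply (loop_ok_circle Sigma r b).
  - intros t.
    assert (K := loop_cauchy_agree c0 a1 a2 b1 b2 Gamma (circle r) (Sigma t) n HG
      (encircles_origin_circle r Hr) (line_neq_0 _ t HS) (fun s Hs => Hd s t Hs)
      (fun s _ => circle_neq_outside r s _ (Rlt_le _ _ Hr) (HSr t))).
    rewrite Hw, (winding_circle_outside r _ Hr (HSr t)) in K. specialize (K eq_refl).
    transitivity (loop_int Gamma (fun w => b w / (w - Sigma t))%C).
    { rewrite loop_int_clamp. reflexivity. }
    transitivity (loop_int (circle r) (fun w => b w / (w - Sigma t))%C); [|reflexivity].
    rewrite (loop_int_ext Gamma _ (fun w => CpowZ w n * Cexp (laurent c0 a1 a2 b1 b2 w) / (w - Sigma t))%C).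
    2:{ intros s Hs. now rewrite E by now apply (loop_avoids_origin _ HG). }
    rewrite K. apply loop_int_ext. intros s Hs. now rewrite E by now apply circle_neq_0.
Qed.

Lemma sigma_part (Gamma Sigma : R -> C) (r eps mu1 mu2 : R) (x1 x2 : Z) :
  admissible Gamma Sigma -> 0 < r -> (forall t, r < Cmod (Sigma t)) -> 0 < eps < 1 ->
  is_CInt (fun s => line_int Sigma (kernel_integrand eps x1 mu1 x2 mu2 (Gamma s))
                    * velocity Gamma s)%C 0 1 (circle_int Sigma r eps mu1 mu2 x1 x2).
Proof.
  intros Hadm Hr HSr He.
  destruct (tail_ok_scaled_weight eps mu2 (- x2 - 1) He) as [M [Y [HM Ht]]].
  destruct (laurent_loop_factor eps mu1 (proj1 He)) as [c0 [a1 [a2 E]]].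
  apply (double_int_circle Gamma Sigma _ (loop_factor eps mu1 x1) _ r M Y c0 a1 a2 a1 a2 x1
    Hadm Hr HSr HM Ht).
  - intros t. apply continuous_scaled_weight_line; [apply Hadm | apply He].
  - intros w Hw0. apply continuous_loop_factor; [apply He | exact Hw0].
  - intros w Hw0. now apply E.
  - intros w z Hw0 Hz Hwz.
    unfold kernel_integrand. rewrite <- loop_factor_weight by (tauto || exact Hw0).
    rewrite scaled_weight_eq by (tauto || exact Hz).
    rewrite CpowZ_pred, CpowZ_opp by exact Hz.
    assert (K1 := Cminus_eq_contra _ _ Hwz).
    assert (K2 := CpowZ_neq_0 _ x2 Hz).
    assert (K3 : kernel_weight eps mu1 w <> RtoC 0).
    { rewrite kernel_weight_wexp by (tauto || exact Hw0). apply Cexp_neq_0. }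
    field. tauto.
Qed.

(** Inverse part: in the coordinate 1/z it is the Sigma part for -1-x1, -1-x2. *)
Lemma inv_sigma_part (Gamma Sigma : R -> C) (r eps mu1 mu2 : R) (x1 x2 : Z) :
  admissible Gamma Sigma -> 0 < r -> (forall t, r < Cmod (Sigma t)) -> 0 < eps < 1 ->
  is_CInt (fun s => line_int (inv_path Sigma) (kernel_integrand eps x1 mu1 x2 mu2 (Gamma s))
                    * velocity Gamma s)%C 0 1
    (circle_int Sigma r eps mu1 mu2 (- 1 - x1) (- 1 - x2)).
Proof.
  intros [HG HS _ _ Hd Hw] Hr HSr He. unfold inv_path in Hd, Hw.
  assert (Em : (- (- 1 - x2) - 1 = x2)%Z) by lia.
  unfold circle_int. rewrite Em.
  destruct (tail_ok_scaled_weight eps mu2 x2 He) as [M [Y [HM Ht]]].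
  assert (HAc : forall t, continuous (fun s => scaled_weight eps mu2 x2 (Sigma s)) t).
  { intros t. apply continuous_scaled_weight_line; [exact HS | apply He]. }
  assert (Hbc : forall n, cont_off_0 (loop_factor eps mu1 n)).
  { intros n w Hw0. apply continuous_loop_factor; [apply He | exact Hw0]. }
  destruct (closed_path_bounded Gamma Cinv HG) as [P HP].
  { intros z Hz. apply (continuous_Cinv (fun z => z)); [apply continuous_id | exact Hz]. }
  assert (Hc0 : forall s, closed_path Gamma s <> RtoC 0).
  { intros s. apply HG, clamp_in. lra. }
  assert (Hdi : forall s t, 0 <= s <= 1 -> (/ Gamma s)%C <> Sigma t).
  { intros s t Hs E. apply (Hd s t Hs). rewrite <- E.
    assert (H0 := loop_avoids_origin _ HG s Hs). now field. }
  assert (Hl : loop_ok Sigma (fun s => / closed_path Gamma s)%C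
    (fun s => loop_factor eps mu1 (x1 - 1) (closed_path Gamma s)) (velocity Gamma) P).
  { split.
    - intros s. apply continuous_Cinv; [now apply continuous_path_clamp, HG | apply Hc0].
    - intros s. apply (continuous_comp (closed_path Gamma) (loop_factor eps mu1 (x1 - 1))).
      + now apply continuous_path_clamp, HG.
      + apply Hbc, Hc0.
    - now apply pw_cont_velocity, HG.
    - intros s t. apply Hdi, clamp_in. lra.
    - exact HP. }
  assert (Echange : cauchy_int Sigma (scaled_weight eps mu2 x2) (fun s => / closed_path Gamma s)%C
    (fun s => loop_factor eps mu1 (x1 - 1) (closed_path Gamma s)) (velocity Gamma)
    = cauchy_int Sigma (scaled_weight eps mu2 x2) (circle r)
        (fun s => loop_factor eps mu1 (- 1 - x1) (circle r s)) (velocity (circle r))).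
  { apply (cauchy_int_loop_change Sigma _ M Y _ _ _ _ _ _ P r HS HM Ht HAc Hl).
    + now apply loop_ok_circle.
    + intros t.
      destruct (laurent_loop_factor eps mu1 (proj1 He)) as [c0 [a1 [a2 E]]].
      assert (K := loop_cauchy_agree_inv c0 a1 a2 a1 a2 Gamma (circle r) (Sigma t) (x1 - 1) HG
        (encircles_origin_circle r Hr) (line_neq_0 _ t HS) (fun s Hs => Hd s t Hs)
        (fun s _ => circle_neq_outside r s _ (Rlt_le _ _ Hr) (HSr t)) (Hw t)
        (winding_circle_outside r _ Hr (HSr t))).
      transitivity (loop_int Gamma (fun w => loop_factor eps mu1 (x1 - 1) w / (/ w - Sigma t))%C).
      { rewrite loop_int_clamp. reflexivity. }
      transitivity (loop_int (circle r) (fun w => loop_factor eps mu1 (- 1 - x1) w / (w - Sigma t))%C);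
        [|reflexivity].
      rewrite (loop_int_ext Gamma _ (fun w => CpowZ w (x1 - 1) * Cexp (laurent c0 a1 a2 a1 a2 w)
        / (/ w - Sigma t))%C).
      2:{ intros s Hs. now rewrite E by now apply (loop_avoids_origin _ HG). }
      rewrite K. apply loop_int_ext. intros s Hs.
      assert (Hv := circle_neq_0 r s Hr). rewrite E by exact Hv.
      replace (- (x1 - 1) - 2)%Z with (- 1 - x1)%Z by lia.
      do 3 f_equal. unfold laurent. simpl. field. exact Hv. }
  rewrite <- Echange.
  refine (is_CInt_ext _ _ 0 1 _ Rle_0_1 _ (CInt_correct _ _ _
    (ex_cauchy_int Sigma _ _ _ _ P M Y HS HM Ht HAc Hl))).
  intros s Hs. f_equal. symmetry.
  rewrite clamp_id by lra. assert (Hs' : 0 <= s <= 1) by lra.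
  assert (Hw0 := loop_avoids_origin _ HG s Hs').
  pose (b := loop_factor eps mu1 (x1 - 1) (Gamma s)).
  pose (h0 := fun z => (scaled_weight eps mu2 x2 z / (/ Gamma s - z))%C).
  assert (Hb := HP s). cbv beta in Hb. rewrite clamp_id in Hb by lra.
  assert (Hth0 : tail_ok h0 M (Rmax Y (P + 1))).
  { apply tail_ok_cauchy_kernel; auto. now apply (loop_ok_bound_pos _ _ _ _ _ Hl). }
  assert (Hch0 : forall t, continuous (fun s => h0 (Sigma s)) t).
  { intros t. unfold h0. apply (continuous_ext (fun t =>
      scaled_weight eps mu2 x2 (Sigma t) / (/ closed_path Gamma s - Sigma t))%C).
    { intros u. now rewrite clamp_id by lra. }
    apply (continuous_slice (fun s t =>
      scaled_weight eps mu2 x2 (Sigma t) / (/ closed_path Gamma s - Sigma t))%C).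
    now apply (loop_ok_kernel_continuous Sigma _ (fun s => / closed_path Gamma s)%C
      (fun s => loop_factor eps mu1 (x1 - 1) (closed_path Gamma s)) (velocity Gamma) P). }
  transitivity (b * line_int Sigma h0)%C; [|reflexivity].
  rewrite <- (line_int_scal Sigma h0 b M (Rmax Y (P + 1)) HS HM Hth0 Hch0).
  apply (line_int_inv_path Sigma _ (fun z => b * h0 z)%C (Cmod b * M) (Rmax Y (P + 1)) HS).
  + apply Rmult_le_pos; [apply Cmod_ge_0 | exact HM].
  + now apply tail_ok_scal.
  + intros t. apply continuous_Cmult; [apply continuous_const | apply Hch0].
  + intros t. assert (Hz := line_neq_0 _ t HS).
    unfold h0, b, kernel_integrand. rewrite kernel_weight_inv by exact Hz.
    rewrite <- loop_factor_weight by (tauto || exact Hw0).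
    rewrite scaled_weight_eq by (tauto || exact Hz).
    rewrite CpowZ_pred by exact Hw0. rewrite CpowZ_inv, CpowZ_opp by exact Hz.
    assert (K1 := Cminus_eq_contra _ _ (Hdi s t Hs')).
    assert (K4 : kernel_weight eps mu1 (Gamma s) <> RtoC 0).
    { rewrite kernel_weight_wexp by (tauto || exact Hw0). apply Cexp_neq_0. }
    assert (K5 := CpowZ_neq_0 (Sigma t) x2 Hz).
    revert K1 K4 K5 Hz Hw0. generalize (Sigma t), (Gamma s). intros u w K1 K4 K5 Hz Hw0.
    assert (K2 : (w * u - RtoC 1)%C <> RtoC 0).
    { intros E. apply K1. transitivity (- / w * (w * u - RtoC 1))%C;
        [now field | rewrite E; ring]. }
    assert (K3 : (RtoC 1 - u * w)%C <> RtoC 0).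
    { intros E. apply K2. transitivity (- (RtoC 1 - u * w))%C; [ring | rewrite E; ring]. }
    field. tauto.
Qed.

(** ** Scaling *)

Lemma circle_scale (k r s : R) : circle (k * r) s = (RtoC k * circle r s)%C.
Proof. unfold circle. rewrite RtoC_mult. ring. Qed.

Lemma wexp_sym (e mu : R) (z : C) :
  e <> 0 -> z <> RtoC 0 -> wexp e mu (RtoC e * z) = wexp e mu (/ z).
Proof.
  intros He Hz. assert (He0 := RtoC_neq_0 _ He). unfold wexp.
  replace (RtoC e * z + RtoC e / (RtoC e * z))%C with (/ z + RtoC e / / z)%C; [reflexivity|].
  field. split; assumption.
Qed.

(** The line variable is dilated first, while w stays on the circle of radius r;
    then w moves to any circle of radius r' with eps r' <= r. *)
Lemma circle_int_scale (Sg : R -> C) (r r' eps mu1 mu2 : R) (x1 x2 : Z) :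
  from_pioo_to_mioo Sg -> 0 < r -> (forall t, r < Cmod (Sg t)) -> 0 < eps < 1 ->
  0 < r' -> eps * r' <= r ->
  circle_int Sg r eps mu1 mu2 x1 x2
  = cauchy_int Sg (weight (eps ^ 2) mu2 (- x2 - 1)) (fun s => RtoC eps * circle r' s)%C
      (fun s => RtoC (powerRZ eps (x2 + 1)) * loop_factor eps mu1 x1 (circle r' s))%C
      (velocity (circle r')).
Proof.
  intros HS Hr HSr He Hr' Hrr.
  assert (He2 : 0 <= eps ^ 2 <= 1) by nra.
  assert (He0 : RtoC eps <> RtoC 0) by (apply RtoC_neq_0; lra).
  destruct (tail_ok_weight mu2 (- x2 - 1)) as [M [HM Ht']].
  assert (Ht := Ht' _ He2). clear Ht'.
  assert (HAc := fun t => continuous_weight_line Sg (eps ^ 2) mu2 (- x2 - 1) t HS).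
  destruct (tail_ok_scaled_weight eps mu2 (- x2 - 1) He) as [M0 [Y0 [HM0 Ht0]]].
  assert (Hl : forall q, 0 < q -> eps * q <= r ->
    loop_ok Sg (fun s => RtoC eps * circle q s)%C
      (fun s => RtoC (powerRZ eps (x2 + 1)) * loop_factor eps mu1 x1 (circle q s))%C
      (velocity (circle q)) r).
  { intros q Hq Hqr.
    assert (Hmod : forall s, Cmod (RtoC eps * circle q s) <= r).
    { intros s. rewrite Cmod_mult, Cmod_R, Cmod_circle, Rabs_pos_eq; lra. }
    split.
    - intros s. apply continuous_Cmult; [apply continuous_const | apply continuous_circle].
    - intros s. apply continuous_Cmult; [apply continuous_const|].
      apply (continuous_comp (circle q) (loop_factor eps mu1 x1)); [apply continuous_circle|].
      apply continuous_loop_factor; [apply He | now apply circle_neq_0].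
    - apply pw_cont_velocity_circle.
    - intros s t E. assert (K := Hmod s). rewrite E in K. specialize (HSr t). lra.
    - exact Hmod. }
  transitivity (cauchy_int Sg (weight (eps ^ 2) mu2 (- x2 - 1)) (fun s => RtoC eps * circle r s)%C
      (fun s => RtoC (powerRZ eps (x2 + 1)) * loop_factor eps mu1 x1 (circle r s))%C
      (velocity (circle r))).
  - apply CInt_ext; [lra|]. intros s _. apply (f_equal (fun c => c * velocity (circle r) s)%C).
    set (w := circle r s). assert (Hw : Cmod w = r) by (apply Cmod_circle; lra).
    pose (f := fun z => (scaled_weight eps mu2 (- x2 - 1) z / (w - z))%C).
    assert (Hne : forall k t, 1 <= k -> w <> (RtoC k * Sg t)%C).
    { intros k t Hk E. apply (f_equal Cmod) in E.
      rewrite Hw, Cmod_mult, Cmod_R, Rabs_pos_eq in E by lra. specialize (HSr t). nra. }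
    assert (Hk : 1 <= / eps) by (rewrite <- Rinv_1; apply Rinv_le_contravar; lra).
    assert (Ew : line_int Sg f = (RtoC (powerRZ eps (x2 + 1))
      * line_int Sg (fun z => weight (eps ^ 2) mu2 (- x2 - 1) z / (RtoC eps * w - z)))%C).
    { rewrite (line_int_dilate Sg f (fun y =>
        (RtoC (powerRZ eps (- (- x2 - 1))) * (dweight (eps ^ 2) mu2 (- x2 - 1) (RtoC eps * y) * RtoC eps))
          / (w - y) + scaled_weight eps mu2 (- x2 - 1) y / ((w - y) * (w - y)))%C
        M0 (Rmax Y0 (r + 1)) (/ eps) HS HM0 Hk).
      - rewrite <- (line_int_scal Sg _ _ M (Rmax 4 (r + 1)) HS HM).
        + apply line_int_ext. intros t. unfold f, scaled_weight.
          replace (- (- x2 - 1))%Z with (x2 + 1)%Z by lia.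
          replace (RtoC eps * (RtoC (/ eps) * Sg t))%C with (Sg t).
          2:{ rewrite RtoC_inv by lra. field. exact He0. }
          rewrite RtoC_inv by lra.
          assert (K1 := Cminus_eq_contra _ _ (Hne (/ eps) t Hk)). rewrite RtoC_inv in K1 by lra.
          assert (K2 : (RtoC eps * w - Sg t)%C <> RtoC 0).
          { intros E. apply K1. transitivity (/ RtoC eps * (RtoC eps * w - Sg t))%C;
              [now field | rewrite E; ring]. }
          field. tauto.
        + apply tail_ok_cauchy_kernel; [lra | exact Ht|].
          rewrite Cmod_mult, Cmod_R, Hw, Rabs_pos_eq by lra. nra.
        + intros t. assert (Hrr0 : eps * r <= r) by nra.
          apply (continuous_slice (fun s t => weight (eps ^ 2) mu2 (- x2 - 1) (Sg t)
                                     / (RtoC eps * circle r s - Sg t))%C s).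
          apply (loop_ok_kernel_continuous Sg _ _ _ _ r s t HS HAc (Hl r Hr Hrr0)).
      - apply tail_ok_cauchy_kernel; [lra | exact Ht0 | lra].
      - intros k t Hk1.
        assert (Hz : (RtoC k * Sg t)%C <> RtoC 0).
        { apply Cmult_neq_0; [apply RtoC_neq_0; lra | now apply line_neq_0]. }
        split.
        + apply (cderiv_cauchy_kernel (scaled_weight eps mu2 (- x2 - 1))); [|now apply Hne].
          apply cderiv_scaled_weight; [apply He | exact Hz].
        + apply (continuous_cauchy_kernel_deriv (scaled_weight eps mu2 (- x2 - 1))
            (fun y => RtoC (powerRZ eps (- (- x2 - 1))) * (dweight (eps ^ 2) mu2 (- x2 - 1) (RtoC eps * y) * RtoC eps))%C).
          * apply (deriv_continuous (X := C_UniformSpace) _ _ _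
              (cderiv_scaled_weight eps mu2 (- x2 - 1) _ (proj1 He) Hz)).
          * apply continuous_scaled_weight_deriv; [apply He | exact Hz].
          * now apply Hne. }
    unfold f in Ew. rewrite Ew. ring.
  - assert (Hrr0 : eps * r <= r) by nra.
    apply (cauchy_int_loop_change Sg _ M 4 _ _ _ _ _ _ r r HS HM Ht HAc (Hl r Hr Hrr0) (Hl r' Hr' Hrr)).
    intros t. destruct (laurent_loop_factor eps mu1 (proj1 He)) as [c0 [a1 [a2 E]]].
    set (u := (/ RtoC eps * Sg t)%C).
    assert (Hu : u <> RtoC 0).
    { apply Cmult_neq_0; [now apply Cinv_neq_0 | now apply line_neq_0]. }
    assert (Hmu : Cmod u = Cmod (Sg t) / eps).
    { unfold u. rewrite Cmod_mult, Cmod_inv, Cmod_R, Rabs_pos_eq by (lra || exact He0).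
      unfold Rdiv. ring. }
    assert (Hout : forall q, 0 < q -> eps * q <= r -> q < Cmod u).
    { intros q Hq Hqr. rewrite Hmu. apply Rmult_lt_reg_r with eps; [apply He|].
      unfold Rdiv. rewrite Rmult_assoc, Rinv_l by lra. specialize (HSr t). lra. }
    assert (Hloop : forall q, 0 < q -> eps * q <= r ->
      CInt (fun s => RtoC (powerRZ eps (x2 + 1)) * loop_factor eps mu1 x1 (circle q s)
              / (RtoC eps * circle q s - Sg t) * velocity (circle q) s)%C 0 1
      = (RtoC (powerRZ eps (x2 + 1)) / RtoC eps *
          loop_int (circle q) (fun w => CpowZ w x1 * Cexp (laurent c0 a1 a2 a1 a2 w) / (w - u)))%C).
    { intros q Hq Hqr. apply is_CInt_unique.
      apply (is_CInt_ext (fun s => RtoC (powerRZ eps (x2 + 1)) / RtoC eps *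
        (CpowZ (circle q s) x1 * Cexp (laurent c0 a1 a2 a1 a2 (circle q s)) / (circle q s - u)
         * velocity (circle q) s))%C); [lra| |].
      - intros s _. rewrite E by now apply circle_neq_0.
        assert (K1 := Cminus_eq_contra _ _ (circle_neq_outside q s u (Rlt_le _ _ Hq) (Hout q Hq Hqr))).
        assert (Eu : (RtoC eps * circle q s - Sg t)%C = (RtoC eps * (circle q s - u))%C).
        { unfold u. field. exact He0. }
        rewrite Eu. field. split; assumption.
      - apply is_CInt_Cmult.
        apply (is_loop_int (circle q) (fun w => CpowZ w x1 * Cexp (laurent c0 a1 a2 a1 a2 w) / (w - u))%C).
        + now apply encircles_origin_circle.
        + intros s _. assert (Hc0 := circle_neq_0 q s Hq). apply continuous_Cdiv.
          * apply continuous_Cmult; [now apply cont_off_0_CpowZ|].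
            now apply continuous_Cexp, cont_off_0_laurent.
          * apply continuous_Cminus; [apply continuous_id | apply continuous_const].
          * apply Cminus_eq_contra, circle_neq_outside; [lra | now apply Hout]. }
    rewrite (Hloop r Hr Hrr0), (Hloop r' Hr' Hrr). f_equal.
    apply (loop_cauchy_agree c0 a1 a2 a1 a2 (circle r) (circle r') u x1).
    + now apply encircles_origin_circle.
    + now apply encircles_origin_circle.
    + exact Hu.
    + intros s _. apply circle_neq_outside; [lra | now apply Hout].
    + intros s _. apply circle_neq_outside; [lra | now apply Hout].
    + rewrite !winding_circle_outside; auto.
Qed.

Lemma circle_int_outer (Sg : R -> C) (r eps mu1 mu2 : R) (x1 x2 : Z) :
  from_pioo_to_mioo Sg -> 0 < r -> (forall t, r < Cmod (Sg t)) -> 0 < eps < 1 ->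
  circle_int Sg r eps mu1 mu2 x1 x2
  = (RtoC (powerRZ eps (x2 - x1)) * outer_int Sg r (eps ^ 2) mu1 mu2 x1 x2)%C.
Proof.
  intros HS Hr HSr He.
  assert (He2 : 0 <= eps ^ 2 <= 1) by nra.
  assert (He0 : RtoC eps <> RtoC 0) by (apply RtoC_neq_0; lra).
  destruct (tail_ok_weight mu2 (- x2 - 1)) as [M [HM Ht]].
  assert (Hi : 0 < / eps) by (apply Rinv_0_lt_compat; lra).
  assert (Hir : eps * (/ eps * r) = r) by (field; lra).
  rewrite (circle_int_scale Sg r (/ eps * r)) by (auto; nra).
  unfold outer_int.
  apply (cauchy_int_const Sg _ _ _ _ (circle r) _ _ _ r M 4 HS HM (Ht _ He2)).
  - intros t. now apply continuous_weight_line.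
  - apply (loop_ok_circle Sg r (fun v => CpowZ v x1 * Cexp (- wexp (eps ^ 2) mu1 v))%C Hr HSr).
    intros v Hv. apply continuous_Cmult; [now apply cont_off_0_CpowZ|].
    apply continuous_Cexp, continuous_Copp.
    apply (continuous_wexp (fun _ => eps ^ 2) (fun v => v)); [apply continuous_const | apply continuous_id | exact Hv].
  - intros s. rewrite circle_scale, RtoC_inv by lra. field. exact He0.
  - intros s. rewrite !velocity_circle, circle_scale. unfold loop_factor.
    assert (Hv := circle_neq_0 r s Hr). set (v := circle r s) in *.
    replace (RtoC eps * (RtoC (/ eps) * v))%C with v.
    2:{ rewrite RtoC_inv by lra. field. exact He0. }
    rewrite CpowZ_mult by (try exact Hv; apply RtoC_neq_0; lra).
    rewrite RtoC_inv by lra. rewrite CpowZ_inv by exact He0.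
    rewrite <- !CpowZ_RtoC by lra.
    replace (x2 - x1)%Z with (x2 + 1 + - x1 - 1)%Z by lia.
    rewrite (CpowZ_pred _ (x2 + 1 + - x1)), (CpowZ_add _ (x2 + 1)) by exact He0. ring.
Qed.

Lemma circle_int_inner (Sg : R -> C) (r eps mu1 mu2 : R) (x1 x2 : Z) :
  from_pioo_to_mioo Sg -> 0 < r -> (forall t, r < Cmod (Sg t)) -> 0 < eps < 1 ->
  circle_int Sg r eps mu1 mu2 x1 x2
  = (RtoC (powerRZ eps (x1 + x2 + 2)) * inner_int Sg r (eps ^ 2) mu1 mu2 x1 x2)%C.
Proof.
  intros HS Hr HSr He.
  assert (He2 : 0 < eps ^ 2 <= 1) by nra.
  assert (He2' : 0 <= eps ^ 2 <= 1) by lra.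
  assert (He0 : RtoC eps <> RtoC 0) by (apply RtoC_neq_0; lra).
  assert (E2 : RtoC (eps ^ 2) = (RtoC eps * RtoC eps)%C) by (rewrite <- RtoC_mult; f_equal; ring).
  destruct (tail_ok_weight mu2 (- x2 - 1)) as [M [HM Ht]].
  rewrite (circle_int_scale Sg r (eps * r)) by (auto; nra).
  unfold inner_int.
  assert (Hmod : forall s, Cmod (RtoC (eps ^ 2) * circle r s) <= r).
  { intros s. rewrite Cmod_mult, Cmod_R, Cmod_circle, Rabs_pos_eq by lra. nra. }
  apply (cauchy_int_const Sg _ _ _ _ (fun s => RtoC (eps ^ 2) * circle r s)%C _ _ _ r M 4 HS HM (Ht _ He2')).
  - intros t. now apply continuous_weight_line.
  - split.
    + intros s. apply continuous_Cmult; [apply continuous_const | apply continuous_circle].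
    + intros s. assert (Hv := circle_neq_0 r s Hr).
      apply continuous_Cmult; [apply continuous_CpowZ; [apply continuous_circle | exact Hv]|].
      apply continuous_Cexp, continuous_Copp.
      apply (continuous_wexp (fun _ => eps ^ 2) (fun s => / circle r s)%C); [apply continuous_const | |].
      * apply continuous_Cinv; [apply continuous_circle | exact Hv].
      * now apply Cinv_neq_0.
    + apply pw_cont_velocity_circle.
    + intros s t E. assert (K := Hmod s). rewrite E in K. specialize (HSr t). lra.
    + exact Hmod.
  - intros s. rewrite circle_scale, E2. ring.
  - intros s. rewrite !velocity_circle, circle_scale. unfold loop_factor.
    assert (Hv := circle_neq_0 r s Hr). set (v := circle r s) in *.
    rewrite <- (wexp_sym (eps ^ 2) mu1 v) by (lra || exact Hv).
    rewrite E2, CpowZ_mult by assumption.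
    replace (RtoC eps * RtoC eps * v)%C with (RtoC eps * (RtoC eps * v))%C by ring.
    rewrite <- !CpowZ_RtoC by lra.
    replace (x1 + x2 + 2)%Z with (x2 + 1 + x1 + 1)%Z by lia.
    rewrite (CpowZ_succ _ (x2 + 1 + x1)), (CpowZ_add _ (x2 + 1)) by exact He0. ring.
Qed.

Lemma limit_part (Gamma Sigma : R -> C) (f : C -> C -> C) (r mu1 mu2 : R) (y1 y2 : Z) :
  admissible Gamma Sigma -> 0 < r -> (forall t, r < Cmod (Sigma t)) ->
  (forall w z, w <> RtoC 0 -> z <> RtoC 0 -> w <> z ->
     f w z = (CpowZ w y1 / gauss_weight mu1 w * (gauss_weight mu2 z * CpowZ z (- y2 - 1) / (w - z)))%C) ->
  loop_int Gamma (fun w => line_int Sigma (f w)) = outer_int Sigma r 0 mu1 mu2 y1 y2.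
Proof.
  intros Hadm Hr HSr Hf. assert (HS := adm_line _ _ Hadm).
  assert (Hg : forall mu z, gauss_weight mu z = Cexp (wexp 0 mu z)).
  { intros mu z. unfold gauss_weight, wexp. f_equal.
    replace (z + RtoC 0 / z)%C with z by (unfold Cdiv; ring). reflexivity. }
  assert (H01 : 0 <= 0 <= 1) by lra.
  destruct (tail_ok_weight mu2 (- y2 - 1)) as [M [HM Ht]].
  rewrite loop_int_CInt. apply is_CInt_unique.
  apply (double_int_circle Gamma Sigma (weight 0 mu2 (- y2 - 1))
    (fun w => CpowZ w y1 * Cexp (- wexp 0 mu1 w))%C f r M 4 (- RtoC 0) (- RtoC mu1) (- RtoC (1 / 2))
    (- (RtoC mu1 * RtoC 0)) (- (RtoC (1 / 2) * (RtoC 0 * RtoC 0))) y1 Hadm Hr HSr HM (Ht _ H01)).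
  - intros t. now apply continuous_weight_line.
  - intros v Hv. apply continuous_Cmult; [now apply cont_off_0_CpowZ|].
    apply continuous_Cexp, continuous_Copp.
    apply (continuous_wexp (fun _ => 0) (fun v => v)); [apply continuous_const | apply continuous_id | exact Hv].
  - intros w Hw. now rewrite laurent_wexp.
  - intros w z Hw Hz Hwz. rewrite (Hf w z Hw Hz Hwz).
    unfold weight. rewrite !Hg, Cexp_opp. reflexivity.
Qed.

(** * The single integral *)

Definition single_int (e d : R) (n : Z) : C :=
  loop_int (circle 1) (fun v => CpowZ v (n - 1) * Cexp (RtoC d * (v + RtoC e / v)))%C.

Lemma laurent_single (a b w : C) :
  w <> RtoC 0 -> (a * w + b / w)%C = laurent (RtoC 0) a (RtoC 0) b (RtoC 0) w.
Proof. intros Hw. unfold laurent. simpl. field. exact Hw. Qed.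

Lemma single_scale (eps d : R) (n : Z) :
  0 < eps ->
  loop_int (circle (/ eps)) (fun w => CpowZ w (n - 1) * Cexp (RtoC (eps * d) * (w + / w)))%C
  = (RtoC (powerRZ eps (- n)) * single_int (eps ^ 2) d n)%C.
Proof.
  intros He. assert (He0 : RtoC eps <> RtoC 0) by (apply RtoC_neq_0; lra).
  assert (E2 : RtoC (eps ^ 2) = (RtoC eps * RtoC eps)%C) by (rewrite <- RtoC_mult; f_equal; ring).
  rewrite loop_int_CInt. apply is_CInt_unique.
  apply (is_CInt_ext (fun s => RtoC (powerRZ eps (- n)) * (CpowZ (circle 1 s) (n - 1)
    * Cexp (RtoC d * (circle 1 s + RtoC (eps ^ 2) / circle 1 s)) * velocity (circle 1) s))%C); [lra| |].
  - intros s _. rewrite !velocity_circle. rewrite <- (Rmult_1_r (/ eps)), circle_scale.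
    assert (Hv := circle_neq_0 1 s Rlt_0_1). set (v := circle 1 s) in *.
    rewrite RtoC_inv by lra. rewrite CpowZ_mult by (auto using Cinv_neq_0).
    rewrite CpowZ_inv by exact He0.
    replace (RtoC (eps * d) * (/ RtoC eps * v + / (/ RtoC eps * v)))%C
      with (RtoC d * (v + RtoC (eps ^ 2) / v))%C.
    2:{ rewrite E2, RtoC_mult. field. split; assumption. }
    rewrite <- CpowZ_RtoC by lra. replace (- (n - 1))%Z with (- n + 1)%Z by lia.
    rewrite CpowZ_succ by exact He0. field. exact He0.
  - apply is_CInt_Cmult.
    apply (is_loop_int (circle 1) (fun v => CpowZ v (n - 1)
             * Cexp (RtoC d * (v + RtoC (eps ^ 2) / v)))%C).
    + apply encircles_origin_circle, Rlt_0_1.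
    + intros s _. assert (Hv := circle_neq_0 1 s Rlt_0_1).
      apply continuous_Cmult; [now apply cont_off_0_CpowZ|]. apply continuous_Cexp.
      apply continuous_Cmult; [apply continuous_const|].
      apply continuous_Cplus; [apply continuous_id|].
      apply continuous_Cdiv; [apply continuous_const | apply continuous_id | exact Hv].
Qed.

Lemma single_part (Gamma : R -> C) (eps d : R) (n : Z) :
  encircles_origin Gamma -> 0 < eps ->
  loop_int Gamma (fun w => Cexp (RtoC (eps * d) * (w + / w)) * CpowZ w (n - 1))%C
  = (RtoC (powerRZ eps (- n)) * single_int (eps ^ 2) d n)%C.
Proof.
  intros HG He. rewrite <- single_scale by exact He.
  assert (Hr : 0 < / eps) by (apply Rinv_0_lt_compat; lra).
  assert (HC := encircles_origin_circle _ Hr).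
  set (a := RtoC (eps * d)).
  assert (E : forall G, encircles_origin G -> forall s, 0 <= s <= 1 ->
    (a * (G s + / G s))%C = laurent (RtoC 0) a (RtoC 0) a (RtoC 0) (G s)).
  { intros G HG' s Hs. assert (H0 := loop_avoids_origin _ HG' s Hs).
    rewrite <- laurent_single by exact H0. field. exact H0. }
  rewrite (loop_int_ext Gamma _ (fun w => CpowZ w (n - 1)
    * Cexp (laurent (RtoC 0) a (RtoC 0) a (RtoC 0) w))%C).
  2:{ intros s Hs. rewrite (E Gamma HG s Hs). ring. }
  rewrite (loop_agree _ _ _ _ _ Gamma (circle (/ eps)) (n - 1) HG HC).
  apply loop_int_ext. intros s Hs. now rewrite (E _ HC s Hs).
Qed.

Lemma single_part_inv (Gamma : R -> C) (eps d : R) (n : Z) :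
  encircles_origin Gamma -> 0 < eps ->
  loop_int Gamma (fun w => Cexp (RtoC (eps * d) * (w + / w)) * CpowZ w (n - 1))%C
  = (RtoC (powerRZ eps n) * single_int (eps ^ 2) d (- n))%C.
Proof.
  intros HG He. replace (powerRZ eps n) with (powerRZ eps (- - n)) by (f_equal; lia).
  rewrite <- single_scale by exact He.
  assert (Hr : 0 < / eps) by (apply Rinv_0_lt_compat; lra).
  assert (HC := encircles_origin_circle _ Hr).
  set (a := RtoC (eps * d)).
  assert (E : forall w, w <> RtoC 0 ->
    (a * (w + / w))%C = laurent (RtoC 0) a (RtoC 0) a (RtoC 0) w).
  { intros w H0. rewrite <- laurent_single by exact H0. field. exact H0. }
  rewrite (loop_int_ext Gamma _ (fun w => CpowZ w (n - 1)
    * Cexp (laurent (RtoC 0) a (RtoC 0) a (RtoC 0) w))%C).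
  2:{ intros s Hs. rewrite E by now apply (loop_avoids_origin _ HG). ring. }
  rewrite (loop_agree_inv _ _ _ _ _ Gamma (circle (/ eps)) (n - 1) HG HC).
  apply loop_int_ext. intros s Hs. assert (Hv := circle_neq_0 _ s Hr).
  rewrite <- E by now apply Cinv_neq_0.
  replace (- (n - 1) - 2)%Z with (- n - 1)%Z by lia.
  do 3 f_equal. field. exact Hv.
Qed.

Lemma continuous_single_int (d : R) (n : Z) :
  continuous (fun x => single_int (clamp 0 1 x) d n) 0.
Proof.
  assert (Hci : forall q : R * R, continuous (fun q : R * R => circle 1 (snd q)) q).
  { intros q. apply (continuous_comp snd (circle 1)); [apply continuous_snd | apply continuous_circle]. }
  apply (continuous_CInt_param (fun x s => CpowZ (circle 1 s) (n - 1)
    * Cexp (RtoC d * (circle 1 s + RtoC (clamp 0 1 x) / circle 1 s)))%C); [apply pw_cont_velocity_circle|].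
  intros x s. assert (Hv := circle_neq_0 1 s Rlt_0_1).
  apply continuous_Cmult; [apply continuous_CpowZ; [apply Hci | exact Hv]|].
  apply continuous_Cexp, continuous_Cmult; [apply continuous_const|].
  apply continuous_Cplus; [apply Hci|]. apply continuous_Cdiv; [|apply Hci | exact Hv].
  apply continuous_RtoC, (continuous_clamp 0 1 fst), continuous_fst.
Qed.

Lemma single_int_0 (d : R) (n : Z) :
  single_int 0 d n = (two_pi_i * RtoC (chi (Z_le_dec n 0) * divided_power d (- n)))%C.
Proof.
  rewrite <- (loop_exp_residue (circle 1)) by apply encircles_origin_circle, Rlt_0_1.
  unfold single_int. apply loop_int_ext. intros s _. do 2 f_equal. unfold Cdiv. ring.
Qed.

(** * The limits *)

Definition tends_0 (f : R -> C) (l : C) : Prop :=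
  forall e, 0 < e -> at_right 0 (fun x => Cmod (f x - l) <= e).

Lemma tends_0_filterlim (f : R -> C) (l : C) :
  tends_0 f l -> filterlim f (at_right 0) (locally l).
Proof.
  intros H P HP. apply locally_Cmod in HP. destruct HP as [d [Hd HP]].
  assert (Hd2 : 0 < d / 2) by lra. specialize (H _ Hd2).
  change (at_right 0 (fun x => P (f x))). revert H. apply filter_imp.
  intros x Hx. apply HP. lra.
Qed.

Lemma at_right_unit : at_right 0 (fun x => 0 < x < 1).
Proof.
  exists (mkposreal 1 Rlt_0_1). intros x Hx Hx0. change (Rabs (x - 0) < 1) in Hx.
  apply Rabs_def2 in Hx. lra.
Qed.

Lemma tends_0_ext (f g : R -> C) (l : C) :
  (forall x, 0 < x < 1 -> f x = g x) -> tends_0 f l -> tends_0 g l.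
Proof.
  intros E H e He. generalize (filter_and _ _ at_right_unit (H e He)). apply filter_imp.
  intros x [Hx K]. now rewrite <- E.
Qed.

Lemma tends_0_plus (f g : R -> C) (l m : C) :
  tends_0 f l -> tends_0 g m -> tends_0 (fun x => f x + g x)%C (l + m)%C.
Proof.
  intros Hf Hg e He. assert (He2 : 0 < e / 2) by lra.
  generalize (filter_and _ _ (Hf _ He2) (Hg _ He2)). apply filter_imp. intros x [K1 K2].
  replace (f x + g x - (l + m))%C with ((f x - l) + (g x - m))%C by ring.
  eapply Rle_trans; [apply Cmod_triangle|]. lra.
Qed.

Lemma tends_0_scal (f : R -> C) (c l : C) :
  tends_0 f l -> tends_0 (fun x => c * f x)%C (c * l)%C.
Proof.
  intros Hf e He. assert (Hc := Cmod_ge_0 c).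
  assert (He' : 0 < e / (Cmod c + 1)) by (apply Rdiv_lt_0_compat; lra).
  generalize (Hf _ He'). apply filter_imp. intros x Hx.
  replace (c * f x - c * l)%C with (c * (f x - l))%C by ring. rewrite Cmod_mult.
  apply Rle_trans with ((Cmod c + 1) * (e / (Cmod c + 1))).
  - apply Rmult_le_compat; try apply Cmod_ge_0; lra.
  - right. field. lra.
Qed.

Lemma tends_0_vanish (f : R -> C) (l : C) (k : Z) :
  (1 <= k)%Z -> tends_0 f l -> tends_0 (fun x => RtoC (powerRZ x k) * f x)%C (RtoC 0).
Proof.
  intros Hk Hf e He. assert (Hc := Cmod_ge_0 l).
  assert (Hd : 0 < e / (Cmod l + 1)) by (apply Rdiv_lt_0_compat; lra).
  assert (Hsmall : at_right 0 (fun x => 0 < x < e / (Cmod l + 1))).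
  { exists (mkposreal _ Hd). intros x Hx Hx0. change (Rabs (x - 0) < e / (Cmod l + 1)) in Hx.
    apply Rabs_def2 in Hx. lra. }
  generalize (filter_and _ _ (Hf 1 Rlt_0_1) (filter_and _ _ at_right_unit Hsmall)).
  apply filter_imp. intros x [K1 [K2 K3]].
  replace (RtoC (powerRZ x k) * f x - RtoC 0)%C with (RtoC (powerRZ x k) * f x)%C by ring.
  rewrite Cmod_mult, Cmod_R.
  assert (Hp : 0 <= powerRZ x k <= x).
  { replace k with (Z.of_nat (S (Z.to_nat (k - 1)))) by lia. rewrite <- pow_powerRZ.
    assert (H0 : 0 <= x ^ Z.to_nat (k - 1)) by (apply pow_le; lra).
    assert (H1 : x ^ Z.to_nat (k - 1) <= 1) by (rewrite <- (pow1 (Z.to_nat (k - 1))); apply pow_incr; lra).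
    simpl. nra. }
  rewrite Rabs_pos_eq by lra.
  assert (Hfx : Cmod (f x) <= Cmod l + 1).
  { replace (f x) with ((f x - l) + l)%C by ring.
    eapply Rle_trans; [apply Cmod_triangle|]. lra. }
  apply Rle_trans with (e / (Cmod l + 1) * (Cmod l + 1)).
  - apply Rmult_le_compat; try lra. apply Cmod_ge_0.
  - right. field. lra.
Qed.

Lemma tends_0_sqr (F : R -> C) :
  continuous (fun x => F (clamp 0 1 x)) 0 -> tends_0 (fun x => F (x ^ 2)) (F 0).
Proof.
  intros HF.
  assert (Hc : continuous (fun x => F (clamp 0 1 (x ^ 2))) 0).
  { apply (continuous_comp (fun x => x ^ 2) (fun x => F (clamp 0 1 x))).
    - apply (continuous_Rmul (fun x => x)); [apply continuous_id|].
      apply (continuous_Rmul (fun x => x)); [apply continuous_id | apply continuous_const].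
    - replace (0 ^ 2) with 0 by ring. exact HF. }
  apply (tends_0_ext (fun x => F (clamp 0 1 (x ^ 2)))).
  { intros x Hx. rewrite clamp_id; [reflexivity | nra]. }
  intros e He. assert (K := continuous_Cmod_elim _ _ _ Hc He). cbv beta in K.
  replace (0 ^ 2) with 0 in K by ring. rewrite (clamp_id 0 1 0) in K by lra.
  unfold at_right, within. revert K. apply filter_imp. intros x Hx _. lra.
Qed.

(** ** Decomposition of the kernel *)

Lemma kernel_split (Gamma Sigma : R -> C) (r eps mu1 mu2 : R) (x1 x2 : Z) :
  admissible Gamma Sigma -> 0 < r -> (forall t, r < Cmod (Sigma t)) -> 0 < eps < 1 ->
  kernel Gamma Sigma eps x1 mu1 x2 mu2
  = (- (RtoC (chi (Rlt_dec mu1 mu2)) / two_pi_i)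
      * loop_int Gamma (fun w => Cexp (RtoC (eps * (mu2 - mu1)) * (w + / w)) * CpowZ w (x1 - x2 - 1))
     + / two_pi_i ^ 2 * (circle_int Sigma r eps mu1 mu2 x1 x2
                         + circle_int Sigma r eps mu1 mu2 (- 1 - x1) (- 1 - x2)))%C.
Proof.
  intros Hadm Hr HSr He. unfold kernel. do 2 f_equal.
  rewrite loop_int_CInt. apply is_CInt_unique.
  assert (H1 := sigma_part Gamma Sigma r eps mu1 mu2 x1 x2 Hadm Hr HSr He).
  assert (H2 := inv_sigma_part Gamma Sigma r eps mu1 mu2 x1 x2 Hadm Hr HSr He).
  refine (is_CInt_ext _ _ 0 1 _ Rle_0_1 _ (is_CInt_plus _ _ 0 1 _ _ H1 H2)).
  intros s _. cbv beta. ring.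
Qed.

(** Stated for arbitrary representations of the three terms: the cases of the
    theorem differ in the choice between the two available for each term. *)
Lemma kernel_limit (Gamma Sigma : R -> C) (mu1 mu2 : R) (x1 x2 g k0 k1 k2 : Z)
    (r : R) (F0 F1 F2 : R -> C) (l0 l1 l2 : C) :
  admissible Gamma Sigma -> 0 < r -> (forall t, r < Cmod (Sigma t)) ->
  (forall eps, 0 < eps < 1 ->
     loop_int Gamma (fun w => Cexp (RtoC (eps * (mu2 - mu1)) * (w + / w)) * CpowZ w (x1 - x2 - 1))%C
       = (RtoC (powerRZ eps k0) * F0 eps)%C) ->
  (forall eps, 0 < eps < 1 ->
     circle_int Sigma r eps mu1 mu2 x1 x2 = (RtoC (powerRZ eps k1) * F1 eps)%C) ->
  (forall eps, 0 < eps < 1 ->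
     circle_int Sigma r eps mu1 mu2 (- 1 - x1) (- 1 - x2) = (RtoC (powerRZ eps k2) * F2 eps)%C) ->
  tends_0 (fun eps => RtoC (powerRZ eps (g + k0)) * F0 eps)%C l0 ->
  tends_0 (fun eps => RtoC (powerRZ eps (g + k1)) * F1 eps)%C l1 ->
  tends_0 (fun eps => RtoC (powerRZ eps (g + k2)) * F2 eps)%C l2 ->
  filterlim (fun eps => RtoC (powerRZ eps g) * kernel Gamma Sigma eps x1 mu1 x2 mu2)%C
    (at_right 0)
    (locally (- (RtoC (chi (Rlt_dec mu1 mu2)) / two_pi_i) * l0 + / two_pi_i ^ 2 * (l1 + l2))%C).
Proof.
  intros Hadm Hr HSr E0 E1 E2 L0 L1 L2. apply tends_0_filterlim.
  assert (L := tends_0_plus _ _ _ _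
    (tends_0_scal _ (- (RtoC (chi (Rlt_dec mu1 mu2)) / two_pi_i))%C _ L0)
    (tends_0_scal _ (/ two_pi_i ^ 2)%C _ (tends_0_plus _ _ _ _ L1 L2))).
  revert L. apply tends_0_ext. intros eps He.
  rewrite (kernel_split Gamma Sigma r) by assumption.
  rewrite E0, E1, E2 by exact He.
  rewrite !powerRZ_add, !RtoC_mult by lra. ring.
Qed.

Lemma tends_0_powerRZ_0 (F : R -> C) (l : C) (k : Z) :
  k = 0%Z -> tends_0 F l -> tends_0 (fun x => RtoC (powerRZ x k) * F x)%C l.
Proof.
  intros -> H. apply (tends_0_ext F); [|exact H]. intros x _. simpl. ring.
Qed.

(** * The theorem *)

Theorem theorem2p7 (Gamma Sigma : R -> C) (Hadm : admissible Gamma Sigma)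
    (mu1 mu2 : R) (x1 x2 : Z) :
  ((x1 < 0)%Z -> (x2 < 0)%Z ->
   filterlim
     (fun eps : R =>
        (RtoC (powerRZ eps (x1 - x2)) * kernel Gamma Sigma eps x1 mu1 x2 mu2)%C)
     (at_right 0) (locally (limit_neg Gamma Sigma x1 mu1 x2 mu2)))
  /\
  ((0 <= x1)%Z -> (0 <= x2)%Z ->
   filterlim
     (fun eps : R =>
        (RtoC (powerRZ eps (x2 - x1)) * kernel Gamma Sigma eps x1 mu1 x2 mu2)%C)
     (at_right 0) (locally (limit_nonneg Gamma Sigma x1 mu1 x2 mu2)))
  /\
  (~ ((x1 < 0)%Z /\ (x2 < 0)%Z) -> ~ ((0 <= x1)%Z /\ (0 <= x2)%Z) ->
   filterlim
     (fun eps : R =>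
        (RtoC (powerRZ eps (gauge x1 - gauge x2))
         * kernel Gamma Sigma eps x1 mu1 x2 mu2)%C)
     (at_right 0) (locally (RtoC 0))).
Proof.
  assert (HG := adm_loop _ _ Hadm). assert (HS := adm_line _ _ Hadm).
  destruct (line_away_from_0 Sigma HS) as [r [Hr HSr]].
  assert (Hout : forall y1 y2, tends_0 (fun eps => outer_int Sigma r (eps ^ 2) mu1 mu2 y1 y2)
            (outer_int Sigma r 0 mu1 mu2 y1 y2)).
  { intros y1 y2. apply (tends_0_sqr (fun e => outer_int Sigma r e mu1 mu2 y1 y2)).
    now apply continuous_outer_int. }
  assert (Hinn : forall y1 y2, tends_0 (fun eps => inner_int Sigma r (eps ^ 2) mu1 mu2 y1 y2)
            (inner_int Sigma r 0 mu1 mu2 y1 y2)).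
  { intros y1 y2. apply (tends_0_sqr (fun e => inner_int Sigma r e mu1 mu2 y1 y2)).
    now apply continuous_inner_int. }
  assert (Hsin : forall n, tends_0 (fun eps => single_int (eps ^ 2) (mu2 - mu1) n)
            (single_int 0 (mu2 - mu1) n)).
  { intros n. apply (tends_0_sqr (fun e => single_int e (mu2 - mu1) n)).
    apply continuous_single_int. }
  assert (Es : forall eps, 0 < eps < 1 -> _ ) by
    exact (fun eps He => single_part Gamma eps (mu2 - mu1) (x1 - x2) HG (proj1 He)).
  assert (Esi : forall eps, 0 < eps < 1 -> _ ) by
    exact (fun eps He => single_part_inv Gamma eps (mu2 - mu1) (x1 - x2) HG (proj1 He)).
  assert (Eo : forall y1 y2 eps, 0 < eps < 1 -> _ ) by
    exact (fun y1 y2 eps He => circle_int_outer Sigma r eps mu1 mu2 y1 y2 HS Hr HSr He).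
  assert (Ei : forall y1 y2 eps, 0 < eps < 1 -> _ ) by
    exact (fun y1 y2 eps He => circle_int_inner Sigma r eps mu1 mu2 y1 y2 HS Hr HSr He).
  assert (H2pi := two_pi_i_neq_0).
  split; [|split].
  - intros H1 H2.
    (* The Sigma part on the large circle has exponent 0; the inverse part, on the
       small circle, has exponent -2 x2 > 0. *)
    replace (limit_neg Gamma Sigma x1 mu1 x2 mu2)
      with (- (RtoC (chi (Rlt_dec mu1 mu2)) / two_pi_i) * single_int 0 (mu2 - mu1) (x1 - x2)
            + / two_pi_i ^ 2 * (outer_int Sigma r 0 mu1 mu2 x1 x2 + RtoC 0))%C.
    + eapply (kernel_limit Gamma Sigma mu1 mu2 x1 x2 _ _ _ _ r).
      * exact Hadm.
      * exact Hr.
      * exact HSr.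
      * exact Es.
      * exact (Eo x1 x2).
      * exact (Ei (- 1 - x1) (- 1 - x2))%Z.
      * apply tends_0_powerRZ_0; [lia | apply Hsin].
      * apply tends_0_powerRZ_0; [lia | apply Hout].
      * eapply tends_0_vanish; [lia | apply Hinn].
    + unfold limit_neg. rewrite (limit_part Gamma Sigma _ r mu1 mu2 x1 x2 Hadm Hr HSr).
      2:{ intros w z Hw Hz Hwz. rewrite CpowZ_pred, CpowZ_opp, CpowZ_succ by exact Hz.
          assert (K1 := Cminus_eq_contra _ _ Hwz). assert (K2 := CpowZ_neq_0 z x2 Hz).
          assert (K3 : gauss_weight mu1 w <> RtoC 0) by apply Cexp_neq_0.
          field. tauto. }
      rewrite single_int_0. f_equal; [|ring].
      replace (chi (Z_le_dec (x1 - x2) 0)) with (chi (Z_le_dec x1 x2))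
        by (unfold chi; destruct (Z_le_dec (x1 - x2) 0), (Z_le_dec x1 x2); lia || reflexivity).
      replace (- (x1 - x2))%Z with (x2 - x1)%Z by lia.
      rewrite !RtoC_mult. field. exact H2pi.
  - intros H1 H2.
    (* The roles are exchanged: the Sigma part on the small circle has exponent
       2 x2 + 2 > 0, the inverse part on the large circle has exponent 0. *)
    replace (limit_nonneg Gamma Sigma x1 mu1 x2 mu2)
      with (- (RtoC (chi (Rlt_dec mu1 mu2)) / two_pi_i) * single_int 0 (mu2 - mu1) (- (x1 - x2))
            + / two_pi_i ^ 2 * (RtoC 0 + outer_int Sigma r 0 mu1 mu2 (- 1 - x1) (- 1 - x2)))%C.
    + eapply (kernel_limit Gamma Sigma mu1 mu2 x1 x2 _ _ _ _ r).
      * exact Hadm.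
      * exact Hr.
      * exact HSr.
      * exact Esi.
      * exact (Ei x1 x2).
      * exact (Eo (- 1 - x1) (- 1 - x2))%Z.
      * apply tends_0_powerRZ_0; [lia | apply Hsin].
      * eapply tends_0_vanish; [lia | apply Hinn].
      * apply tends_0_powerRZ_0; [lia | apply Hout].
    + unfold limit_nonneg.
      rewrite (limit_part Gamma Sigma _ r mu1 mu2 (- 1 - x1) (- 1 - x2) Hadm Hr HSr).
      2:{ intros w z Hw Hz Hwz. replace (- (- 1 - x2) - 1)%Z with x2 by lia.
          replace (- 1 - x1)%Z with (- (x1 + 1))%Z by lia. rewrite CpowZ_opp by exact Hw.
          assert (K1 := Cminus_eq_contra _ _ Hwz). assert (K2 := CpowZ_neq_0 w (x1 + 1) Hw).
          assert (K3 : gauss_weight mu1 w <> RtoC 0) by apply Cexp_neq_0.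
          field. tauto. }
      rewrite single_int_0. f_equal; [|ring].
      replace (chi (Z_le_dec (- (x1 - x2)) 0)) with (chi (Z_le_dec x2 x1))
        by (unfold chi; destruct (Z_le_dec (- (x1 - x2)) 0), (Z_le_dec x2 x1); lia || reflexivity).
      replace (- - (x1 - x2))%Z with (x1 - x2)%Z by lia.
      rewrite !RtoC_mult. field. exact H2pi.
  - intros Hn1 Hn2.
    replace (RtoC 0) with (- (RtoC (chi (Rlt_dec mu1 mu2)) / two_pi_i) * RtoC 0
      + / two_pi_i ^ 2 * (RtoC 0 + RtoC 0))%C by ring.
    unfold gauge. destruct (Z_lt_dec x1 0) as [H1|H1], (Z_lt_dec x2 0) as [H2|H2]; try lia.
    + (* x1 < 0 <= x2: the exponents are 2 x2 + 1, 2 x2 + 1 and 1. *)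
      eapply (kernel_limit Gamma Sigma mu1 mu2 x1 x2 _ _ _ _ r).
      * exact Hadm.
      * exact Hr.
      * exact HSr.
      * exact Es.
      * exact (Eo x1 x2).
      * exact (Ei (- 1 - x1) (- 1 - x2))%Z.
      * eapply tends_0_vanish; [lia | apply Hsin].
      * eapply tends_0_vanish; [lia | apply Hout].
      * eapply tends_0_vanish; [lia | apply Hinn].
    + (* x2 < 0 <= x1: the exponents are - 2 x2 - 1, 1 and - 2 x2 - 1. *)
      eapply (kernel_limit Gamma Sigma mu1 mu2 x1 x2 _ _ _ _ r).
      * exact Hadm.
      * exact Hr.
      * exact HSr.
      * exact Esi.
      * exact (Ei x1 x2).
      * exact (Eo (- 1 - x1) (- 1 - x2))%Z.
      * eapply tends_0_vanish; [lia | apply Hsin].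
      * eapply tends_0_vanish; [lia | apply Hinn].
      * eapply tends_0_vanish; [lia | apply Hout].
Qed.
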